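(* Let $M=(M_k)$ be a non-quasianalytic log-convex positive sequence and let $X\subseteq\mathbb{R}^d$ be a Lipschitz set. Then \[ \mathcal{C}^M(X)\subseteq\mathcal{A}^M(X)\subseteq\mathcal{C}^{M^{(2)}}(X), \] where $M^{(2)}$ is the sequence $M^{(2)}_k:=M_{2k}$.
   Context: $M$ is non-quasianalytic if $\sum_k M_k/((k+1)M_{k+1})<\infty$. For a positive sequence $N$, $\mathcal{C}^N(\mathbb{R},\mathbb{R}^m)$ is the set of smooth $c$ such that for every compact $K\subseteq\mathbb{R}$ there are $C,\rho>0$ with $|c^{(k)}(t)|\le C\rho^k k!\,N_k$ for all $k$, $t\in K$. $\mathcal{A}^M(X)$ is the set of $f:X\to\mathbb{R}$ with $f\circ c\in\mathcal{C}^M(\mathbb{R},\mathbb{R})$ for every $c\in\mathcal{C}^M(\mathbb{R},\mathbb{R}^d)$ with $c(\mathbb{R})\subseteq X$. $\mathcal{C}^\infty(X)$ is the set of $f:X\to\mathbb{R}$ that locally near each point of $X$ are restrictions of smooth functions on open subsets of $\mathbb{R}^d$; since $X$ is fat, the Fréchet derivatives $f^{(k)}(x)\in L_k(\mathbb{R}^d,\mathbb{R})$ are well defined on $X$. $\mathcal{C}^N(X)$ is the set of $f\in\mathcal{C}^\infty(X)$ such that for every compact $K\subseteq X$ there are $C,\rho>0$ with $\|f^{(k)}(x)\|_{L_k(\mathbb{R}^d,\mathbb{R})}\le C\rho^k k!\,N_k$ for all $k\in\mathbb{N}$, $x\in K$. Lipschitz set: for $r,h>0$ let $\Gamma_d(r,h)=\{(x',x_d)\in\mathbb{R}^{d-1}\times\mathbb{R}: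 |x'|<r,\ h|x'|/r<x_d<h\}$ (truncated open cone). An open $U$ has the uniform cone property if for every $x\in\partial U$ there are $\epsilon>0$, some $\Gamma=\Gamma_d(r,h)$ and $A\in O(d)$ with $y+A\Gamma\subseteq U$ for all $y\in\overline U\cap B(x,\epsilon)$. A Lipschitz set is a closed set $X$ with $X=\overline{\mathrm{int}(X)}\neq\emptyset$ such that $\mathrm{int}(X)$ has the uniform cone property. *)

(* Defs.v *)
From HB Require Import structures.
From mathcomp Require Import all_boot all_order all_algebra.
From mathcomp Require Import all_classical all_reals all_analysis.
Set Implicit Arguments. Unset Strict Implicit. Unset Printing Implicit Defensive.
Import Order.TTheory GRing.Theory Num.Theory.
Import numFieldNormedType.Exports.
Local Open Scope classical_set_scope.
Local Open Scope ring_scope.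

Section Defs.
Variable R : realType.

Definition positive_seq (M : nat -> R) : Prop := forall k, 0 < M k.

Definition log_convex (M : nat -> R) : Prop :=
  forall k, M k.+1 ^+ 2 <= M k * M k.+2.

Definition non_quasianalytic (M : nat -> R) : Prop :=
  cvgn (series (fun k => M k / (k.+1%:R * M k.+1))).

Definition smooth_curve (V : normedModType R) (c : R -> V) : Prop :=
  forall (k : nat) (t : R), derivable (derive1n k c) t 1.

Definition CN_curve (V : normedModType R) (N : nat -> R) (c : R -> V) : Prop :=
  smooth_curve c /\
  forall K : set R, compact K ->
    exists C rho : R, 0 < C /\ 0 < rho /\
      forall (k : nat) (t : R), K t ->
        `| derive1n k c t | <= C * rho ^+ k * k`!%:R * N k.

Definition eucl (m : nat) (x : 'rV[R]_m) : R :=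
  Num.sqrt (\sum_(i < m) x ord0 i ^+ 2).

Definition eucl_head (n : nat) (x : 'rV[R]_n.+1) : R :=
  Num.sqrt (\sum_(i < n.+1 | i != ord_max) x ord0 i ^+ 2).

Definition cone (n : nat) (r h : R) : set 'rV[R]_n.+1 :=
  [set x | eucl_head x < r /\ h * eucl_head x / r < x ord0 ord_max
           /\ x ord0 ord_max < h].

Definition orthogonal (n : nat) (A : 'M[R]_n) : Prop := A *m A^T = 1%:M.

(* uniform cone property of an open set U (boundary = closure U minus U) *)
Definition uniform_cone (n : nat) (U : set 'rV[R]_n.+1) : Prop :=
  forall x, closure U x -> ~ U x ->
    exists (eps r h : R) (A : 'M[R]_n.+1),
      0 < eps /\ 0 < r /\ 0 < h /\ orthogonal A /\
      forall y, closure U y -> eucl (y - x) < eps ->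
        forall z, cone r h z -> U (y + z *m A).

Definition lipschitz_set (n : nat) (X : set 'rV[R]_n.+1) : Prop :=
  closed X /\ X = closure (interior X) /\ X !=set0 /\ uniform_cone (interior X).

(* iterated directional derivative  d^k g (x) (v_1,...,v_k) *)
Definition iterD (m : nat) (vs : seq 'rV[R]_m) (g : 'rV[R]_m -> R) : 'rV[R]_m -> R :=
  foldr (fun v h => 'D_v h) g vs.

Definition smooth_on (m : nat) (U : set 'rV[R]_m) (g : 'rV[R]_m -> R) : Prop :=
  forall (vs : seq 'rV[R]_m) x, U x -> differentiable (iterD vs g) x.

Definition local_ext (m : nat) (X : set 'rV[R]_m) (f : 'rV[R]_m -> R)
    (x : 'rV[R]_m) (U : set 'rV[R]_m) (g : 'rV[R]_m -> R) : Prop :=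
  open U /\ U x /\ smooth_on U g /\ forall y, U y -> X y -> f y = g y.

Definition Cinf_set (m : nat) (X : set 'rV[R]_m) : set ('rV[R]_m -> R) :=
  [set f | forall x, X x -> exists U g, local_ext X f x U g].

(* C^N(X): derivatives f^(k)(x) (computed through any local smooth extension,
   which is well defined since X is fat) satisfy
   ||f^(k)(x)||_{L_k} <= C rho^k k! N_k on compacts; the operator norm is
   the sup over Euclidean unit vectors v_1..v_k. *)
Definition CN_set (m : nat) (N : nat -> R) (X : set 'rV[R]_m) : set ('rV[R]_m -> R) :=
  [set f | Cinf_set X f /\
    forall K, K `<=` X -> compact K ->
      exists C rho : R, 0 < C /\ 0 < rho /\
        forall (k : nat) x U g (vs : seq 'rV[R]_m),
          K x -> local_ext X f x U g -> size vs = k ->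
          (forall v, v \in vs -> eucl v <= 1) ->
          `| iterD vs g x | <= C * rho ^+ k * k`!%:R * N k].

Definition AM_set (m : nat) (M : nat -> R) (X : set 'rV[R]_m) : set ('rV[R]_m -> R) :=
  [set f : 'rV[R]_m -> R | forall c : R -> 'rV[R]_m, CN_curve M c -> (forall t, X (c t)) ->
             CN_curve M (fun t => f (c t))].

End Defs.

(* Main.v *)
(* The first inclusion is the Faa di Bruno estimate: by induction on [k], the
   [k]-th derivative of [iterD vs g] along a curve of class [M] is at most
   [A s^p t^k (p + k)! M_(p+k)], [p = size vs], by log-convexity of [M].

   For the second one, let [f] be in [AM_set M X] and [x0] in [X].  Near [x0]
   the set [X] is stable under moving along the directions [v] of a fixed open
   cone.  If the [k]-th derivatives at [0] of [t |-> f (y + t^2 v)] did not obey a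
   uniform bound [C rho^k k! M_k], bump functions of class [M] (which exist since
   [M] is non-quasianalytic) would string counterexamples together into a
   single curve contradicting the hypothesis.  Substituting [s = t^2] bounds the
   [k]-th derivative of [s |-> f (y + s v)] by [C rho^k k! M_(2k)].

   In a basis of such directions [f] is thus smooth along the positive axes,
   with bounds uniform up to the boundary.  A local smooth extension is the sum
   of a series: at scale [2^-j] one glues, by a partition of unity, the
   tensor products of Lagrange polynomials of degree [k_j] at nodes shifted
   into [X], where [k_j] grows slowly to infinity; the difference of two successive
   approximants is rewritten so that only interpolation errors at points of [X]
   occur, and these are [O(2^(-j (k_j + 1)))].

   Finally the symmetric multilinear form [f^(k)(x)] is bounded by polarization
   from its values on the open cone, and compactness globalises the bounds. *)
Require Import Defs.
From HB Require Import structures.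
From mathcomp Require Import all_boot all_order all_algebra.
From mathcomp Require Import all_classical all_reals all_analysis.
From mathcomp Require Import ring lra zify.
Import Order.TTheory GRing.Theory Num.Theory.
Import numFieldNormedType.Exports.
Local Open Scope classical_set_scope.
Local Open Scope ring_scope.
Set Implicit Arguments.
Unset Strict Implicit.
Unset Printing Implicit Defensive.

(** The squares answer an obstacle at the boundary: [y + t v] leaves [X] for [t < 0], while
    [y + t^2 v] stays in it. The price is that order k on a ray appears as order 2k on the curve,
    whence M_(2k). Rescaling one bump to width w would introduce a factor w^(-k). The bumps built
    here have arbitrarily small width and still satisfy [C k! M_k] without geometric factor; only
    [C] depends on the width, and a small scalar in front of each piece of the curve absorbs it. The
    extension need only be smooth. Its derivatives on [X] are limits of derivatives of [f] along
    rays entering [X], so the bounds hold for every local extension, whatever its construction. That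
    construction cannot start from Taylor jets, since nothing is known about mixed derivatives of
    [f] at the boundary; interpolation uses values of [f] only. A term at scale 2^(-j)
    differentiated p times costs 2^(jp), so the degrees must pass every p; but the constants
    attached to a degree have no controlled growth, so the degrees must rise slowly. *)

Local Notation iterD := Defs.iterD.

(** * Jets *)

Section Jets.
Context {R : realType}.

(** A jet is a list of formulas for the successive derivatives. Sums, products and series are
    differentiated on jets, and [derive1n] is identified with a jet afterwards, on an open set. The
    truncated version serves where the list is built by induction on its length. *)
Definition jetn (V : normedModType R) (I : set R) (n : nat) (u : nat -> R -> V) :=
  forall k t, (k < n)%N -> I t -> is_derive t (1 : R) (u k) (u k.+1 t).

Definition jet (V : normedModType R) (I : set R) (u : nat -> R -> V) :=
  forall k t, I t -> is_derive t (1 : R) (u k) (u k.+1 t).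

Lemma jet_jetn (V : normedModType R) I (u : nat -> R -> V) n : jet I u -> jetn I n u.
Proof. by move=> ju k t _ It; exact: ju. Qed.

Lemma derive1n_jetn (V : normedModType R) (I : set R) n (u : nat -> R -> V) (c : R -> V) :
  open I -> jetn I n u -> (forall t, I t -> c t = u 0%N t) ->
  forall k, (k <= n)%N -> forall t, I t -> derive1n k c t = u k t.
Proof.
move=> oI ju cu; elim=> [_ t It|k IH kn t It]; first exact: cu.
rewrite derive1nS derive1E.
have := ju k t kn It; case=> _ <-; apply: near_eq_derive.
have : \forall s \near t, I s by exact: open_nbhs_nbhs.
by apply: filterS => s Is; rewrite IH// ltnW.
Qed.

Lemma derivable_jetn (V : normedModType R) (I : set R) n (u : nat -> R -> V) (c : R -> V) :
  open I -> jetn I n u -> (forall t, I t -> c t = u 0%N t) ->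
  forall k, (k < n)%N -> forall t, I t -> derivable (derive1n k c) t 1.
Proof.
move=> oI ju cu k kn t It.
have := ju k t kn It; case=> + _; apply: near_eq_derivable.
have : \forall s \near t, I s by exact: open_nbhs_nbhs.
by apply: filterS => s Is /=; rewrite (derive1n_jetn oI ju cu)// ltnW.
Qed.

Lemma derive1n_jet (V : normedModType R) (I : set R) (u : nat -> R -> V) (c : R -> V) :
  open I -> jet I u -> (forall t, I t -> c t = u 0%N t) ->
  forall k t, I t -> derive1n k c t = u k t.
Proof.
by move=> oI ju cu k t It; apply: (derive1n_jetn oI (jet_jetn (n := k) ju) cu).
Qed.

Lemma jet_derive1n (V : normedModType R) (I : set R) (c : R -> V) :
  (forall k t, I t -> derivable (derive1n k c) t 1) -> jet I (fun k => derive1n k c).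
Proof.
by move=> dc k t It; apply: DeriveDef; [exact: dc|rewrite derive1nS derive1E].
Qed.

Lemma is_derive_affine (V : normedModType R) (u : R -> V) (a b t : R) (du : V) :
  is_derive (a * t + b) 1 u du -> is_derive t 1 (fun s => u (a * s + b)) (a *: du).
Proof.
move=> du1.
have dg : is_diff t (fun s : R => a * s + b) (fun s => a * s).
  have -> : (fun s : R => a * s + b) = ( *:%R a) + cst b by apply/funext => s.
  have -> : (fun s : R => a * s) = ( *:%R a : R -> R) + 0.
    by apply/funext => s /=; rewrite addr0.
  exact: is_diffD.
have du2 : differentiable u (a * t + b).
  by apply/derivable1_diffP; case: du1.
have d3 : differentiable (u \o (fun s : R => a * s + b)) t.
  by apply: differentiable_comp; [exact: ex_diff|exact: du2].
apply: DeriveDef; first exact/derivable1_diffP.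
rewrite -[LHS]/('D_1 (u \o (fun s : R => a * s + b)) t) deriveE//.
rewrite diff_comp//=.
rewrite diff_val -[a * 1]/(a *: (1 : R)) linearZ/=; congr (_ *: _).
by rewrite -deriveE//; case: du1.
Qed.

Lemma jet_affine (V : normedModType R) (I J : set R) (u : nat -> R -> V) (a b : R) :
  jet I u -> (forall t, J t -> I (a * t + b)) ->
  jet J (fun k t => a ^+ k *: u k (a * t + b)).
Proof.
move=> ju IJ k t Jt.
have -> : a ^+ k.+1 *: u k.+1 (a * t + b) = a ^+ k *: (a *: u k.+1 (a * t + b)).
  by rewrite scalerA -exprSr.
by apply: is_deriveZ; apply: is_derive_affine; apply: ju; exact: IJ.
Qed.

Lemma jetD (V : normedModType R) I (u v : nat -> R -> V) :
  jet I u -> jet I v -> jet I (fun k t => u k t + v k t).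
Proof. by move=> ju jv k t It; apply: is_deriveD; [exact: ju|exact: jv]. Qed.

Lemma jetB (V : normedModType R) I (u v : nat -> R -> V) :
  jet I u -> jet I v -> jet I (fun k t => u k t - v k t).
Proof. by move=> ju jv k t It; apply: is_deriveB; [exact: ju|exact: jv]. Qed.

Lemma jetZ (V : normedModType R) I (a : R) (u : nat -> R -> V) :
  jet I u -> jet I (fun k t => a *: u k t).
Proof. by move=> ju k t It; apply: is_deriveZ; exact: ju. Qed.

(* The [k]-th derivative of a product, as a function of the two jets. *)
Fixpoint jmul (k : nat) (u v : nat -> R -> R) : R -> R :=
  if k is k'.+1 then
    fun t => jmul k' (fun i => u i.+1) v t + jmul k' u (fun i => v i.+1) t
  else fun t => u 0%N t * v 0%N t.

Lemma is_derive_jmul k t (u v : nat -> R -> R) :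
  (forall i, (i <= k)%N -> is_derive t (1 : R) (u i) (u i.+1 t)) ->
  (forall i, (i <= k)%N -> is_derive t (1 : R) (v i) (v i.+1 t)) ->
  is_derive t (1 : R) (jmul k u v) (jmul k.+1 u v t).
Proof.
elim: k u v => [|k IH] u v hu hv.
  rewrite [X in is_derive _ _ X](_ : _ = u 0%N * v 0%N)//=.
  apply: is_derive_eq; first by apply: is_deriveM; [exact: hu|exact: hv].
  by rewrite /= addrC; congr (_ + _); rewrite -[LHS]/(_ * _) mulrC.
rewrite [jmul k.+2 u v t]/= -/(jmul k.+1 (fun i => u i.+1) v t).
rewrite [X in is_derive _ _ X](_ : _ =
   jmul k (fun i => u i.+1) v + jmul k u (fun i => v i.+1))//.
apply: is_deriveD.
- by apply: IH => i ik; [exact: hu|apply: hv; rewrite leqW].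
- by apply: IH => i ik; [apply: hu; rewrite leqW|exact: hv].
Qed.

Lemma jetn_jmul I n (u v : nat -> R -> R) :
  jetn I n u -> jetn I n v -> jetn I n (fun k => jmul k u v).
Proof.
move=> ju jv k t kn It; apply: is_derive_jmul => i ik.
  by apply: ju => //; exact: leq_ltn_trans kn.
by apply: jv => //; exact: leq_ltn_trans kn.
Qed.

Lemma jet_jmul I (u v : nat -> R -> R) :
  jet I u -> jet I v -> jet I (fun k => jmul k u v).
Proof.
by move=> ju jv k t It; apply: is_derive_jmul => i ik; [exact: ju|exact: jv].
Qed.

(** Leibniz's formula, by Pascal's rule. The recursive form is the one that is easy to
    differentiate, this one the one that is easy to estimate. *)
Lemma jmulE k (u v : nat -> R -> R) t :
  jmul k u v t = \sum_(j < k.+1) 'C(k, j)%:R * (u j t * v (k - j)%N t).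
Proof.
elim: k u v => [|k IH] u v; first by rewrite big_ord1 /= mul1r.
rewrite /= IH IH /=.
rewrite [in RHS]big_ord_recl [in X in _ + X = _]big_ord_recl /=.
rewrite !bin0 !subn0 !mul1r [LHS]addrCA; congr (_ + _).
rewrite big_ord_recr [X in _ + X = _](_ : _ =
   \sum_(i < k) 'C(k, i.+1)%:R * (u i.+1 t * v (k - i)%N t)); last first.
  apply: eq_bigr => i _; rewrite /bump /= add1n.
  by rewrite -subSn ?subSS.
rewrite [in RHS]big_ord_recr /= !binn /bump /= !add1n ?binn !subnn ?subSS ?subnn.
rewrite addrAC; congr (_ + _); rewrite -big_split /=; apply: eq_bigr => i _.
by rewrite /bump /= add1n subSS -mulrDl -natrD binS addnC.
Qed.

Lemma jmul_bound k (u v : nat -> R -> R) (a b : nat -> R) t :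
  (forall i, (i <= k)%N -> `|u i t| <= a i) -> (forall i, (i <= k)%N -> `|v i t| <= b i) ->
  `|jmul k u v t| <= \sum_(j < k.+1) 'C(k, j)%:R * (a j * b (k - j)%N).
Proof.
move=> ha hb; rewrite jmulE; apply: (le_trans (ler_norm_sum _ _ _)).
apply: ler_sum => j _; rewrite !normrM ger0_norm//.
apply: ler_wpM2l => //; apply: ler_pM => //.
  by apply: ha; rewrite -ltnS.
by apply: hb; rewrite leq_subr.
Qed.

End Jets.
(** * The inclusion of C^M(X) in A^M(X) *)

Section LogConvex.
Context {R : realType}.
Variable M : nat -> R.
Hypotheses (M0 : positive_seq M) (Mlc : log_convex M).

Lemma log_convex_ratio k j : M k.+1 * M (k + j)%N <= M k * M (k + j).+1.
Proof.
elim: j => [|j IH]; first by rewrite addn0 mulrC.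
rewrite addnS -(ler_pM2r (M0 (k + j)%N)).
apply: (@le_trans _ _ (M k * M (k + j).+1 * M (k + j).+1)).
  by rewrite mulrAC ler_wpM2r// ltW.
rewrite -!mulrA; apply: ler_wpM2l; first exact/ltW/M0.
by rewrite -expr2 [leRHS]mulrC; exact: Mlc.
Qed.

(** With M_1 as base the total order drops by one. The chain rule calls for this: the orders p+1+j
    and k-j+1 of its two factors add up to one more than the order p+k+1 of the result. *)
Lemma log_convex_mul a l : M a.+1 * M l.+1 <= M 1 * M (a + l).+1.
Proof.
elim: a => [|a IH]; first by rewrite add0n.
rewrite -(ler_pM2r (M0 a.+1)) addSn.
apply: (@le_trans _ _ (M a.+2 * (M 1 * M (a + l).+1))).
  by rewrite -mulrA; apply: ler_wpM2l; [exact/ltW/M0|rewrite mulrC].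
rewrite mulrCA -mulrA; apply: ler_wpM2l; first exact/ltW/M0.
rewrite [leRHS]mulrC.
by have := log_convex_ratio a.+1 l; rewrite addSn.
Qed.

Lemma log_convex_le k : M k <= M 0 / M 1 * M k.+1.
Proof.
rewrite mulrAC ler_pdivlMr// mulrC.
by have := log_convex_ratio 0 k; rewrite add0n.
Qed.

End LogConvex.

Section CompositionEstimate.
Context {R : realType}.

(** Since C(k,j) (k-j)! = k!/j!, division by (k-j+1) (p+1)! k! leaves the monotonicity of C(p+1+i,
    p+1) in i. *)
Lemma bin_fact_le k j p : (j <= k)%N ->
  ('C(k, j) * ((k - j).+1`! * (p + j).+1`!) <= (k - j).+1 * (p + k).+1`!)%N.
Proof.
move=> jk.
have kj : ('C(k, j) * (j`! * (k - j)`!) = k`!)%N by exact: bin_fact.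
have e (i : nat) : ((p + i).+1`! = 'C(p.+1 + i, p.+1) * (p.+1`! * i`!))%N.
  have := @bin_fact (p.+1 + i) p.+1 (leq_addr _ _).
  by rewrite addKn addSn => ->.
rewrite !e factS.
have := @leq_bin2l (p.+1 + j) (p.+1 + k) p.+1; rewrite leq_add2l => /(_ jk) h.
rewrite -(leq_pmul2r (fact_gt0 j)).
apply: (@leq_trans ((k - j).+1 * (p.+1`! * j`! * k`!) * 'C(p.+1 + j, p.+1))).
  by rewrite -kj; apply: eq_leq; ring.
apply: (@leq_trans ((k - j).+1 * (p.+1`! * j`! * k`!) * 'C(p.+1 + k, p.+1))).
  by rewrite leq_mul2l h orbT.
by apply: eq_leq; ring.
Qed.

Lemma geometric_convolution (q t : R) k : 0 <= q -> 2 * q <= t ->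
  \sum_(j < k.+1) t ^+ j * q ^+ (k - j)%N <= 2 * t ^+ k.
Proof.
move=> q0 qt; have t0 : 0 <= t by apply: le_trans qt; rewrite mulr_ge0.
elim: k => [|k IH]; first by rewrite big_ord1 subnn !expr0; lra.
rewrite big_ord_recr /= subnn expr0 mulr1.
under eq_bigr => j _ do rewrite subSn -1?ltnS// exprS mulrCA.
rewrite -mulr_sumr.
have h1 : q * (\sum_(j < k.+1) t ^+ j * q ^+ (k - j)%N) <= q * (2 * t ^+ k).
  by rewrite ler_wpM2l.
have h2 : 2 * q * t ^+ k <= t * t ^+ k by rewrite ler_wpM2r// exprn_ge0.
by rewrite exprS; lra.
Qed.

Variable M : nat -> R.
Hypotheses (M0 : positive_seq M) (Mlc : log_convex M).

Definition comp_bound (A s t : R) p k :=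
  A * s ^+ p * t ^+ k * (p + k)`!%:R * M (p + k)%N.

(** This is one application of the chain rule, summed over d coordinates and expanded by Leibniz.
    The factor k-j+1 of [bin_fact_le] is absorbed into 2^(k-j+1), which turns r into 2r. The
    convolution then asks for t >= 4r and doubles, so that the whole sum costs 4 r d s C M_1; this
    dictates [t]. *)
Lemma comp_bound_step (A s C r t : R) (d p k : nat) :
  0 < A -> 0 < s -> 0 < C -> 0 < r -> t = 4 * r * (1 + d%:R * s * C * M 1) ->
  d%:R * (\sum_(j < k.+1) 'C(k, j)%:R *
     (comp_bound A s t p.+1 j *
      (C * r ^+ (k - j).+1 * (k - j).+1`!%:R * M (k - j).+1)))
  <= comp_bound A s t p k.+1.
Proof.
move=> A0 s0 C0 r0 tE.
have M1 : 0 < M 1 by [].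
have dsCM : 0 <= d%:R * s * C * M 1 by rewrite !mulr_ge0// ltW.
have t0 : 0 < t by rewrite tE mulr_gt0// ?mulr_gt0//; lra.
have rt : 2 * (2 * r) <= t.
  rewrite tE mulrA -[X in X <= _]mulr1; have -> : 2 * 2 = 4 :> R by lra.
  by rewrite ler_wpM2l; [lra|rewrite mulr_ge0// ltW|lra].
pose Q := A * s ^+ p * (p + k).+1`!%:R * M (p + k).+1.
have Q0 : 0 <= Q by rewrite /Q !mulr_ge0// ?exprn_ge0// ltW.
have term (j : 'I_k.+1) : 'C(k, j)%:R *
     (comp_bound A s t p.+1 j *
      (C * r ^+ (k - j).+1 * (k - j).+1`!%:R * M (k - j).+1)) <=
   (Q * s * C * M 1 * (2 * r)) * (t ^+ j * (2 * r) ^+ (k - j)).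
  have jk : (j <= k)%N by rewrite -ltnS.
  have h1 : M (p + j).+1 * M (k - j).+1 <= M 1 * M (p + k).+1.
    by apply: le_trans (log_convex_mul M0 Mlc _ _) _; rewrite -addnA subnKC.
  have h2 : 'C(k, j)%:R * ((k - j).+1`!%:R * (p + j).+1`!%:R) <=
            (2 : R) ^+ (k - j).+1 * (p + k).+1`!%:R.
    rewrite -!natrM.
    apply: (@le_trans _ _ ((k - j).+1 * (p + k).+1`!)%:R).
      by rewrite ler_nat bin_fact_le.
    by rewrite natrM ler_wpM2r// -natrX ler_nat ltnW// ltn_expl.
  rewrite /comp_bound addSn.
  have -> : 'C(k, j)%:R * (A * s ^+ p.+1 * t ^+ j * (p + j).+1`!%:R * M (p + j).+1 *
      (C * r ^+ (k - j).+1 * (k - j).+1`!%:R * M (k - j).+1)) =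
     ((A * s ^+ p.+1 * t ^+ j * C * r ^+ (k - j).+1) *
     (('C(k, j)%:R * ((k - j).+1`!%:R * (p + j).+1`!%:R)) *
     (M (p + j).+1 * M (k - j).+1))) by ring.
  have -> : (Q * s * C * M 1 * (2 * r)) * (t ^+ j * (2 * r) ^+ (k - j)) =
    ((A * s ^+ p.+1 * t ^+ j * C * r ^+ (k - j).+1) *
     ((2 ^+ (k - j).+1 * (p + k).+1`!%:R) * (M 1 * M (p + k).+1))).
    by rewrite /Q exprMn !exprS; ring.
  apply: ler_wpM2l; first by rewrite !mulr_ge0// ?exprn_ge0// ltW.
  by apply: ler_pM => //; rewrite !mulr_ge0// ltW.
apply: (@le_trans _ _ (d%:R * ((Q * s * C * M 1 * (2 * r)) * (2 * t ^+ k)))).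
  rewrite ler_wpM2l//; apply: (le_trans (ler_sum _ (fun j _ => term j))).
  rewrite -mulr_sumr; apply: ler_wpM2l.
    by repeat apply: mulr_ge0 => //; exact: ltW.
  by apply: geometric_convolution rt; rewrite mulr_ge0// ltW.
rewrite /comp_bound addnS.
have -> : A * s ^+ p * t ^+ k.+1 * (p + k).+1`!%:R * M (p + k).+1 = Q * t ^+ k * t.
  by rewrite /Q exprS; ring.
have -> : d%:R * ((Q * s * C * M 1 * (2 * r)) * (2 * t ^+ k)) =
  Q * t ^+ k * (4 * r * (d%:R * s * C * M 1)) by ring.
apply: ler_wpM2l; first by apply: mulr_ge0 => //; rewrite exprn_ge0// ltW.
by rewrite [leRHS]tE; apply: ler_wpM2l; [rewrite mulr_ge0// ltW|lra].
Qed.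

End CompositionEstimate.

Section CurveComposition.
Context {R : realType}.
Variable n : nat.
Implicit Types (c : R -> 'rV[R]_n.+1) (g : 'rV[R]_n.+1 -> R).

Lemma le_coord_norm m (x : 'rV[R]_m) i : `|x ord0 i| <= `|x|.
Proof.
rewrite [leRHS]/Num.Def.normr/= mx_normrE.
by apply: le_trans (le_bigmax _ _ (ord0, i)).
Qed.

Lemma rV_norm_le m (x : 'rV[R]_m) (e : R) : 0 <= e ->
  (forall i, `|x ord0 i| <= e) -> `|x| <= e.
Proof.
move=> e0 h; rewrite /Num.Def.normr/= mx_normrE; apply: bigmax_le => //.
by case=> i j _ /=; rewrite (ord1 i).
Qed.

Lemma eucl_delta m (i : 'I_m) : eucl (delta_mx ord0 i : 'rV[R]_m) = 1.
Proof.
rewrite /eucl (bigD1 i)//= big1 ?addr0; last first.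
  by move=> j ji; rewrite mxE (negPf ji) /= expr0n.
by rewrite mxE !eqxx expr1n sqrtr1.
Qed.

Lemma le_eucl m (x : 'rV[R]_m) : `|x| <= eucl x.
Proof.
apply: rV_norm_le => [|i]; first exact: sqrtr_ge0.
rewrite -sqrtr_sqr ler_wsqrtr// (bigD1 i)//= lerDl sumr_ge0// => j _.
exact: sqr_ge0.
Qed.

Lemma eucl_le m (x : 'rV[R]_m) : eucl x <= m%:R * `|x|.
Proof.
rewrite /eucl -[leRHS]ger0_norm ?mulr_ge0// -sqrtr_sqr ler_wsqrtr//.
apply: (@le_trans _ _ (m%:R * `|x| ^+ 2)).
  rewrite mulr_natl -[X in _ *+ X]card_ord -sumr_const; apply: ler_sum => i _.
  by rewrite -real_normK ?num_real// ler_sqr ?nnegrE// le_coord_norm.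
rewrite exprMn ler_wpM2r ?sqr_ge0// -natrX ler_nat.
by case: (m) => // k; rewrite leq_pmull.
Qed.

Lemma is_derive_rV_coord m (c : R -> 'rV[R]_m) t dc i :
  is_derive t (1 : R) c dc -> is_derive t (1 : R) (fun s => c s ord0 i) (dc ord0 i).
Proof.
case=> dct <-; apply: DeriveDef; first by move/derivable_mxP : dct; apply.
by rewrite derive_mx// mxE.
Qed.

Lemma is_derive_rV m (c : R -> 'rV[R]_m) t (dc : 'rV[R]_m) :
  (forall i, is_derive t (1 : R) (fun s => c s ord0 i) (dc ord0 i)) ->
  is_derive t (1 : R) c dc.
Proof.
move=> h; have dct : derivable c t 1.
  by apply/derivable_mxP => i j; rewrite (ord1 i); case: (h j).
apply: DeriveDef => //; rewrite derive_mx//; apply/rowP => j; rewrite mxE.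
by case: (h j).
Qed.

Lemma is_derive_comp_curve c g t (dc : 'rV[R]_n.+1) :
  differentiable g (c t) -> is_derive t (1 : R) c dc ->
  is_derive t (1 : R) (fun s => g (c s))
    (\sum_(i < n.+1) 'D_(delta_mx ord0 i) g (c t) * dc ord0 i).
Proof.
move=> dg [dct <-].
have dct1 : differentiable c t by exact/derivable1_diffP.
apply: DeriveDef.
  by apply/derivable1_diffP; exact: differentiable_comp.
rewrite -[LHS]/('D_1 (g \o c) t) deriveE; last exact: differentiable_comp.
rewrite diff_comp//=; rewrite -(deriveE _ dct1) [X in 'd g (c t) X]row_sum_delta linear_sum.
by apply: eq_bigr => i _; rewrite linearZ /= (deriveE _ dg) mulrC.
Qed.

(** The derivative of [iterD vs g] along [c] involves [iterD (e_i :: vs) g], so the induction on the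
    length [N] treats all [vs] at once. The estimates are assumed at the single point [t]: the jet
    lives on an open set, while the constants are valid on a compact set only. *)
Lemma comp_curve_jet (M : nat -> R) (A s C r : R) c g (U : set 'rV[R]_n.+1) N
    (vs : seq 'rV[R]_n.+1) :
  positive_seq M -> log_convex M -> 0 < A -> 0 < s -> 0 < C -> 0 < r ->
  smooth_curve c -> smooth_on U g ->
  exists u : nat -> R -> R,
    [/\ jetn (c @^-1` U) N u, u 0%N = (fun t => iterD vs g (c t)) &
      forall t, U (c t) ->
        (forall j, `|derive1n j c t| <= C * r ^+ j * j`!%:R * M j) ->
        (forall ws, (forall v, v \in ws -> eucl v <= 1) ->
           `|iterD ws g (c t)| <= A * s ^+ (size ws) * (size ws)`!%:R * M (size ws)) ->
        (forall v, v \in vs -> eucl v <= 1) ->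
        forall k, (k <= N)%N ->
          `|u k t| <= comp_bound M A s (4 * r * (1 + n.+1%:R * s * C * M 1))
                        (size vs) k].
Proof.
move=> M0 Mlc A0 s0 C0 r0 sc sg; elim: N vs => [|N IH] vs.
  exists (fun k t => iterD vs g (c t)); split=> // t Ut cb gb vsb k.
  rewrite leqn0 => /eqP ->; rewrite /comp_bound addn0 expr0 mulr1.
  exact: gb.
have {IH}/choice[u hu] (i : 'I_n.+1) := IH (delta_mx ord0 i :: vs).
pose cc (i : 'I_n.+1) k t := (derive1n k.+1 c t) ord0 i.
pose w k t := if k is k'.+1 then \sum_(i < n.+1) jmul k' (u i) (cc i) t
  else iterD vs g (c t).
have dc k t : is_derive t (1 : R) (derive1n k c) (derive1n k.+1 c t).
  by apply: DeriveDef; [exact: sc|rewrite derive1nS derive1E].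
have jcc i : jetn (c @^-1` U) N (cc i).
  move=> k t _ _; apply: is_derive_rV_coord; exact: dc.
exists w; split=> //.
  case=> [|k] t; rewrite ?ltnS => kN Ut.
    rewrite /w; apply: is_derive_eq.
      by apply: (is_derive_comp_curve (sg vs _ Ut)); exact: (dc 0%N).
    by apply: eq_bigr => i _ /=; have [_ -> _] := hu i.
  rewrite [X in is_derive _ _ X](_ : _ = \sum_(i < n.+1) jmul k (u i) (cc i)); last first.
    by apply/funext => x; rewrite /= fct_sumE.
  apply: is_derive_sum => i.
  by apply: (jetn_jmul (n := N)) => //; have [] := hu i.
move=> t Ut cb gb vsb [|k] kN.
  by rewrite /comp_bound addn0 expr0 mulr1 /=; exact: gb.
apply: (le_trans _ (comp_bound_step M0 Mlc (size vs) k A0 s0 C0 r0 erefl)).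
rewrite /= mulr_natl -[X in _ *+ X]card_ord -sumr_const.
apply: (le_trans (ler_norm_sum _ _ _)); apply: ler_sum => i _.
have [_ _ hb] := hu i.
apply: (@jmul_bound _ _ _ _ _ (fun j => C * r ^+ j.+1 * j.+1`!%:R * M j.+1)) => j jk.
  apply: hb => //; last exact: leq_trans jk _.
  by move=> v; rewrite inE => /orP[/eqP ->|/vsb//]; rewrite eucl_delta.
by apply: le_trans (le_coord_norm _ _) _; exact: cb.
Qed.

Lemma CN_set_sub_AM_set (M : nat -> R) (X : set 'rV[R]_n.+1) :
  positive_seq M -> log_convex M -> CN_set M X `<=` AM_set M X.
Proof.
move=> M0 Mlc f [fs fb] c [cs cb] cX.
have cc : continuous c.
  by move=> t; apply: differentiable_continuous; apply/derivable1_diffP; exact: (cs 0%N).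
have ext t : exists U g, local_ext X f (c t) U g by exact: fs.
have oc U : open U -> open (c @^-1` U) by move=> oU; exact: open_comp.
split=> [k t|K cK].
  have [U [g [oU [Ut [sg fg]]]]] := ext t.
  (* Only the jet matters here, so all four constants are set to 1. *)
  have [u [ju u0 _]] := comp_curve_jet k.+1 [::] M0 Mlc ltr01 ltr01 ltr01 ltr01 cs sg.
  apply: (derivable_jetn (oc _ oU) ju) => // s Us.
  by rewrite u0 /= fg.
have [C [r [C0 [r0 hc]]]] := cb K cK.
have cKX : c @` K `<=` X by move=> _ [t _ <-].
have ccK : compact (c @` K).
  by apply: continuous_compact => //; exact: continuous_subspaceT.
have [A [s [A0 [s0 hA]]]] := fb _ cKX ccK.
exists A, (4 * r * (1 + n.+1%:R * s * C * M 1)); split=> //; split.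
  have M1 : 0 < M 1 by [].
  by rewrite !mulr_gt0//; have : 0 < n.+1%:R * s * C * M 1; [rewrite !mulr_gt0|lra].
move=> k t Kt; have [U [g gext]] := ext t; have [oU [Ut [sg fg]]] := gext.
have [u [ju u0 hb]] := comp_curve_jet k [::] M0 Mlc A0 s0 C0 r0 cs sg.
rewrite (derive1n_jetn (oc _ oU) ju)//; last first.
  by move=> x Ux; rewrite u0 /= fg.
apply: le_trans (hb t Ut _ _ _ k (leqnn _)) _ => //.
- by move=> j; exact: hc.
- by move=> ws wsb; apply: (hA _ (c t) U g ws) => //; exists t.
- by rewrite /comp_bound add0n expr0 mulr1.
Qed.

End CurveComposition.
(** * Step and bump functions of class M *)

Section StepFunction.
Context {R : realType}.

Lemma MVT_everywhere (G u : R -> R) (a b : R) : a <= b ->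
  (forall x, a <= x <= b -> is_derive x (1 : R) G (u x)) ->
  exists2 c, a <= c <= b & G b - G a = u c * (b - a).
Proof.
move=> ab dG.
have [||c] := @MVT_segment R G u a b ab.
- by move=> x; rewrite in_itv/= => /andP[/ltW ax /ltW xb]; apply: dG; rewrite ax.
- apply: derivable_within_continuous => x; rewrite in_itv/= => xab.
  by case: (dG x xab).
- by rewrite in_itv/= => cab e; exists c.
Qed.

Lemma is_cvg_seriesM (L : R) (b : nat -> R) :
  cvgn (series b) -> cvgn (series (fun n => L * b n)).
Proof.
move=> cb.
have -> : series (fun n => L * b n) = cst L \* series b.
  by apply/funext => n; rewrite /series /= mulr_sumr.
by apply: is_cvgM => //; exact: is_cvg_cst.
Qed.

Lemma cvg_increments (x b : nat -> R) (L : R) : 0 <= L -> (forall n, 0 <= b n) ->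
  cvgn (series b) -> (forall n, `|x n.+1 - x n| <= L * b n) ->
  cvgn x /\ forall n, `|limn x - x n| <= L * (limn (series b) - series b n).
Proof.
move=> L0 b0 cb hx.
have cx : cvgn x.
  have -> : x = cst (x 0%N) + series (fun i => x i.+1 - x i).
    apply/funext => n; rewrite /series /=.
    by rewrite -[RHS]/(x 0%N + \sum_(0 <= i < n) (x i.+1 - x i)) telescope_sumr// addrC subrK.
  apply: is_cvgD; first exact: is_cvg_cst.
  apply: normed_cvg; apply: (series_le_cvg _ _ hx) => // [n|].
    by rewrite mulr_ge0.
  exact: is_cvg_seriesM.
have mono : nondecreasing_seq (series b).
  by apply/nondecreasing_seqP => n; rewrite -subr_ge0 seriesSB.
have hx2 n k : `|x (n + k)%N - x n| <= L * (series b (n + k)%N - series b n).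
  elim: k => [|k IH]; first by rewrite addn0 !subrr normr0 mulr0.
  have -> : x (n + k.+1)%N - x n = (x (n + k).+1 - x (n + k)%N) + (x (n + k)%N - x n).
    by rewrite addnS addrA subrK.
  apply: (le_trans (ler_normD _ _)).
  have -> : series b (n + k.+1)%N - series b n = b (n + k)%N + (series b (n + k)%N - series b n).
    by rewrite addnS seriesSr; lra.
  by rewrite mulrDr; apply: lerD.
split=> // n; set E := L * _.
have near_bd : \forall m \near \oo, x n - E <= x m <= x n + E.
  exists n => // m /= nm; rewrite -(subnKC nm).
  have := hx2 n (m - n)%N; set m' := (n + (m - n))%N.
  have : L * (series b m' - series b n) <= E.
    by rewrite ler_wpM2l// lerB//; exact: nondecreasing_cvgn_le.
  by move=> h1 h2; have := le_trans h2 h1; rewrite ler_norml => /andP[? ?]; lra.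
rewrite ler_norml; apply/andP; split.
  rewrite lerBrDr addrC; apply: limr_ge => //.
  by apply: filterS near_bd => m /andP[].
rewrite lerBlDr addrC; apply: limr_le => //.
by apply: filterS near_bd => m /andP[].
Qed.

Definition lipschitz_with (L : R) (u : R -> R) :=
  forall x y, `|u x - u y| <= L * `|x - y|.

Lemma lipschitz_with_continuous L u : lipschitz_with L u -> continuous u.
Proof.
move=> lu x; apply/cvgrPdist_le => e e0.
have L1 : 0 < `|L| + 1 by apply: ltr_wpDl.
near=> y; apply: (le_trans (lu _ _)).
have xy : `|x - y| <= e / (`|L| + 1).
  by near: y; apply: cvgr_dist_le => //; rewrite divr_gt0.
move: xy; rewrite ler_pdivlMr// mulrC; apply: le_trans.
by rewrite ler_wpM2r//; have := ler_norm L; lra.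
Unshelve. all: by end_near. Qed.

(* Integrating from [-1] gives a primitive on the whole line because [u] vanishes
   on the negative half-line and the integral over an empty interval is [0]. *)
Lemma primitive_exists (u : R -> R) : continuous u -> (forall x, x <= 0 -> u x = 0) ->
  exists G : R -> R, forall x, is_derive x (1 : R) G (u x).
Proof.
move=> cu u0.
pose G (x : R) := (\int[lebesgue_measure]_(t in [set` `[-1, x]]) (u t))%R.
have G0 y : y <= 0 -> G y = 0.
  move=> y0; rewrite /G /Rintegral (eq_integral (cst 0%E)) ?integral0//.
  move=> t; rewrite inE/= in_itv/= => /andP[_ ty].
  by rewrite u0//; exact: le_trans y0.
exists G => x; case: (ltP (- (1/2)) x) => x1.
  have [||||dG GE] := @continuous_FTC1_closed R u (-1) x (x + 1).
  - by lra.
  - apply: continuous_compact_integrable; first exact: segment_compact.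
    exact: continuous_subspaceT.
  - by lra.
  - exact: cu.
  by apply: DeriveDef; [exact: dG|rewrite -derive1E].
apply: (@near_eq_is_derive _ _ _ (cst 0)); last first.
  by rewrite u0//; [exact: is_derive_cst|lra].
near=> y; rewrite /= G0//.
by apply: ltW; near: y; apply: (cvgr_lt x); [exact: cvg_id|lra].
Unshelve. all: by end_near. Qed.

(** An arbitrary choice among primitives that differ by a constant; [avg] sees only differences of
    its values. *)
Definition primitive (u : R -> R) : R -> R :=
  xget (cst 0) [set G | forall x, is_derive x (1 : R) G (u x)].

Definition avg (a : R) (u : R -> R) (x : R) : R :=
  (primitive u x - primitive u (x - a)) / a.

(* The class of functions preserved by averaging over [[x - a, x]]. *)
Definition rampish (L : R) (u : R -> R) :=
  [/\ lipschitz_with L u, (forall x, 0 <= u x <= 1) & (forall x, x <= 0 -> u x = 0)].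

Lemma primitiveP L u x : rampish L u -> is_derive x (1 : R) (primitive u) (u x).
Proof.
case=> lu _ u0.
have [G hG] := primitive_exists (lipschitz_with_continuous lu) u0.
by have := xgetPex (cst 0) (ex_intro [set G | forall x, is_derive x (1 : R) G (u x)] G hG); apply.
Qed.

Lemma avg_derive L u a x : rampish L u ->
  is_derive x (1 : R) (avg a u) ((u x - u (x - a)) / a).
Proof.
move=> ru; rewrite mulrC.
rewrite [X in is_derive _ _ X](_ : _ = a^-1 *: ((primitive u) - (fun y => primitive u (1 * y - a)))); last first.
  by apply/funext => y; rewrite /avg mulrC -[RHS]/(a^-1 * (primitive u y - primitive u (1 * y - a))) mul1r.
apply: is_deriveZ; apply: is_deriveB; first exact: primitiveP ru.
apply: is_derive_eq; first by apply: is_derive_affine; exact: primitiveP ru.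
by rewrite scale1r mul1r.
Qed.

Lemma avg_val L u a x : rampish L u -> 0 < a ->
  exists2 y, x - a <= y <= x & avg a u x = u y.
Proof.
move=> ru a0.
have [||y xy e] := @MVT_everywhere (primitive u) u (x - a) x; first by lra.
  by move=> z _; exact: primitiveP ru.
exists y => //; rewrite /avg e opprB [x + _]addrC subrK mulfK// gt_eqF//.
Qed.

Lemma avg_dist L u v a x (e : R) : rampish L u -> rampish L v -> 0 < a ->
  (forall y, `|u y - v y| <= e) -> `|avg a u x - avg a v x| <= e.
Proof.
move=> ru rv a0 uv.
have [||y xy] := @MVT_everywhere (primitive u - primitive v) (fun z => u z - v z) (x - a) x.
- by lra.
- by move=> z _; apply: is_deriveB; [exact: primitiveP ru|exact: primitiveP rv].
rewrite -![(_ - _) _]/(_ - _) => h.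
have -> : avg a u x - avg a v x = u y - v y.
  rewrite /avg -mulrBl; apply: (mulIf (lt0r_neq0 a0)); rewrite divfK ?gt_eqF//.
  by move: h; lra.
exact: uv.
Qed.

Lemma avg_rampish L u a : rampish L u -> 0 < a -> rampish L (avg a u).
Proof.
move=> ru a0; have [lu u01 u0] := ru; split.
- move=> x y.
  (* [avg a u x - avg a u y] is the mean over [[y - a, y]] of the function [u (. + (x - y)) - u],
     hence one of its values. *)
  have dd z : is_derive z (1 : R) ((fun s => primitive u (1 * s + (x - y))) - primitive u)
                (u (z + (x - y)) - u z).
    apply: is_deriveB; last exact: primitiveP ru.
    apply: is_derive_eq; first by apply: is_derive_affine; exact: primitiveP ru.
    by rewrite scale1r mul1r.
  have [|z _] := @MVT_everywhere _ _ (y - a) y _ (fun z _ => dd z); first by lra.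
  rewrite -![((_ : R -> R) - _) _]/(_ - _) !mul1r => h.
  have -> : avg a u x - avg a u y = u (z + (x - y)) - u z.
    rewrite /avg -mulrBl; apply: (mulIf (lt0r_neq0 a0)); rewrite divfK ?gt_eqF//.
    move: h; have -> : y + (x - y) = x by lra.
    have -> : y - a + (x - y) = x - a by lra.
    by lra.
  by apply: (le_trans (lu _ _)); rewrite addrC addKr.
- by move=> x; have [y _ ->] := avg_val x ru a0.
- move=> x x0; have [y /andP[_ yx] ->] := avg_val x ru a0; apply: u0.
  exact: le_trans x0.
Qed.

Variables (a : nat -> R) (u0 : R -> R) (L : R).
Hypotheses (a_gt0 : forall n, 0 < a n) (L0 : 0 <= L) (ru0 : rampish L u0).
Hypothesis ca : cvgn (series a).

(** The outermost width is [a m] and the innermost [a (m + n - 1)]. The parameter [m] makes the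
    limit in [n] satisfy a recursion that peels off the outermost average. *)
Fixpoint avgs (n m : nat) : R -> R :=
  if n is n'.+1 then avg (a m) (avgs n' m.+1) else u0.

Lemma avgs_rampish n m : rampish L (avgs n m).
Proof. by elim: n m => [|n IH] m //=; apply: avg_rampish. Qed.

Lemma avgs_val n m x :
  exists2 y, x - \sum_(i < n) a (m + i)%N <= y <= x & avgs n m x = u0 y.
Proof.
elim: n m x => [|n IH] m x.
  by exists x => //; rewrite big_ord0 subr0 lexx.
have [y /andP[y1 y2] /= ->] := avg_val x (avgs_rampish n m.+1) (a_gt0 m).
have [z /andP[z1 z2] ->] := IH m.+1 y; exists z => //.
rewrite (le_trans z2 y2) andbT big_ord_recl addn0.
under eq_bigr => i _ do rewrite lift0 addnS -addSn.
by lra.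
Qed.

(** The additional average is the innermost one: it moves the Lipschitz function [u0] by at most
    [L * a (m + n)], and the outer averages do not increase sup distances. *)
Lemma avgs_increment n m x : `|avgs n.+1 m x - avgs n m x| <= L * a (m + n)%N.
Proof.
elim: n m x => [|n IH] m x.
  have [y /andP[y1 y2] /= ->] := avg_val x ru0 (a_gt0 m).
  have [lu _ _] := ru0; apply: (le_trans (lu _ _)); rewrite addn0.
  by rewrite ler_wpM2l// distrC ger0_norm; lra.
rewrite addnS -addSn.
apply: (avg_dist _ (avgs_rampish n.+1 m.+1) (avgs_rampish n m.+1)); first exact: a_gt0.
by move=> y; exact: IH.
Qed.

Definition smoothed (m : nat) (x : R) : R := limn (fun n => avgs n m x).

Lemma cvg_series_shift m : cvgn (series (fun i => a (m + i)%N)).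
Proof.
elim: m => [//|m IH].
have -> : series (fun i => a (m.+1 + i)%N) =
   (fun n => series (fun i => a (m + i)%N) n.+1) - cst (a m).
  apply/funext => n.
  rewrite -[RHS]/(\sum_(0 <= i < n.+1) a (m + i)%N - a m) big_nat_recl// addn0 addrC addKr.
  by apply: eq_bigr => i _; rewrite addSn addnS.
apply: is_cvgB; last exact: is_cvg_cst.
by move/cvg_ex: IH => [l hl]; apply/cvg_ex; exists l; rewrite (cvg_shiftS (series _)).
Qed.

Lemma smoothed_approx m x :
  cvgn (fun n => avgs n m x) /\ forall n, `|smoothed m x - avgs n m x| <=
     L * (limn (series (fun i => a (m + i)%N)) - series (fun i => a (m + i)%N) n).
Proof.
apply: cvg_increments => // [n||n]; first exact: ltW.
- exact: cvg_series_shift.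
- exact: avgs_increment.
Qed.

Lemma smoothed_rampish m : rampish L (smoothed m).
Proof.
split.
- move=> x y.
  have [cx _] := smoothed_approx m x; have [cy _] := smoothed_approx m y.
  have <- : limn (fun n => `|avgs n m x - avgs n m y|) = `|smoothed m x - smoothed m y|.
    by apply/cvg_lim => //; apply: cvg_norm; apply: cvgB.
  apply: limr_le; first by apply: is_cvg_norm; exact: is_cvgB.
  by near=> n; have [+ _ _] := avgs_rampish n m; apply.
- move=> x; have [cx _] := smoothed_approx m x; apply/andP; split.
    by apply: limr_ge => //; near=> n; have [_ /(_ x)/andP[]] := avgs_rampish n m.
  by apply: limr_le => //; near=> n; have [_ /(_ x)/andP[]] := avgs_rampish n m.
- move=> x x0; apply: lim_near_cst => //; near=> n.
  by have [_ _] := avgs_rampish n m; apply.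
Unshelve. all: by end_near. Qed.

(** The limit passes through the average because the tail of the series of widths bounds the
    distance to the limit uniformly in the point. *)
Lemma smoothed_avg m x : smoothed m x = avg (a m) (smoothed m.+1) x.
Proof.
pose b i := a (m.+1 + i)%N.
have cb : cvgn (series b) by exact: cvg_series_shift.
have [c1 _] := smoothed_approx m x.
apply/cvg_lim => //; rewrite -cvg_shiftS; apply/cvgrPdist_le => e e0.
have : (fun n => L * (limn (series b) - series b n)) @ \oo --> L * (limn (series b) - limn (series b)).
  by apply: cvgMr; apply: cvgB => //; exact: cvg_cst.
rewrite subrr mulr0 => /cvgrPdist_le/(_ e e0); apply: filterS => n.
rewrite sub0r normrN => hn.
apply: (avg_dist _ (smoothed_rampish m.+1) (avgs_rampish n m.+1)) => // y.
have [_ /(_ n) h] := smoothed_approx m.+1 y.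
by apply: (le_trans h); apply: le_trans (ler_norm _) hn.
Qed.

Definition dquot (c : R) (u : R -> R) (x : R) := (u x - u (x - c)) / c.

Fixpoint dquots (k : nat) (u : R -> R) : R -> R :=
  if k is k'.+1 then dquots k' (dquot (a k') u) else u.

Lemma is_derive_dquot c (u du : R -> R) :
  (forall x, is_derive x (1 : R) u (du x)) ->
  forall x, is_derive x (1 : R) (dquot c u) (dquot c du x).
Proof.
move=> hu x; rewrite /dquot mulrC.
rewrite [X in is_derive _ _ X](_ : _ = c^-1 *: (u - (fun y => u (1 * y - c)))); last first.
  by apply/funext => y; rewrite mulrC -[RHS]/(c^-1 * (u y - u (1 * y - c))) mul1r.
have d1 := hu x.
have d2 : is_derive x (1 : R) (fun y => u (1 * y - c)) (du (x - c)).
  have := @is_derive_affine R R u 1 (- c) x (du (x - c)).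
  by rewrite scale1r mul1r; apply; exact: hu.
by apply: is_deriveZ.
Qed.

Lemma is_derive_dquots k (u du : R -> R) :
  (forall x, is_derive x (1 : R) u (du x)) ->
  forall x, is_derive x (1 : R) (dquots k u) (dquots k du x).
Proof.
elim: k u du => [|k IH] u du hu; first exact: hu.
by apply: IH; exact: is_derive_dquot.
Qed.

Lemma dquots_bound k (u : R -> R) (B : R) : (forall x, `|u x| <= B) ->
  forall x, `|dquots k u x| <= (\prod_(i < k) (2 / a i)) * B.
Proof.
elim: k u B => [|k IH] u B hu x; first by rewrite big_ord0 mul1r /=.
rewrite big_ord_recr /= -mulrA; apply: IH => y.
rewrite /dquot normrM [X in _ * X]ger0_norm; last by rewrite invr_ge0 ltW.
rewrite mulrAC.
apply: ler_wpM2r; first by rewrite invr_ge0 ltW.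
apply: le_trans (ler_normB _ _) _.
by have := hu y; have := hu (y - a k); lra.
Qed.

(** By [smoothed_avg], the derivative of [smoothed k] is the difference quotient of [smoothed k.+1]
    with step [a k], and difference quotients commute with differentiation. *)
Lemma smoothed_jet : jet setT (fun k => dquots k (smoothed k)).
Proof.
move=> k t _ /=; apply: is_derive_dquots => x.
rewrite [X in is_derive _ _ X](_ : _ = avg (a k) (smoothed k.+1)).
  exact: avg_derive (smoothed_rampish _).
by apply/funext => y; exact: smoothed_avg.
Qed.

Lemma smoothed_eq1 (S : R) x : (forall n, \sum_(i < n) a i <= S) ->
  (forall y, x - S <= y -> u0 y = 1) -> smoothed 0 x = 1.
Proof.
move=> aS h; apply: lim_near_cst => //; near=> n.
have [y /andP[y1 _] ->] := avgs_val n 0 x; apply: h; apply: le_trans y1.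
by have := aS n; under [X in _ <= x - X]eq_bigr do rewrite add0n; lra.
Unshelve. all: by end_near. Qed.

End StepFunction.

Section StepExistence.
Context {R : realType}.
Variable M : nat -> R.
Hypotheses (M0 : positive_seq M) (Mnq : non_quasianalytic M).

(** The formula is [k * x] cut off to [0, 1], which climbs from 0 at 0 to 1 at [w / 2]. *)
Lemma ramp_rampish (w : R) : 0 < w -> let k := 2 / w in
  rampish k (fun x => (`|k * x| - `|k * x - 1| + 1) / 2).
Proof.
move=> w0 k; have k0 : 0 < k by rewrite divr_gt0.
have cases (z : R) : [\/ z <= 0 /\ `|z| - `|z - 1| = -1,
    0 <= z <= 1 /\ `|z| - `|z - 1| = z + z - 1 | 1 <= z /\ `|z| - `|z - 1| = 1].
  case: (lerP z 0) => z0; [apply: Or31|case: (lerP z 1) => z1; [apply: Or32|apply: Or33]].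
  - by split=> //; rewrite ler0_norm// ler0_norm; lra.
  - by split; [lra|rewrite ger0_norm ?ler0_norm; lra].
  - by split; [lra|rewrite ger0_norm ?ger0_norm; lra].
split.
- move=> x y.
  have -> : k * `|x - y| = `|k * x - k * y|.
    by rewrite -mulrBr normrM (ger0_norm (ltW k0)).
  rewrite -mulrBl normrM [X in _ * X]ger0_norm// ler_pdivrMr//.
  rewrite opprD addrACA subrr addr0 opprB.
  apply: (@le_trans _ _ (`| `|k * x| - `|k * y| | + `| `|k * y - 1| - `|k * x - 1| |)).
    by apply: le_trans (ler_normD _ _); rewrite le_eqVlt; apply/orP; left; apply/eqP; congr (`| _ |); lra.
  rewrite mulr_natr mulr2n; apply: lerD; first exact: ler_dist_dist.
  by apply: le_trans (ler_dist_dist _ _) _; rewrite distrC le_eqVlt; apply/orP; left; apply/eqP; congr (`| _ |); lra.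
- by move=> x; case: (cases (k * x)) => -[h ->]; lra.
- move=> x x0; have kx : k * x <= 0 by rewrite mulr_ge0_le0// ltW.
  by case: (cases (k * x)) => -[h ->]; lra.
Qed.

(** With the widths 2 M_i / ((i+1) M_(i+1)) the product of the [2 / a i] telescopes to k! M_k / M_0,
    and non-quasianalyticity makes the widths summable. Shrinking only finitely many of them makes
    their sum small at the cost of a constant factor, not of a geometric one. *)
Lemma step_exists (w : R) : 0 < w -> exists (s : nat -> R -> R) (C : R),
  [/\ 0 < C, jet setT s, (forall t, t <= 0 -> s 0%N t = 0), (forall t, w <= t -> s 0%N t = 1) &
      (forall t, 0 <= s 0%N t <= 1) /\ forall k t, `|s k t| <= C * k`!%:R * M k].
Proof.
move=> w0.
pose m k := M k / (k.+1%:R * M k.+1).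
have m0 k : 0 < m k by rewrite divr_gt0// mulr_gt0.
have cm : cvgn (series m) by exact: Mnq.
set S := limn (series m).
have mono : nondecreasing_seq (series m).
  by apply/nondecreasing_seqP => n; rewrite -subr_ge0 seriesSB ltW.
have mS n : series m n <= S by exact: nondecreasing_cvgn_le.
have S0 : 0 <= S by apply: le_trans (mS 0%N); rewrite /series /= big_geq.
(* The tail beyond [J] and the head shrunk by [e] each contribute at most [2 * (w / 8)] to the sum
   of the widths. This leaves [w / 2] for the ramp. *)
have [J hJ] : exists J, S - series m J <= w / 8.
  have : series m @ \oo --> S by exact: cm.
  move=> /cvgrPdist_le /(_ (w / 8)) []; first by rewrite divr_gt0.
  by move=> J _ /(_ J (leqnn _)) h; exists J; apply: le_trans (ler_norm _) h.
pose e := Num.min 1 (w / 8 / (S + 1)).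
have e0 : 0 < e by rewrite /e lt_min ltr01 !divr_gt0//; lra.
have eS : e * S <= w / 8.
  apply: (@le_trans _ _ (w / 8 / (S + 1) * S)).
    by rewrite ler_wpM2r// /e ge_min lexx orbT.
  rewrite mulrAC ler_pdivrMr; last lra.
  by rewrite ler_wpM2l ?divr_ge0 ?(ltW w0)//; lra.
have e1 : e <= 1 by rewrite /e ge_min lexx.
pose s i : R := if (i < J)%N then e else 1.
have s0 i : 0 < s i by rewrite /s; case: ifP.
pose a i := 2 * m i * s i.
have a0 i : 0 < a i by rewrite /a mulr_gt0// mulr_gt0.
have ca : cvgn (series a).
  apply: (@series_le_cvg _ a (fun n => 2 * m n)).
  - by move=> n; rewrite ltW.
  - by move=> n; rewrite mulr_ge0// ltW.
  - move=> n; rewrite /a -[leRHS]mulr1; apply: ler_wpM2l; first by rewrite mulr_ge0// ltW.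
    by rewrite /s; case: ifP.
  exact: is_cvg_seriesM.
have asum n : \sum_(i < n) a i <= w / 2.
  have main : \sum_(i < n) a i <= 2 * e * series m (minn n J) + 2 * (series m n - series m (minn n J)).
    elim: n => [|n IH]; first by rewrite big_ord0 min0n /series /= big_geq// subrr !mulr0 addr0.
    rewrite big_ord_recr /=; case: (ltnP n J) => nJ.
      move: IH; rewrite (minn_idPl (ltnW nJ)) (minn_idPl nJ) seriesSr.
      by rewrite [a n]/a /s nJ; nra.
    move: IH; rewrite (minn_idPr nJ) (minn_idPr (leqW nJ)) seriesSr.
    by rewrite [a n]/a /s ltnNge nJ /=; lra.
  apply: (le_trans main).
  have h1 : e * series m (minn n J) <= w / 8.
    by apply: le_trans eS; rewrite ler_wpM2l// ltW.
  have h2 : series m n - series m (minn n J) <= w / 8.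
    case: (leqP n J) => nJ; first by rewrite subrr divr_ge0// ltW.
    by apply: le_trans hJ; rewrite lerB.
  by lra.
pose k := 2 / w.
have k0 : 0 < k by rewrite divr_gt0.
pose u0 (x : R) := (`|k * x| - `|k * x - 1| + 1) / 2.
have ru0 : rampish k u0 := ramp_rampish w0.
have jt := smoothed_jet a0 (ltW k0) ru0 ca.
have rU := smoothed_rampish a0 (ltW k0) ru0 ca.
exists (fun j => dquots a j (smoothed a u0 j)), ((e ^- J) * (M 0%N)^-1).
split=> //.
- by rewrite mulr_gt0 ?invr_gt0 ?exprn_gt0.
- by move=> t; have [_ _] := rU 0%N; apply.
- move=> t wt /=; apply: (smoothed_eq1 a0 ru0 (S := w / 2)) => // y hy.
  have ky : 1 <= k * y by rewrite /k mulrAC ler_pdivlMr//; lra.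
  by rewrite /u0 !ger0_norm; lra.
split=> [t|j t]; first by have [_ + _] := rU 0%N; apply.
have hb : `|dquots a j (smoothed a u0 j) t| <= (\prod_(i < j) (2 / a i)) * 1.
  by apply: dquots_bound => // x; have [_ /(_ x) /andP[h1 h2] _] := rU j; rewrite ger0_norm.
apply: (le_trans hb); rewrite mulr1.
have -> : \prod_(i < j) (2 / a i) = (\prod_(i < j) (s i)^-1) * (j`!%:R * M j / M 0%N).
  elim: j {hb} => [|j IH]; first by rewrite !big_ord0 fact0 !mul1r divff// gt_eqF.
  rewrite !big_ord_recr /= IH factS natrM /a /m.
  by field; rewrite !gt_eqF//=.
have -> : e ^- J / M 0 * j`!%:R * M j = e ^- J * (j`!%:R * M j / M 0) by ring.
have MM : 0 <= j`!%:R * M j / M 0.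
  by apply: mulr_ge0; [apply: mulr_ge0 => //; exact/ltW/M0|rewrite invr_ge0; exact/ltW/M0].
apply: (ler_wpM2r MM).
have -> : \prod_(i < j) (s i)^-1 = e ^- (minn j J).
  elim: j {hb MM} => [|j IH]; first by rewrite big_ord0 min0n expr0 invr1.
  rewrite big_ord_recr /= IH /s; case: (ltnP j J) => jJ.
    by rewrite (minn_idPl jJ) exprSr invfM mulrC.
  by rewrite (minn_idPr (leqW jJ)) invr1 mulr1.
rewrite lef_pV2 ?posrE ?exprn_gt0//.
by rewrite ler_wiXn2l// ?geq_minr// ltW.
Qed.

Lemma jet_const_on (I : set R) (u : nat -> R -> R) (c : R) :
  jet I u -> open I -> (forall t, I t -> u 0%N t = c) ->
  forall k t, I t -> u k.+1 t = 0.
Proof.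
move=> ju oI uc k t It.
rewrite -(derive1n_jet oI ju (c := u 0%N))//.
apply: (derive1n_jet oI (u := fun k => if k is _.+1 then cst 0 else cst c)) => //.
by move=> [|j] s _; exact: is_derive_cst.
Qed.

Definition bumpy (w C : R) (b : nat -> R -> R) :=
  [/\ jet setT b, (forall k t, `|b k t| <= C * k`!%:R * M k) &
      (forall k t, w < `|t| -> b k t = 0)].

(** The bump is the difference of two translates of a step that climbs within [w / 2]. *)
Lemma bump_exists (w : R) : 0 < w -> exists (b : nat -> R -> R) (C : R),
  [/\ 0 < C, bumpy w C b, (forall t, `|t| <= w / 2 -> b 0%N t = 1) &
      (forall t, 0 <= b 0%N t <= 1)].
Proof.
move=> w0; have w2 : 0 < w / 2 by rewrite divr_gt0.
have [s [C [C0 js s0 s1 [s01 sb]]]] := step_exists w2.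
pose b k t := s k (t + w) - s k (t - w / 2).
have jb : jet setT b.
  have sh c : jet setT (fun k t => s k (t + c)).
    move=> k t _; have := @is_derive_affine R R (s k) 1 c t (s k.+1 (t + c)).
    by rewrite scale1r mul1r; under eq_fun do rewrite mul1r; apply; exact: js.
  exact: jetB (sh w) (sh (- (w / 2))).
have bz t : w < `|t| -> b 0%N t = 0.
  rewrite /b; case: (ltP t 0) => t0.
    rewrite ltr0_norm// => wt.
    by rewrite !s0 ?subrr//; lra.
  by rewrite ger0_norm// => wt; rewrite !s1 ?subrr//; lra.
exists b, (C + C); split; first by rewrite addr_gt0.
- split=> // [k t|[|k] t wt].
  + by apply: le_trans (ler_normB _ _) _; rewrite !mulrDl lerD.
  + exact: bz.
  apply: (@jet_const_on [set t : R | w < `|t|] b 0) => //.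
  * by move=> j y _; exact: jb.
  * apply: (@open_comp _ _ (fun t : R => `|t|) [set y | w < y]); last exact: open_gt.
    by move=> y _; exact: norm_continuous.
- move=> t; rewrite ler_norml => /andP[t1 t2]; rewrite /b s1 ?s0 ?subr0//; lra.
- move=> t; rewrite /b; case: (lerP t (w / 2)) => tw.
    by rewrite (s0 (t - w / 2)) ?subr0//; lra.
  by rewrite (s1 (t + w)); [have := s01 (t - w / 2); lra|lra].
Qed.

(** The jet of t b(t), by Leibniz; at [k = 0] the default value of [k.-1] is multiplied by 0. *)
Definition tmul (b : nat -> R -> R) (k : nat) (t : R) : R :=
  t * b k t + k%:R * b k.-1 t.

(** On the support [|t| <= w], and k (k-1)! M_(k-1) is at most (M_0/M_1) k! M_k. Again only the
    constant grows. *)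
Lemma tmul_bumpy (w C : R) b : log_convex M -> 0 <= w -> 0 <= C -> bumpy w C b ->
  bumpy w ((w + M 0%N / M 1%N) * C) (tmul b).
Proof.
move=> Mlc w0 C0 [jb bb bz]; split.
- move=> k t _.
  have d1 : is_derive t (1 : R) (b k) (b k.+1 t) by exact: jb.
  have d2 : is_derive t (1 : R) (b k.-1) (b k.-1.+1 t) by exact: jb.
  have -> : tmul b k = (id * b k) + (k%:R *: b k.-1).
    by apply/funext => s.
  have d3 := @is_deriveM R R id (b k) t 1 1 (b k.+1 t) (is_derive_id t 1) d1.
  have d4 := @is_deriveZ R R R (b k.-1) k%:R t 1 _ d2.
  have -> : tmul b k.+1 t = id t *: b k.+1 t + b k t *: 1 + k%:R *: b k.-1.+1 t.
    rewrite /tmul /= -natr1 mulrDl mul1r [_ + b k t]addrC addrA.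
    by congr (_ + _ + _); [exact/esym/mulr1|case: k {d1 d2 d3 d4} => [|k] //; rewrite !mul0r scale0r].
  exact: (@is_deriveD R R R _ _ t 1 _ _ d3 d4).
- move=> k t; case: (lerP `|t| w) => tw; last first.
    rewrite /tmul !bz// !mulr0 addr0 normr0 !mulr_ge0// ?ltW//.
    by rewrite ltr_wpDl// divr_gt0.
  rewrite /tmul; apply: le_trans (ler_normD _ _) _.
  rewrite !mulrDl; apply: lerD.
    by rewrite normrM -!mulrA; apply: ler_pM => //; rewrite mulrA.
  rewrite normrM ger0_norm//; case: k => [|k].
    rewrite mul0r !mulr_ge0// ?ltW//.
    by rewrite invr_gt0.
  apply: (@le_trans _ _ (k.+1%:R * (C * k`!%:R * M k))); first by rewrite ler_wpM2l.
  rewrite factS natrM.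
  have -> : M 0 / M 1 * C * (k.+1%:R * k`!%:R) * M k.+1 =
     k.+1%:R * (C * k`!%:R * (M 0 / M 1 * M k.+1)) by ring.
  by rewrite !ler_wpM2l// ?mulr_ge0//; exact: log_convex_le.
- by move=> k t wt; rewrite /tmul !bz// !mulr0 addr0.
Qed.

End StepExistence.
(** * Rays and curves in a Lipschitz set *)

Section LocalCone.
Context {R : realType}.
Variable n : nat.

Lemma mulmx_norm_le m k (w : 'rV[R]_m) (B : 'M[R]_(m, k)) :
  `|w *m B| <= (\sum_i \sum_j `|B i j|) * `|w|.
Proof.
have nn i : 0 <= \sum_j `|B i j| by apply: sumr_ge0.
apply: rV_norm_le => [|j]; first by rewrite mulr_ge0// sumr_ge0.
rewrite mxE mulr_suml; apply: le_trans (ler_norm_sum _ _ _) _.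
apply: ler_sum => i _; rewrite normrM mulrC; apply: ler_pM => //; last exact: le_coord_norm.
by rewrite (bigD1 j)//= lerDl sumr_ge0.
Qed.

Definition local_cone (X : set 'rV[R]_n.+1) (x0 v0 : 'rV[R]_n.+1) (r d e : R) :=
  forall y, X y -> `|y - x0| < e -> forall v, `|v - v0| <= r ->
  forall s, 0 <= s <= d -> X (y + s *: v).

Lemma eucl_head_le (z w : 'rV[R]_n.+1) :
  (forall i, i != ord_max -> z ord0 i = w ord0 i) -> eucl_head z <= n.+1%:R * `|w|.
Proof.
move=> zw; apply: le_trans (eucl_le w); apply: ler_wsqrtr.
rewrite [leRHS](bigID (fun i => i != ord_max))/=.
under eq_bigr => i im do rewrite zw//.
by rewrite lerDl sumr_ge0// => i _; exact: sqr_ge0.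
Qed.

Lemma norm_delta m (i : 'I_m) : `|delta_mx ord0 i : 'rV[R]_m| <= 1.
Proof.
by apply: rV_norm_le => // j; rewrite mxE; case: eqP => _; case: eqP => _; rewrite ?normr1 ?normr0.
Qed.

Lemma lipschitz_local_cone (X : set 'rV[R]_n.+1) x0 : lipschitz_set X -> X x0 ->
  exists (A : 'M[R]_n.+1) (r d e : R),
    [/\ A \in unitmx, 0 < r, 0 < d, 0 < e &
        local_cone X x0 (delta_mx ord0 ord_max *m A) r d e].
Proof.
move=> [cX [Xcl [_ Xcone]]] Xx0.
have [x0i|x0i] := pselect (interior X x0).
  move: x0i; rewrite /interior /= => /nbhs_ballP[e /= e0 he].
  exists 1%:M, 1, (e / 8), (e / 2); split; rewrite ?divr_gt0 ?unitmx1//.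
  move=> y Xy yx v; rewrite mulmx1 => vv s /andP[s0 s1]; apply: he.
  rewrite -ball_normE /= distrC addrAC.
  apply: le_lt_trans (ler_normD _ _) _; rewrite normrZ (ger0_norm s0).
  have v2 : `|v| <= 2.
    rewrite -[v](subrK (delta_mx ord0 ord_max)); apply: le_trans (ler_normD _ _) _.
    by have := norm_delta (@ord_max n); lra.
  have : s * `|v| <= e / 8 * 2 by apply: ler_pM.
  by lra.
have x0c : closure (interior X) x0 by rewrite -Xcl.
have [eps [r [h [A [eps0 [r0 [h0 [oA hA]]]]]]]] := Xcone x0 x0c x0i.
have oA' : A^T *m A = 1%:M by apply: mulmx1C.
have uA : A \in unitmx by apply: (mulmx1_unit oA).1.
pose K : R := \sum_i \sum_j `|A^T i j|.
have K0 : 0 <= K by apply: sumr_ge0 => i _; exact: sumr_ge0.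
(* Let [z] be [s] times the axis plus a perturbation of size [q]. As [q <= 1/2] and
   [h * q / r <= 1/4], its last coordinate lies between [s / 2] and [3 s / 2] and its head is at
   most [s * q]. Hence [z] is in the cone for [0 < s <= h / 4]. *)
pose q := Num.min (1/2) (r / (4 * h)).
have q0 : 0 < q by rewrite lt_min !divr_gt0// mulr_gt0.
have q1 : q <= 1 / 2 by rewrite ge_min lexx.
have q2 : h * q / r <= 1 / 4.
  have : q <= r / (4 * h) by rewrite ge_min lexx orbT.
  rewrite ler_pdivlMr ?mulr_gt0// => qh.
  by rewrite ler_pdivrMr//; lra.
have q3 : h / 4 * q < r.
  have : q <= r / (4 * h) by rewrite ge_min lexx orbT.
  by rewrite ler_pdivlMr ?mulr_gt0// => qh; lra.
have nK : 0 < n.+1%:R * (K + 1) :> R by rewrite mulr_gt0//; lra.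
exists A, (q / (n.+1%:R * (K + 1))), (h / 4), (eps / n.+1%:R).
split; rewrite ?divr_gt0//.
move=> y Xy; rewrite ltr_pdivlMr// => yx v vv s /andP[s0 s1].
(* The open cone misses its vertex, so [s = 0] is treated apart. *)
have := s0; rewrite le_eqVlt => /predU1P[<-|{}s0]; first by rewrite scale0r addr0.
pose w := (v - delta_mx ord0 ord_max *m A) *m A^T.
have wq : n.+1%:R * `|w| <= q.
  have h1 := mulmx_norm_le (v - delta_mx ord0 ord_max *m A) A^T.
  move: vv; rewrite ler_pdivlMr// => vv.
  apply: le_trans vv; move: h1; rewrite -/K -/w; set b := `|v - _| => h1.
  have h2 : n.+1%:R * `|w| <= n.+1%:R * (K * b) by rewrite ler_wpM2l.
  have h3 : 0 <= n.+1%:R * b by rewrite mulr_ge0// normr_ge0.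
  by lra.
have w1 : `|w| <= q.
  apply: le_trans wq; rewrite -[leLHS]mul1r ler_wpM2r//.
  by rewrite ler1n.
pose z := s *: (delta_mx ord0 ord_max + w).
have zA : s *: v = z *m A.
  rewrite /z /w -scalemxAl mulmxDl -mulmxA oA' mulmx1.
  by rewrite addrC subrK.
have Xsub : interior X `<=` X by exact: interior_subset.
rewrite zA; apply: Xsub; apply: hA.
- by rewrite -Xcl.
- by apply: le_lt_trans (eucl_le _) _; rewrite mulrC.
have hz : eucl_head z <= s * q.
  apply: le_trans (@eucl_head_le _ (s *: w) _) _.
    by move=> i im; rewrite !mxE (negPf im) /= add0r.
  by rewrite normrZ (ger0_norm (ltW s0)) mulrCA ler_wpM2l// ltW.
have zm : z ord0 ord_max = s * (1 + w ord0 ord_max) by rewrite !mxE !eqxx.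
have := le_trans (le_coord_norm w ord_max) w1; rewrite ler_norml => /andP[wm1 wm2].
split.
  apply: le_lt_trans hz _; apply: le_lt_trans q3.
  by rewrite ler_wpM2r// ltW.
split.
  apply: (@le_lt_trans _ _ (s * (h * q / r))).
    rewrite mulrA ler_wpM2r ?invr_ge0 ?(ltW r0)// mulrCA ler_wpM2l// ltW//.
  rewrite zm ltr_pM2l//; lra.
rewrite zm; apply: (@le_lt_trans _ _ (h / 4 * (3 / 2))); last lra.
by apply: ler_pM => //; lra.
Qed.

End LocalCone.

(** * Termwise differentiation of series with dyadic bounds *)

Section DyadicSums.
Context {R : realType}.

Lemma cvg_dyadic (a : nat -> R) (b : R) : (forall k, `|a k| <= b / 2 ^+ k) ->
  cvgn (series a) /\ `|limn (series a)| <= 2 * b.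
Proof.
move=> ab.
have b0 : 0 <= b by have := le_trans (normr_ge0 _) (ab 0%N); rewrite expr0 divr1.
have h12 : `|2^-1 : R| < 1 by rewrite ger0_norm; lra.
have gE : (fun k => b / 2 ^+ k) = geometric b 2^-1.
  by apply/funext => k; rewrite /geometric /= exprVn.
have cg : cvgn (series (fun k => b / 2 ^+ k)).
  by rewrite gE; exact: is_cvg_geometric_series.
have lg : limn (series (fun k => b / 2 ^+ k)) = 2 * b.
  rewrite gE; apply/cvg_lim => //; have := @cvg_geometric_series R b 2^-1 h12.
  have -> : 1 - 2^-1 = 2^-1 :> R by lra.
  by rewrite invrK mulrC.
have cn : cvgn [normed series a].
  by apply: series_le_cvg ab cg => // k; rewrite divr_ge0// exprn_ge0.
have ca : cvgn (series a) by exact: normed_cvg.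
split=> //; apply: le_trans (lim_series_norm cn) _.
by rewrite -lg; apply: lim_series_le.
Qed.

Lemma series_single (a : nat -> R) k : (forall j, j != k -> a j = 0) ->
  limn (series a) = a k.
Proof.
move=> a0; apply: lim_near_cst => //; exists k.+1 => // m /= km.
rewrite /series /= (@big_cat_nat _ _ _ k.+1)//= big_nat_recr//=.
have -> : \sum_(0 <= i < k) a i = 0.
  rewrite big_nat_cond big1// => i /andP[/andP[_ ki] _]; apply: a0.
  by rewrite neq_ltn ki.
have -> : \sum_(k.+1 <= i < m) a i = 0.
  rewrite big_nat_cond big1// => i /andP[/andP[ki _] _]; apply: a0.
  by rewrite neq_ltn ki orbT.
by rewrite add0r addr0.
Qed.

(** A quadratic remainder is stable under summation, so a series can be differentiated from the
    Taylor remainders of its terms. *)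
Lemma is_derive_quadratic (F : R -> R) (t D K : R) :
  (forall h, `|F (t + h) - F t - h * D| <= K * h ^+ 2) -> is_derive t (1 : R) F D.
Proof.
move=> hF.
have K0 : 0 <= K by have := le_trans (normr_ge0 _) (hF 1); rewrite expr1n mulr1.
have cvD : (fun h : R => h^-1 *: (F (h *: (1 : R) + t) - F t)) @ 0^' --> D.
  apply/cvgrPdist_le => e e0; near=> h.
  have h0 : h != 0 by near: h; exact: nbhs_dnbhs_neq.
  have -> : D - h^-1 *: (F (h *: (1 : R) + t) - F t) = - (h^-1 * (F (t + h) - F t - h * D)).
    rewrite -[_ *: (1 : R)]/(h * 1) mulr1 [h + t]addrC -[_ *: _]/(_ * _).
    by field.
  rewrite normrN normrM normfV.
  apply: (@le_trans _ _ (`|h|^-1 * (K * h ^+ 2))).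
    by rewrite ler_wpM2l// invr_ge0.
  rewrite -(real_normK (num_real h)) expr2 mulrCA mulKf ?normr_eq0//.
  have : `|h| <= e / (K + 1).
    by near: h; apply: dnbhs0_le; rewrite divr_gt0//; lra.
  rewrite ler_pdivlMr; last lra.
  apply: le_trans; rewrite mulrC ler_wpM2l//; lra.
apply: DeriveDef; first by apply/cvg_ex; exists D.
exact: cvg_lim cvD.
Unshelve. all: by end_near. Qed.

Lemma jet_taylor2 (u : nat -> R -> R) k t h (B : R) : jet setT u ->
  (forall s, `|u k.+2 s| <= B) -> `|u k (t + h) - u k t - h * u k.+1 t| <= B * h ^+ 2.
Proof.
move=> ju uB.
have mvt j x y (C : R) : (forall s, `|s - x| <= `|y - x| -> `|u j.+1 s| <= C) ->
    `|u j y - u j x| <= C * `|y - x|.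
  move=> hC; case/orP: (le_total x y) => xy.
    have [|c /andP[c1 c2] ->] := @MVT_everywhere R (u j) (u j.+1) x y xy.
      by move=> z _; exact: ju.
    rewrite normrM ler_wpM2r//; apply: hC.
    by rewrite !ger0_norm; lra.
  have [|c /andP[c1 c2] e] := @MVT_everywhere R (u j) (u j.+1) y x xy.
    by move=> z _; exact: ju.
  rewrite distrC e normrM distrC ler_wpM2r//; apply: hC.
  by rewrite !ler0_norm; lra.
have h1 : `|u k (t + h) - u k t - h * u k.+1 t| <= (B * `|h|) * `|h|.
  have d (z : R) : is_derive z (1 : R) (fun s => u k s - s * u k.+1 t) (u k.+1 z - u k.+1 t).
    apply: (@is_deriveB R R R (u k) (fun s => s * u k.+1 t)); first exact: ju.
    have := @is_derive_affine R R id (u k.+1 t) 0 z 1 (is_derive_id _ _).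
    rewrite -[_ *: _]/(_ * _) mulr1; congr (is_derive _ _ _ _).
    by apply/funext => s; rewrite addr0 mulrC.
  have h3 z : `|z - t| <= `|h| -> `|u k.+1 z - u k.+1 t| <= B * `|h|.
    move=> zt; apply: le_trans (mvt k.+1 t z B _) _ => //.
    by rewrite ler_wpM2l//; exact: le_trans (uB t).
  have -> : u k (t + h) - u k t - h * u k.+1 t =
     (u k (t + h) - (t + h) * u k.+1 t) - (u k t - t * u k.+1 t) by ring.
  case/orP: (le_total 0 h) => hp.
    have [|c /andP[c1 c2] ->] := @MVT_everywhere R _ _ t (t + h) _ (fun z _ => d z); first by lra.
    have -> : t + h - t = h by lra.
    by rewrite normrM ler_wpM2r//; apply: h3; rewrite !ger0_norm; lra.
  have [|c /andP[c1 c2] e] := @MVT_everywhere R _ _ (t + h) t _ (fun z _ => d z); first by lra.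
  rewrite distrC e; have -> : t - (t + h) = - h by lra.
  by rewrite normrM normrN ler_wpM2r//; apply: h3; rewrite !ler0_norm; lra.
by apply: le_trans h1 _; rewrite -mulrA -expr2 real_normK// num_real.
Qed.

(** The second-order Taylor remainder of the j-th term is at most [B (k + 2) * h ^ 2 / 2 ^ j], and
    these bounds add up. *)
Lemma dyadic_sum_jet (u : nat -> nat -> R -> R) (B : nat -> R) :
  (forall j, jet setT (u j)) -> (forall j k t, `|u j k t| <= B k / 2 ^+ j) ->
  jet setT (fun k t => limn (series (fun j => u j k t))) /\
  forall k t, `|limn (series (fun j => u j k t))| <= 2 * B k.
Proof.
move=> ju uB; split; last by move=> k t; apply: (cvg_dyadic _).2.
move=> k t _; apply: (@is_derive_quadratic _ _ _ (2 * B k.+2)) => h.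
have c j s : cvgn (series (fun i => u i j s)) by apply: (cvg_dyadic _).1.
have -> : limn (series (fun j => u j k (t + h))) - limn (series (fun j => u j k t)) -
    h * limn (series (fun j => u j k.+1 t)) =
    limn (series (fun j => u j k (t + h) - u j k t - h * u j k.+1 t)).
  apply/esym/cvg_lim => //.
  have -> : series (fun j => u j k (t + h) - u j k t - h * u j k.+1 t) =
     (fun m => series (fun j => u j k (t + h)) m - series (fun j => u j k t) m -
      h * series (fun j => u j k.+1 t) m).
    by apply/funext => m; rewrite /series /= !sumrB mulr_sumr.
  by apply: cvgB; [apply: cvgB; exact: c|apply: cvgMr; exact: c].
have := @cvg_dyadic (fun j => u j k (t + h) - u j k t - h * u j k.+1 t) (B k.+2 * h ^+ 2).
rewrite mulrA => H; apply: (H _).2 => j.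
rewrite mulrAC; apply: (jet_taylor2 _ _ (ju j)) => s; exact: uB.
Qed.

End DyadicSums.

(** * Uniform bounds along the curves [y + t^2 v] *)

Section CurveLemma.
Context {R : realType}.
Variables (n : nat) (M : nat -> R) (X : set 'rV[R]_n.+1) (f : 'rV[R]_n.+1 -> R).
Hypotheses (M0 : positive_seq M) (Mlc : log_convex M) (Mnq : non_quasianalytic M).
Hypothesis fA : AM_set M X f.

Lemma CN_curve_rows (u : 'I_n.+1 -> nat -> R -> R) (y : 'rV[R]_n.+1) (C : R) :
  0 < C -> (forall i, jet setT (u i)) ->
  (forall i k t, `|u i k t| <= C * k`!%:R * M k) ->
  CN_curve M (fun t => y + \row_i u i 0%N t).
Proof.
move=> C0 ju uB.
pose cc k t : 'rV[R]_n.+1 := (if k == 0%N then y else 0) + \row_i u i k t.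
have jcc : jet setT cc.
  move=> k t _; apply: is_derive_rV => i.
  have -> : (fun s => cc k s ord0 i) = cst ((if k == 0%N then y else 0) ord0 i) + u i k.
    by apply/funext => s; rewrite !mxE.
  have -> : cc k.+1 t ord0 i = 0 + u i k.+1 t by rewrite !mxE.
  exact: (@is_deriveD R R R _ _ t 1 _ _ (is_derive_cst _ _ _) (ju i k t I)).
have cE k t : derive1n k (fun t => y + \row_i u i 0%N t) t = cc k t.
  exact: (derive1n_jet openT jcc).
split=> [k t|K _].
  exact: (derivable_jetn openT (jet_jetn (n := k.+1) jcc)).
exists (C + `|y| / M 0%N), 1; split; first by rewrite ltr_wpDr// divr_ge0// ltW.
split=> // k t _; rewrite cE expr1n mulr1 /cc.
have hr : `|\row_i u i k t : 'rV[R]_n.+1| <= C * k`!%:R * M k.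
  apply: rV_norm_le => [|i]; first by rewrite !mulr_ge0// ltW.
  by rewrite mxE.
case: k hr => [|k] hr.
  apply: le_trans (ler_normD _ _) _; rewrite addrC mulr1 mulrDl divfK ?gt_eqF//.
  by rewrite lerD2r; move: hr; rewrite mulr1.
rewrite add0r; apply: le_trans hr _.
apply: ler_wpM2r; first exact/ltW/M0.
by rewrite ler_wpM2r// lerDl divr_ge0// ltW.
Qed.

Lemma CN_curve_scalar (u : nat -> R -> R) (y v : 'rV[R]_n.+1) (C : R) :
  0 < C -> jet setT u -> (forall k t, `|u k t| <= C * k`!%:R * M k) ->
  CN_curve M (fun t => y + u 0%N t *: v).
Proof.
move=> C0 ju uB.
have -> : (fun t => y + u 0%N t *: v) = (fun t => y + \row_i (u 0%N t * v ord0 i)).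
  by apply/funext => t; congr (_ + _); apply/rowP => i; rewrite !mxE.
apply: (@CN_curve_rows (fun i k t => u k t * v ord0 i) y (C * (`|v| + 1))).
- by rewrite mulr_gt0// ltr_wpDl.
- move=> i k t _; have := @jetZ R R setT (v ord0 i) u ju k t I.
  rewrite -[_ *: _]/(_ * _) mulrC; congr (is_derive _ _ _ _).
  by apply/funext => s; rewrite mulrC.
- move=> i k t; rewrite normrM.
  have -> : C * (`|v| + 1) * k`!%:R * M k = C * k`!%:R * M k * (`|v| + 1) by ring.
  apply: ler_pM => //; apply: le_trans (le_coord_norm _ _) _; lra.
Qed.

Variables (yo v0 : 'rV[R]_n.+1) (r d e : R).
Hypotheses (Xyo : X yo) (r0 : 0 < r) (d0 : 0 < d) (e0 : 0 < e).
Hypothesis cX : local_cone X yo v0 r d e.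

(* If the bound failed, the bad points and directions [(y_j, v_j)] could be
   strung on one curve of class [M] in [X] that equals
   [y_j + lam_j ^ 2 (t - t_j) ^ 2 v_j] near [t_j = 2 ^ -j]; the scales [lam_j]
   are fixed before [(y_j, v_j)] is chosen, and [f] is not of class [M] along
   this curve. *)
Lemma curve_lemma : exists eta C rho : R, [/\ 0 < eta, 0 < C, 0 < rho &
  forall y v k, X y -> `|y - yo| < eta -> `|v - v0| <= r / 2 ->
    `|derive1n k (fun t : R => f (y + t ^+ 2 *: v)) 0| <= C * rho ^+ k * k`!%:R * M k].
Proof.
apply: contrapT => hno.
have bad (eta C rho : R) : 0 < eta -> 0 < C -> 0 < rho -> exists y v k,
    [/\ X y, `|y - yo| < eta, `|v - v0| <= r / 2 &
      C * rho ^+ k * k`!%:R * M k < `|derive1n k (fun t : R => f (y + t ^+ 2 *: v)) 0|].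
  move=> eta0 C0 rho0; apply: contrapT => hb; apply: hno.
  exists eta, C, rho; split=> // y v k Xy yy vv; rewrite leNgt; apply/negP => lt.
  by apply: hb; exists y, v, k.
(* The j-th piece lives in [|t - tt j| <= 4 * w j = tt j / 8]; these intervals are disjoint since
   [tt] halves at each step. *)
pose tt j : R := (1 / 2) ^+ j.
pose w j : R := tt j / 32.
have tt0 j : 0 < tt j by rewrite exprn_gt0.
have tt1 j : tt j <= 1 by apply: exprn_ile1; lra.
have w0 j : 0 < w j by rewrite divr_gt0.
have w1 j : w j <= 1 by rewrite /w; have := tt1 j; lra.
have /choice[b] (j : nat) := bump_exists M0 Mnq (w0 j).
move=> /choice[C1 hb].
have w40 j : 0 < 4 * w j by rewrite mulr_gt0.
(* [b j] carries the displacement [y_j - yo] and vanishes beyond [w j]. [B j] carries the motion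
   along [v_j]; its plateau extends to [2 * w j], so the motion is not yet cut off where [b j]
   varies. *)
have /choice[B] (j : nat) := bump_exists M0 Mnq (w40 j).
move=> /choice[CB hB].
pose psi j := tmul (tmul (B j)).
pose m01 := M 0%N / M 1%N.
have m010 : 0 < m01 by rewrite divr_gt0.
pose C2 j := (4 * w j + m01) * ((4 * w j + m01) * CB j).
have hpsi j : bumpy M (4 * w j) (C2 j) (psi j).
  have [CB0 hBj _ _] := hB j.
  have wm : 0 <= 4 * w j + m01 by rewrite addr_ge0// ltW.
  apply: tmul_bumpy => //; [exact: ltW|by rewrite mulr_ge0// ltW|].
  by apply: tmul_bumpy => //; exact: ltW.
have C20 j : 0 < C2 j.
  by have [CB0 _ _ _] := hB j; rewrite /C2 !mulr_gt0// addr_gt0.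
clearbody C2.
have C10 j : 0 < C1 j by have [] := hb j.
pose V := `|v0| + r.
have V0 : 0 < V by rewrite /V ltr_wpDl.
(* [Q j] collects all that [q j = (tt j / Q j)^2] must beat: the constants of the bumps, so that the
   pieces decay like 2^(-j), and the height [d] and radius [e] of the local cone. *)
pose Q j := 1 + r * C1 j + C2 j * V + d^-1 + r / e.
have Q1 j : 1 <= Q j.
  have [h1 h2 h3 h4] : [/\ 0 < r * C1 j, 0 < C2 j * V, 0 < d^-1 & 0 < r / e].
    by split; [exact: mulr_gt0|exact: mulr_gt0|rewrite invr_gt0|exact: divr_gt0].
  by rewrite /Q; lra.
have Q0 j : 0 < Q j by apply: lt_le_trans (Q1 j).
pose lam j := tt j / Q j.
have lam0 j : 0 < lam j by rewrite divr_gt0.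
have lamQ j : lam j * Q j = tt j by rewrite /lam divfK// gt_eqF.
have lam1 j : lam j <= 1.
  by rewrite /lam ler_pdivrMr// mul1r; exact: le_trans (tt1 j) (Q1 j).
pose q j := lam j ^+ 2.
have q0 j : 0 < q j by rewrite exprn_gt0.
have ql j : q j <= lam j by rewrite /q expr2 ler_piMl// ltW.
have qQ j : q j * (r * C1 j + C2 j * V) <= tt j /\ q j <= d /\ q j * r <= e.
  have [h1 h2 h3 h4] : [/\ 0 < r * C1 j, 0 < C2 j * V, 0 < d^-1 & 0 < r / e].
    by split; [exact: mulr_gt0|exact: mulr_gt0|rewrite invr_gt0|exact: divr_gt0].
  have qQt : q j * Q j <= 1.
    apply: le_trans (tt1 j); rewrite -lamQ ler_wpM2r//; exact: ltW.
  have qQt' : q j * Q j <= tt j by rewrite -lamQ ler_wpM2r//; exact: ltW.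
  have le1 x : 0 <= x -> x <= Q j -> q j * x <= q j * Q j.
    by move=> x0 xQ; rewrite ler_wpM2l// ltW.
  split; first by apply: le_trans qQt'; apply: le1; rewrite /Q; lra.
  split.
    have : q j * d^-1 <= 1 by apply: le_trans qQt; apply: le1; rewrite /Q; lra.
    by rewrite ler_pdivrMr// mul1r.
  have : q j * (r / e) <= 1 by apply: le_trans qQt; apply: le1; rewrite /Q; lra.
  by rewrite mulrA ler_pdivrMr// mul1r.
(* Where [b j] is being cut off, [q s^2] is at least [q w^2 / 4]. A displacement of size [eps j]
   then amounts to tilting [v_j] by at most [r / 4], within the margin left by
   [|v_j - v0| <= r / 2]. *)
pose eps j := r * q j * w j ^+ 2 / 16.
have eps0 j : 0 < eps j.
  by rewrite /eps divr_gt0// mulr_gt0 ?exprn_gt0// mulr_gt0.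
have w2 j : w j ^+ 2 <= 1 by rewrite exprn_ile1// ltW.
have epsq j : eps j <= r * q j.
  rewrite /eps ler_pdivrMr//.
  have : r * q j * w j ^+ 2 <= r * q j by rewrite ler_piMr// mulr_ge0// ltW.
  by have : 0 < r * q j; [rewrite mulr_gt0|lra].
(* Near [tt j] the curve is run with [lam j * (t - tt j)] in place of [t], which multiplies the k-th
   derivative by [lam j ^ k]; the factor [1 / lam j] in the violated bound makes up for it. *)
have /choice[y] (j : nat) := bad (eps j) j.+1%:R (j.+1%:R / lam j) (eps0 j) (ltr0Sn _ _)
   (divr_gt0 (ltr0Sn _ _) (lam0 j)).
move=> /choice[v /choice[k hyv]].
pose u i j p t := b j p (t - tt j) * (y j - yo) ord0 i + q j * psi j p (t - tt j) * v j ord0 i.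
have ju i j : jet setT (u i j).
  have sh (z : nat -> R -> R) a (c : R) : jet setT z -> jet setT (fun p t => a * z p (t - c)).
    move=> jz p t _; apply: (@is_deriveZ R R R); have := @is_derive_affine R R (z p) 1 (- c) t (z p.+1 (t - c)).
    by rewrite scale1r mul1r; under eq_fun do rewrite mul1r; apply; exact: jz.
  have [_ [jb _ _] _ _] := hb j; have [jp _ _] := hpsi j.
  have -> : u i j = fun p t => ((y j - yo) ord0 i) * b j p (t - tt j) +
      (q j * v j ord0 i) * psi j p (t - tt j).
    by apply/funext => p; apply/funext => t; rewrite /u; ring.
  by apply: jetD; apply: sh.
have vV j : `|v j| <= V.
  have [_ _ vv _] := hyv j.
  rewrite /V -[v j](subrK v0) addrC; apply: le_trans (ler_normD _ _) _; rewrite lerD2l.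
  by apply: le_trans vv _; have := r0; lra.
have uB i j p t : `|u i j p t| <= (p`!%:R * M p) / 2 ^+ j.
  have [_ [_ bB _] _ _] := hb j; have [_ pB _] := hpsi j; have [_ yy _ _] := hyv j.
  apply: le_trans (ler_normD _ _) _.
  have -> : (2 ^+ j)^-1 = tt j :> R by rewrite /tt div1r exprVn.
  have pM : 0 <= p`!%:R * M p by rewrite mulr_ge0// ltW.
  have h1 : `|b j p (t - tt j) * (y j - yo) ord0 i| <= (C1 j * p`!%:R * M p) * eps j.
    rewrite normrM; apply: ler_pM => //.
    by apply: le_trans (le_coord_norm _ _) _; exact: ltW.
  have h2 : `|q j * psi j p (t - tt j) * v j ord0 i| <= (q j * (C2 j * p`!%:R * M p)) * V.
    rewrite normrM; apply: ler_pM => //; last exact: le_trans (le_coord_norm _ _) _.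
    by rewrite normrM (ger0_norm (ltW (q0 j))) ler_wpM2l// ltW.
  apply: le_trans (lerD h1 h2) _.
  apply: (@le_trans _ _ ((p`!%:R * M p) * (q j * (r * C1 j + C2 j * V)))); last first.
    by rewrite ler_wpM2l//; have [] := qQ j.
  have h3 : C1 j * (p`!%:R * M p) * eps j <= C1 j * (p`!%:R * M p) * (r * q j).
    by rewrite ler_wpM2l// mulr_ge0// ltW.
  by lra.
have [{}ju uS] : (forall i, jet setT (fun p t => limn (series (fun j => u i j p t)))) /\
   (forall i p t, `|limn (series (fun j => u i j p t))| <= 2 * p`!%:R * M p).
  by split=> i; have [h1 h2] := dyadic_sum_jet (ju i) (uB i) => // p t; rewrite -mulrA.
pose c t : 'rV[R]_n.+1 := yo + \row_i limn (series (fun j => u i j 0%N t)).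
have cCN : CN_curve M c.
  by apply: (@CN_curve_rows (fun i p t => limn (series (fun j => u i j p t))) yo 2).
have psi0 j t : psi j 0%N t = t ^+ 2 * B j 0%N t.
  by rewrite /psi /tmul /= !mul0r !addr0 expr2 mulrA.
have sep j1 j2 t : (j1 < j2)%N -> `|t - tt j1| <= 4 * w j1 -> `|t - tt j2| <= 4 * w j2 -> False.
  move=> j12; have : tt j2 <= tt j1 / 2.
    rewrite -(subnKC j12) /tt addSnnS exprD exprS [X in _ * X]mulrC mulrA.
    have : (1 / 2 : R) ^+ (j2 - j1.+1) <= 1 by apply: exprn_ile1; lra.
    move=> /(ler_wpM2l (ltW (tt0 j1))); rewrite mulr1 /tt => h.
    by move: h; set z := _ * (1 / 2) ^+ _; set z' := (1 / 2) ^+ j1; lra.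
  have := tt0 j1; rewrite !ler_norml /w => a1 a2 /andP[b1 b2] /andP[b3 b4]; lra.
have uz i j t : 4 * w j < `|t - tt j| -> u i j 0%N t = 0.
  move=> ht; have [_ [_ _ bz] _ _] := hb j; have [_ _ pz] := hpsi j.
  rewrite /u bz ?pz ?mulr0 ?mul0r ?addr0//; apply: le_lt_trans ht.
  by have := w0 j; lra.
have cE j t : `|t - tt j| <= 4 * w j -> c t = yo + b j 0%N (t - tt j) *: (y j - yo) +
     (q j * psi j 0%N (t - tt j)) *: v j.
  move=> tj; rewrite /c -addrA; congr (_ + _); apply/rowP => i; rewrite !mxE.
  rewrite (@series_single _ _ j); first by rewrite /u !mxE.
  move=> j' j'j; apply: uz; rewrite ltNge; apply/negP => tj'.
  move: j'j; rewrite neq_ltn => /orP[l|l]; first exact: (sep _ _ _ l tj' tj).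
  exact: (sep _ _ _ l tj tj').
have cz t : (forall j, 4 * w j < `|t - tt j|) -> c t = yo.
  move=> tj; rewrite /c -[RHS]addr0; congr (_ + _); apply/rowP => i; rewrite !mxE.
  by rewrite (@series_single _ _ 0%N) ?uz// => j _; exact: uz.
have cXt t : X (c t).
  have [[j tj]|nj] := pselect (exists j, `|t - tt j| <= 4 * w j); last first.
    by rewrite cz// => j; rewrite ltNge; apply/negP => tj; apply: nj; exists j.
  rewrite (cE j t tj) psi0.
  have [_ [_ _ bz] b1 b01] := hb j; have [_ [_ _ Bz] B1 B01] := hB j.
  have [Xy yy vv _] := hyv j; have [_ [qd qe]] := qQ j.
  set s := t - tt j in tj *.
  have s2 : s ^+ 2 <= 1.
    rewrite -real_normK ?num_real// exprn_ile1//.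
    by apply: le_trans tj _; have := tt1 j; rewrite /w; lra.
  have /andP[Bs0 Bs1] := B01 s; have /andP[bs0 bs1] := b01 s.
  have sB0 : 0 <= s ^+ 2 * B j 0%N s by rewrite mulr_ge0// sqr_ge0.
  have sB : q j * (s ^+ 2 * B j 0%N s) <= d.
    apply: le_trans qd; rewrite ler_piMr//; first exact: ltW.
    by rewrite mulr_ile1// sqr_ge0.
  have sB' : 0 <= q j * (s ^+ 2 * B j 0%N s) <= d by rewrite mulr_ge0// ltW.
  have [sw|sw] := lerP `|s| (w j / 2).
    rewrite b1// scale1r addrCA subrr addr0.
    apply: cX => //; last by apply: le_trans vv _; have := r0; lra.
    apply: lt_le_trans yy _; apply: le_trans (epsq j) _; by rewrite mulrC.
  have [sw2|sw2] := ltrP (w j) `|s|.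
    rewrite bz// scale0r addr0; apply: cX => //; first by rewrite subrr normr0.
    by apply: le_trans vv _; have := r0; lra.
  rewrite B1; last by have := w0 j; lra.
  rewrite mulr1.
  have ws : w j ^+ 2 / 4 <= s ^+ 2.
    rewrite -[s ^+ 2]real_normK ?num_real//.
    have -> : w j ^+ 2 / 4 = (w j / 2) ^+ 2 by field.
    by rewrite ler_sqr ?nnegrE ?(ltW sw)// divr_ge0// ltW.
  have qs0 : 0 < q j * s ^+ 2.
    by rewrite mulr_gt0//; apply: lt_le_trans ws; rewrite divr_gt0// exprn_gt0.
  (* In the transition zone the point is seen from [yo] rather than from [y j]: the displacement
     becomes a perturbation of the direction. *)
  have -> : yo + b j 0%N s *: (y j - yo) + (q j * s ^+ 2) *: v j =
     yo + (q j * s ^+ 2) *: (v j + (b j 0%N s / (q j * s ^+ 2)) *: (y j - yo)).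
    rewrite [in RHS]scalerDr scalerA [_ * (_ / _)]mulrC divfK ?gt_eqF//.
    by rewrite -addrA; congr (_ + _); rewrite addrC.
  apply: cX => //; first by rewrite subrr normr0.
    rewrite addrAC; apply: le_trans (ler_normD _ _) _.
    have : `|(b j 0%N s / (q j * s ^+ 2)) *: (y j - yo)| <= r / 4.
      rewrite normrZ normrM normfV (gtr0_norm qs0) (ger0_norm bs0) mulrAC ler_pdivrMr//.
      apply: (@le_trans _ _ (eps j)).
        by rewrite -[leRHS]mul1r; apply: ler_pM => //; exact: ltW.
      rewrite /eps.
      have : r * q j * (w j ^+ 2 / 4) <= r * q j * s ^+ 2 by rewrite ler_wpM2l// mulr_ge0// ltW.
      by lra.
    by have := r0; lra.
  apply/andP; split; first exact: ltW.
  by apply: le_trans qd; rewrite ler_piMr// ltW.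
have [fcs fcb] := fA cCN cXt.
have [C [rho [C0 [rho0 hC]]]] := fcb _ (@segment_compact _ 0 1).
(* [j + 1] exceeds both [C] and [rho], so the j-th counterexample contradicts the bound for [f]
   along [c] at [tt j]. *)
pose j := (Num.bound (C + rho)).
have Cj : C + rho < j.+1%:R.
  apply: lt_trans (archi_boundP _) _; first by rewrite addr_ge0// ltW.
  by rewrite ltr_nat.
have jF := jet_derive1n (I := setT) (fun k t _ => fcs k t).
have jG : jet [set s : R | `|s| < lam j * (w j / 2)]
   (fun p s => (lam j)^-1 ^+ p *: derive1n p (fun t => f (c t)) ((lam j)^-1 * s + tt j)).
  exact: jet_affine jF _.
have oI : open [set s : R | `|s| < lam j * (w j / 2)].
  apply: (@open_comp _ _ (fun t : R => `|t|) [set y | y < lam j * (w j / 2)]); last exact: open_lt.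
  by move=> s _; exact: norm_continuous.
have GE s : `|s| < lam j * (w j / 2) ->
   f (y j + s ^+ 2 *: v j) = f (c ((lam j)^-1 * s + tt j)).
  move=> hs; set s' := (lam j)^-1 * s.
  have hs' : `|s'| <= w j / 2.
    rewrite /s' normrM normfV (gtr0_norm (lam0 j)) mulrC ler_pdivrMr// mulrC; exact: ltW.
  have e1 : s' + tt j - tt j = s' by rewrite addrK.
  have wj := w0 j.
  have [_ _ b1 _] := hb j; have [_ _ B1 _] := hB j.
  rewrite (cE j) e1; last by lra.
  rewrite psi0 b1// B1; last by lra.
  rewrite mulr1 scale1r addrCA subrr addr0; congr (f (_ + _ *: _)).
  by rewrite /s' /q -exprMn mulrA divff ?mul1r// gt_eqF.
have [_ _ _] := hyv j.
rewrite (derive1n_jet oI jG)//; last 2 first.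
- by move=> s /GE ->; rewrite expr0 scale1r.
- by rewrite /= normr0 mulr_gt0// divr_gt0.
rewrite mulr0 add0r normrZ normrX normfV (gtr0_norm (lam0 j)).
have tj01 : `[0, 1]%classic (tt j) by rewrite /= in_itv /= (ltW (tt0 j)) tt1.
have := hC (k j) (tt j) tj01; set D := `|derive1n _ _ _| => hD.
rewrite exprMn => hlt.
have := lt_le_trans hlt (ler_wpM2l (exprn_ge0 (k j) (ltW _)) hD).
rewrite invr_gt0 => /(_ (lam0 j)).
set L := (lam j)^-1 ^+ k j => hlt2.
have L0 : 0 < L by rewrite exprn_gt0// invr_gt0.
have F0 : 0 < (k j)`!%:R * M (k j) by rewrite mulr_gt0// ltr0n fact_gt0.
have : L * ((k j)`!%:R * M (k j)) * (j.+1%:R * j.+1%:R ^+ k j) < L * ((k j)`!%:R * M (k j)) * (C * rho ^+ k j).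
  have -> : L * ((k j)`!%:R * M (k j)) * (j.+1%:R * j.+1%:R ^+ k j) =
    j.+1%:R * (j.+1%:R ^+ k j * L) * (k j)`!%:R * M (k j) by ring.
  have -> : L * ((k j)`!%:R * M (k j)) * (C * rho ^+ k j) =
    L * (C * rho ^+ k j * (k j)`!%:R * M (k j)) by ring.
  exact: hlt2.
rewrite ltr_pM2l ?mulr_gt0//; apply/negP; rewrite -leNgt.
have Cj' : C <= j.+1%:R by lra.
have rj : rho <= j.+1%:R by lra.
apply: ler_pM => //; [exact: ltW|by rewrite exprn_ge0// ltW|].
by rewrite lerXn2r// ?nnegrE// ltW.
Qed.

End CurveLemma.

(** * From even derivatives along squares to derivatives along rays *)

Section SquareSubstitution.
Context {R : realType}.
Variables (F : nat -> R -> R) (s0 : R).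

(* The [m]-th derivative of [t ^ a * F b (s0 + t ^ 2)]. *)
Fixpoint sqsub (m a b : nat) (t : R) : R :=
  if m is m'.+1 then a%:R * sqsub m' a.-1 b t + 2 * sqsub m' a.+1 b.+1 t
  else t ^+ a * F b (s0 + t ^+ 2).

Lemma sqsub_small m a b : (m < a)%N -> sqsub m a b 0 = 0.
Proof.
elim: m a b => [|m IH] a b ma /=; first by rewrite expr0n gtn_eqF// mul0r.
rewrite !IH ?mulr0 ?addr0//; first by rewrite ltnW// ltnW.
by case: a ma.
Qed.

(** The Taylor coefficient of t^(a+2i) in t^a F_b(s0 + t^2) is F_(b+i)(s0)/i!. In the induction the
    two terms of the recursion account for the shares a and 2i of the order a+2i. *)
Lemma sqsub0 i a b :
  i`!%:R * sqsub (a + i.*2) a b 0 = (a + i.*2)`!%:R * F (b + i)%N s0.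
Proof.
move mE : (a + i.*2)%N => m.
elim: m i a b mE => [|m IH] i a b mE.
  have [-> ->] : a = 0%N /\ i = 0%N by lia.
  by rewrite /= expr0 !mul1r expr0n /= addr0 addn0.
rewrite [sqsub _ _ _ _]/= mulrDr.
have e1 : i`!%:R * (a%:R * sqsub m a.-1 b 0) = a%:R * (m`!%:R * F (b + i)%N s0).
  case: a mE => [|a] mE; first by rewrite !mul0r mulr0.
  by rewrite /= mulrCA IH//; lia.
have e2 : i`!%:R * (2 * sqsub m a.+1 b.+1 0) = (i.*2)%:R * (m`!%:R * F (b + i)%N s0).
  case: i mE {e1} => [|i] mE.
    by rewrite sqsub_small ?mul0r ?mulr0//; lia.
  rewrite factS natrM -mulrA [i`!%:R * _]mulrCA IH; last by lia.
  by rewrite addSnnS -muln2 natrM; ring.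
by rewrite e1 e2 -mulrDl -natrD mE factS natrM mulrA.
Qed.

Lemma sqsub_jet (I : set R) a b : jet I F ->
  jet [set t | I (s0 + t ^+ 2)] (fun m => sqsub m a b).
Proof.
move=> jF m t It; elim: m a b => [|m IH] a b; last first.
  have h1 := @is_deriveZ R R R _ a%:R t 1 _ (IH a.-1 b).
  have h2 := @is_deriveZ R R R _ (2 : R) t 1 _ (IH a.+1 b.+1).
  exact: (@is_deriveD R R R _ _ t 1 _ _ h1 h2).
have dX k : is_derive t (1 : R) (fun x : R => x ^+ k) (k%:R * t ^+ k.-1).
  have := @is_deriveX R R id k t 1 1 (is_derive_id _ _).
  rewrite -[_ *: (1 : R)]/(_ * 1) mulr1; congr (is_derive _ _ _ _).
  by rewrite exprfctE.
have dF : is_derive t (1 : R) (fun x => F b (s0 + x ^+ 2)) (F b.+1 (s0 + t ^+ 2) * (2 * t)).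
  have d2 : is_derive t (1 : R) (fun x : R => s0 + x ^+ 2) (2 * t).
    have := @is_deriveD R R R (cst s0) (fun x => x ^+ 2) t 1 0 _ (is_derive_cst _ _ _) (dX 2%N).
    by rewrite add0r /= expr1.
  have := @is_derive1_comp R (F b) (fun x : R => s0 + x ^+ 2) t _ _ (jF b _ It) d2.
  exact.
have -> : sqsub 1 a b t = t ^+ a *: (F b.+1 (s0 + t ^+ 2) * (2 * t)) +
    F b (s0 + t ^+ 2) *: (a%:R * t ^+ a.-1).
  by rewrite /= [t ^+ a.+1]exprSr -![_ *: _]/(_ * _); ring.
exact: (@is_deriveM R R (fun x => x ^+ a) (fun x => F b (s0 + x ^+ 2)) t 1 _ _ (dX a) dF).
Qed.

Lemma derive_even_square (I : set R) k (G : R -> R) : open I -> I s0 -> jet I F ->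
  (forall t, G t = F 0%N (s0 + t ^+ 2)) ->
  k`!%:R * derive1n k.*2 G 0 = (k.*2)`!%:R * F k s0.
Proof.
move=> oI Is0 jF GE.
have oJ : open [set t | I (s0 + t ^+ 2)].
  apply: (@open_comp _ _ (fun t : R => s0 + t ^+ 2) I) => // t _.
  by apply: cvgD; [exact: cvg_cst|exact: exprn_continuous].
rewrite (derive1n_jet oJ (sqsub_jet 0 0 jF)).
- by have := sqsub0 k 0 0; rewrite !add0n.
- by move=> t _; rewrite GE /= expr0 mul1r.
- by rewrite /= expr0n addr0.
Qed.

End SquareSubstitution.

Section Rays.
Context {R : realType}.
Variables (n : nat) (M : nat -> R) (X : set 'rV[R]_n.+1) (f : 'rV[R]_n.+1 -> R).
Hypotheses (M0 : positive_seq M) (Mlc : log_convex M) (Mnq : non_quasianalytic M).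
Hypothesis fA : AM_set M X f.

Lemma bumpy_CN_curve (w C : R) u (y v : 'rV[R]_n.+1) : 0 < C -> bumpy M w C u ->
  CN_curve M (fun t => y + u 0%N t *: v).
Proof. by move=> C0 [ju uB _]; exact: (CN_curve_scalar M0 _ _ C0 ju uB). Qed.

(** With a bump [b], the curve [y + t^2 b(t) v] stays on the ray and passes through [y] at [t = 0];
    the statement is continuity along it, read at [t = sqrt s]. *)
Lemma ray_right_continuous (y v : 'rV[R]_n.+1) (d : R) : 0 < d ->
  (forall s, 0 <= s <= d -> X (y + s *: v)) ->
  forall e, 0 < e -> exists2 del, 0 < del &
    forall s, 0 <= s < del -> `|f (y + s *: v) - f y| <= e.
Proof.
move=> d0 hX e e0.
pose w := Num.min 1 d.
have w0 : 0 < w by rewrite lt_min ltr01.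
have w1 : w <= 1 by rewrite ge_min lexx.
have wd : w <= d by rewrite ge_min lexx orbT.
have [b [C [C0 hb b1 b01]]] := bump_exists M0 Mnq w0.
have m010 : 0 < w + M 0%N / M 1%N by rewrite addr_gt0// divr_gt0.
have hb2 : bumpy M w ((w + M 0%N / M 1%N) * ((w + M 0%N / M 1%N) * C)) (tmul (tmul b)).
  apply: tmul_bumpy => //; [exact: ltW|by rewrite mulr_ge0// ltW|].
  by apply: tmul_bumpy => //; exact: ltW.
have psi0 t : tmul (tmul b) 0%N t = t ^+ 2 * b 0%N t.
  by rewrite /tmul /= !mul0r !addr0 expr2 mulrA.
have cc := bumpy_CN_curve y v (mulr_gt0 m010 (mulr_gt0 m010 C0)) hb2.
have cX t : X (y + tmul (tmul b) 0%N t *: v).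
  apply: hX; rewrite psi0; have /andP[bt0 bt1] := b01 t.
  have [_ _ bz] := hb.
  apply/andP; split; first by rewrite mulr_ge0// sqr_ge0.
  apply: le_trans wd; case: (ltrP w `|t|) => tw; first by rewrite bz// mulr0 ltW.
  rewrite -[leRHS]mulr1; apply: ler_pM => //; first exact: sqr_ge0.
  rewrite -real_normK ?num_real// expr2 -[leRHS]mulr1; apply: ler_pM => //.
  exact: le_trans w1.
have [fs _] := fA cc cX.
have fc : {for 0, continuous (fun t => f (y + tmul (tmul b) 0%N t *: v))}.
  by apply: differentiable_continuous; apply/derivable1_diffP; exact: (fs 0%N).
move/cvgrPdist_le: fc => /(_ e e0); rewrite /= psi0 expr0n mul0r scale0r addr0.
move=> /nbhs_ballP[z /= z0 hz].
pose del := (Num.min z (w / 2)) ^+ 2.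
have zw0 : 0 < Num.min z (w / 2) by rewrite lt_min z0 divr_gt0.
exists del; first by rewrite exprn_gt0.
move=> s /andP[s0 sdel].
have sq : Num.sqrt s ^+ 2 = s by rewrite sqr_sqrtr.
have sqlt : Num.sqrt s < Num.min z (w / 2).
  by rewrite -(ltr_pXn2r (n := 2)) ?nnegrE ?sqrtr_ge0// ?(ltW zw0)// sq.
move: sqlt; rewrite lt_min => /andP[sz sw].
have := hz (Num.sqrt s); rewrite -ball_normE /= sub0r normrN ger0_norm ?sqrtr_ge0//.
move=> /(_ sz); rewrite psi0 sq b1 ?mulr1 1?distrC//.
by rewrite ger0_norm ?sqrtr_ge0// ltW.
Qed.

(** Around an interior point of the ray both directions are available: [y + (s0 + t b(t)) v] is a
    curve of class [M] in [X] and is affine in [t] near 0. *)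
Lemma ray_derivable (y v : 'rV[R]_n.+1) (d : R) k s0 : 0 < s0 < d ->
  (forall s, 0 <= s <= d -> X (y + s *: v)) ->
  derivable (derive1n k (fun s => f (y + s *: v))) s0 1.
Proof.
move=> /andP[s00 s0d] hX.
pose w := Num.min 1 (Num.min s0 (d - s0)).
have w0 : 0 < w by rewrite !lt_min ltr01 s00 subr_gt0.
have w1 : w <= s0 by rewrite !ge_min lexx orbT.
have wd : w <= d - s0 by rewrite !ge_min lexx !orbT.
have [b [C [C0 hb b1 b01]]] := bump_exists M0 Mnq w0.
have m010 : 0 < w + M 0%N / M 1%N by rewrite addr_gt0// divr_gt0.
have hb2 : bumpy M w ((w + M 0%N / M 1%N) * C) (tmul b).
  by apply: tmul_bumpy => //; exact: ltW.
have psi0 t : tmul b 0%N t = t * b 0%N t by rewrite /tmul /= mul0r addr0.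
have cc := bumpy_CN_curve (y + s0 *: v) v (mulr_gt0 m010 C0) hb2.
have cX t : X (y + s0 *: v + tmul b 0%N t *: v).
  rewrite -addrA -scalerDl; apply: hX; rewrite psi0; have /andP[bt0 bt1] := b01 t.
  have [_ _ bz] := hb.
  have : `|t * b 0%N t| <= w.
    case: (ltrP w `|t|) => tw; first by rewrite bz// mulr0 normr0 ltW.
    by rewrite normrM -[leRHS]mulr1; apply: ler_pM => //; rewrite ger0_norm.
  by rewrite ler_norml => /andP[h1 h2]; lra.
have [fs _] := fA cc cX.
have jF := jet_derive1n (I := setT) (fun k t _ => fs k t).
have jG : jet [set s : R | `|s - s0| < w / 2]
   (fun p s => (1 : R) ^+ p *: derive1n p (fun t => f (y + s0 *: v + tmul b 0%N t *: v)) (1 * s - s0)).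
  exact: jet_affine jF _.
have oI : open [set s : R | `|s - s0| < w / 2].
  have -> : [set s : R | `|s - s0| < w / 2] = ball s0 (w / 2).
    by rewrite -ball_normE; apply/seteqP; split=> s /=; rewrite distrC.
  exact: ball_open.
apply: (derivable_jetn oI (jet_jetn (n := k.+1) jG)) => //; last first.
  by rewrite /= subrr normr0 divr_gt0.
move=> s /= hs; rewrite expr0 scale1r mul1r psi0 b1; last exact: ltW.
by rewrite mulr1 -addrA -scalerDl [s0 + _]addrC subrK.
Qed.

Variables (yo v0 : 'rV[R]_n.+1) (r d e : R).
Hypotheses (Xyo : X yo) (r0 : 0 < r) (d0 : 0 < d) (e0 : 0 < e).
Hypothesis cX : local_cone X yo v0 r d e.

(** The 2k-th derivative at 0 of [t |-> f (y + (s + t^2) v)] is (2k)!/k! times the k-th derivative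
    at [s]. The (2k)! cancels that of [curve_lemma] and leaves k! M_(2k). The point [s] is positive,
    so that the function on the ray is differentiable on both sides of it. *)
Lemma ray_lemma : exists eta C rho : R, [/\ 0 < eta, 0 < C, 0 < rho &
  forall y v, X y -> `|y - yo| < eta -> `|v - v0| <= r / 2 ->
  [/\ forall s, 0 <= s <= eta -> X (y + s *: v),
      forall k s, 0 < s < eta -> derivable (derive1n k (fun s => f (y + s *: v))) s 1 &
      forall k s, 0 < s < eta ->
        `|derive1n k (fun s => f (y + s *: v)) s| <= C * rho ^+ k * k`!%:R * M (2 * k)%N]].
Proof.
have [eta [C [rho [eta0 C0 rho0 hb]]]] := curve_lemma M0 Mlc Mnq fA Xyo r0 d0 e0 cX.
pose V := `|v0| + r.
have V0 : 0 < V by rewrite /V ltr_wpDl.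
pose eta' := Num.min (Num.min d e) (Num.min (eta / 2) (eta / (2 * V))).
have h1 : eta' <= d by rewrite !ge_min lexx.
have h2 : eta' <= e by rewrite !ge_min lexx !orbT.
have h3 : eta' <= eta / 2 by rewrite !ge_min lexx !orbT.
have h4 : eta' <= eta / (2 * V) by rewrite !ge_min lexx !orbT.
have h0 : 0 < eta' by rewrite !lt_min d0 e0 !divr_gt0// mulr_gt0.
exists eta', C, (rho ^+ 2); split=> //; first by rewrite exprn_gt0.
move=> y v Xy yy vv.
have hX s : 0 <= s <= d -> X (y + s *: v).
  move=> hs; apply: cX => //; first exact: lt_le_trans h2.
  by apply: le_trans vv _; have := r0; lra.
have der k s : 0 < s < eta' -> derivable (derive1n k (fun s => f (y + s *: v))) s 1.
  by move=> /andP[s0 s1]; apply: (@ray_derivable y v d) => //; rewrite s0 (lt_le_trans s1).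
split=> // [s /andP[s0 s1]|k s hs]; first by apply: hX; rewrite s0 (le_trans s1).
have /andP[s0 s1] := hs.
have oI : open [set s : R | 0 < s < eta'].
  have -> : [set s : R | 0 < s < eta'] = `]0, eta'[%classic.
    by apply/seteqP; split=> z /=; rewrite in_itv.
  exact: itv_open.
have jF := jet_derive1n (I := [set s : R | 0 < s < eta']) (fun k t It => der k t It).
have := @derive_even_square R _ s _ k (fun t => f (y + (s + t ^+ 2) *: v)) oI hs jF.
move=> /(_ (fun t => erefl)); set D := derive1n k _ s => hD.
have vV : `|v| <= V.
  rewrite /V -[v](subrK v0) addrC; apply: le_trans (ler_normD _ _) _; rewrite lerD2l.
  by apply: le_trans vv _; have := r0; lra.
have := hb (y + s *: v) v k.*2; have -> : (fun t => f (y + s *: v + t ^+ 2 *: v)) =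
          (fun t => f (y + (s + t ^+ 2) *: v)) :> (R -> R).
  by apply/funext => t; rewrite scalerDl addrA.
set G := derive1n _ _ _ in hD *.
have yv : `|y + s *: v - yo| < eta.
  rewrite addrAC; apply: le_lt_trans (ler_normD _ _) _.
  have : `|s *: v| <= eta / 2.
    rewrite normrZ (gtr0_norm s0).
    apply: (@le_trans _ _ (eta / (2 * V) * V)).
      by apply: ler_pM => //; [exact: ltW|apply: le_trans h4; exact: ltW].
    by rewrite invfM mulrA mulrVK ?unitfE ?gt_eqF.
  by have := lt_le_trans yy h3; lra.
move=> /(_ (hX _ _) yv vv) hG.
have {}hG : `|G| <= C * rho ^+ k.*2 * (k.*2)`!%:R * M k.*2.
  by apply: hG; rewrite (ltW s0) /=; apply: le_trans h1; exact: ltW.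
have F0 : 0 < (k.*2)`!%:R :> R by rewrite ltr0n fact_gt0.
rewrite -(ler_pM2l F0).
have -> : (k.*2)`!%:R * `|D| = k`!%:R * `|G|.
  by rewrite -[(k.*2)`!%:R]ger0_norm// -normrM -hD normrM ger0_norm.
apply: le_trans (ler_wpM2l _ hG) _ => //.
by rewrite -exprM -[k.*2]mul2n le_eqVlt; apply/orP; left; apply/eqP; ring.
Qed.

End Rays.
(** * Mixed directional derivatives *)

Section DirectionalDerivatives.
Context {R : realType}.
Variable n : nat.
Notation V := ('rV[R]_n.+1).
Implicit Types (g h : V -> R) (U : set V) (x v w : V) (vs us ws : seq V).

Lemma differentiable_approx g x : differentiable g x -> forall e : R, 0 < e ->
  exists2 d, 0 < d & forall z, `|z| < d -> `|g (x + z) - g x - 'd g x z| <= e * `|z|.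
Proof.
move=> /diff_locally/eqaddoP dg e e0.
have /nbhs_ballP[d /= d0 hd] := dg e e0; exists d => // z zd.
have := hd z; rewrite -ball_normE /= sub0r normrN => /(_ zd).
rewrite -[X in `|X| <= _]/(g (z + x) - (g x + 'd g x z)) opprD addrA.
by rewrite [z + x]addrC.
Qed.

Lemma deriveDv g x v w : differentiable g x -> 'D_(v + w) g x = 'D_v g x + 'D_w g x.
Proof. by move=> dg; rewrite !deriveE// linearD. Qed.

Lemma deriveZv g x (a : R) v : differentiable g x -> 'D_(a *: v) g x = a * 'D_v g x.
Proof. by move=> dg; rewrite !deriveE// linearZ. Qed.

Lemma is_derive_line g x v (s : R) : differentiable g (x + s *: v) ->
  is_derive s (1 : R) (fun t => g (x + t *: v)) ('D_v g (x + s *: v)).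
Proof.
move=> dg.
have dl : is_diff s (fun t : R => x + t *: v) (fun t => t *: v).
  rewrite [X in is_diff _ _ X](_ : _ = 0 + (fun t => t *: v)); last first.
    by apply/funext => t; rewrite add0r.
  apply: (@is_diffD _ _ _ (cst x) (fun t : R => t *: v) 0 (fun t => t *: v)).
have dd : differentiable (g \o (fun t : R => x + t *: v)) s.
  by apply: differentiable_comp; [exact: ex_diff|exact: dg].
apply: DeriveDef; first exact/derivable1_diffP.
rewrite -[LHS]/('D_1 (g \o (fun t : R => x + t *: v)) s) deriveE// diff_comp//=.
by rewrite diff_val scale1r deriveE.
Qed.

Lemma near_line U x v (s : R) : open U -> U (x + s *: v) ->
  exists2 d, 0 < d & forall t, `|t - s| < d -> U (x + t *: v).
Proof.
move=> oU Us.
have /nbhs_ballP[e /= e0 he] : nbhs (x + s *: v) U by exact: open_nbhs_nbhs.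
exists (e / (`|v| + 1)); first by rewrite divr_gt0// ltr_wpDl.
move=> t ts; apply: he; rewrite -ball_normE /= opprD addrACA subrr add0r -scalerBl.
rewrite normrZ distrC; move: ts; rewrite ltr_pdivlMr ?ltr_wpDl//; apply: le_lt_trans.
by rewrite ler_wpM2l// lerDl.
Qed.

(** The mean value theorem in direction [v] reduces the difference to increments of ['D_v g], which
    is differentiable at [x]. The difference itself is symmetric in [v] and [w], whence
    [schwarz]. *)
Lemma second_difference U g x v w (e : R) : open U -> U x ->
  (forall y, U y -> differentiable g y) -> differentiable ('D_v g) x -> 0 < e ->
  exists2 d, 0 < d & forall t, 0 < t < d ->
   `|g (x + t *: v + t *: w) - g (x + t *: v) - (g (x + t *: w) - g x)
     - t ^+ 2 * 'D_w ('D_v g) x| <= e * t ^+ 2.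
Proof.
move=> oU Ux dg dvg e0.
pose K := 2 * `|v| + `|w| + 1.
have K0 : 0 < K by rewrite /K ltr_wpDl// addr_ge0// mulr_ge0.
have [d1 d10 hd1] := differentiable_approx dvg (divr_gt0 e0 K0).
have /nbhs_ballP[d2 /= d20 hd2] : nbhs x U by exact: open_nbhs_nbhs.
pose d := Num.min d1 d2 / K.
have dd0 : 0 < Num.min d1 d2 by rewrite lt_min d10.
exists d; first by rewrite divr_gt0.
move=> t /andP[t0 td].
have tK : t * K < Num.min d1 d2 by rewrite -ltr_pdivlMr.
have small (z : V) : `|z| <= t * (K - 1) -> `|z| < d1 /\ `|z| < d2.
  move=> hz; move: tK; rewrite lt_min => /andP[h1 h2].
  have : t * (K - 1) <= t * K by rewrite ler_wpM2l; lra.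
  by move=> h3; split; [apply: le_lt_trans h1|apply: le_lt_trans h2]; apply: le_trans h3.
have nz (s a : R) : 0 <= s <= t -> 0 <= a <= t -> `|s *: v + a *: w| <= t * `|v| + t * `|w|.
  move=> /andP[s0 s1] /andP[a0 a1]; apply: le_trans (ler_normD _ _) _.
  by rewrite !normrZ (ger0_norm s0) (ger0_norm a0); apply: lerD; rewrite ler_wpM2r.
have nz' (s a : R) : 0 <= s <= t -> 0 <= a <= t -> `|s *: v + a *: w| <= t * (K - 1).
  move=> hs ha; apply: le_trans (nz s a hs ha) _; rewrite /K.
  have : 0 <= t * `|v| by rewrite mulr_ge0// ltW.
  by lra.
have inU (z : V) : `|z| <= t * (K - 1) -> U (x + z).
  move=> /small[_ hz]; apply: hd2; rewrite -ball_normE /=.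
  by rewrite opprD addrA subrr sub0r normrN.
have inUv s a : 0 <= s <= t -> 0 <= a <= t -> U (x + a *: w + s *: v).
  by move=> hs ha; rewrite -addrA [_ *: w + _]addrC; apply: inU; exact: nz'.
have t01 : 0 <= t <= t by rewrite ltW/=.
have t00 : 0 <= (0 : R) <= t by rewrite lexx ltW.
have dpsi s : 0 <= s <= t -> is_derive s (1 : R)
   ((fun s => g (x + t *: w + s *: v)) - (fun s => g (x + 0 *: w + s *: v)))
   ('D_v g (x + t *: w + s *: v) - 'D_v g (x + 0 *: w + s *: v)).
  move=> hs; have h1 := is_derive_line (dg _ (inUv s t hs t01)).
  have h2 := is_derive_line (dg _ (inUv s 0 hs t00)).
  exact: (@is_deriveB R R R _ _ s 1 _ _ h1 h2).
have [s hs] := MVT_everywhere (ltW t0) dpsi.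
rewrite -![((_ : R -> R) - _) _]/(_ - _) !scale0r !addr0 subr0 => e1.
have -> : g (x + t *: v + t *: w) - g (x + t *: v) - (g (x + t *: w) - g x) =
    ('D_v g (x + t *: w + s *: v) - 'D_v g (x + s *: v)) * t.
  rewrite -e1 [x + t *: v + t *: w]addrAC; ring.
rewrite ['D_w _ x](deriveE _ dvg).
have lin (a b : R) : 'd ('D_v g) x (a *: v + b *: w) =
    a * 'd ('D_v g) x v + b * 'd ('D_v g) x w by rewrite linearD !linearZ.
have linv (a : R) : 'd ('D_v g) x (a *: v) = a * 'd ('D_v g) x v by rewrite linearZ.
have z1 := hd1 (s *: v + t *: w) (small _ (nz' s t hs t01)).1.
have := nz' s 0 hs t00; rewrite scale0r addr0 => hsv.
have z2 := hd1 (s *: v) (small _ hsv).1.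
move: z1; rewrite lin [x + (s *: v + _)]addrA [x + s *: v + _]addrAC.
move: z2; rewrite linv.
set A := 'D_v g (x + s *: v); set B := 'D_v g (x + t *: w + s *: v).
set D := 'D_v g x; set dv := 'd _ x v; set dw := 'd _ x w => z2 z1.
have -> : (B - A) * t - t ^+ 2 * dw = t * ((B - D - (s * dv + t * dw)) - (A - D - s * dv)).
  by ring.
rewrite normrM (gtr0_norm t0) expr2 mulrCA ler_wpM2l ?(ltW t0)//.
apply: le_trans (ler_normB _ _) _; apply: le_trans (lerD z1 z2) _.
have b1 := nz s t hs t01; have := nz s 0 hs t00; rewrite scale0r addr0 => b2.
rewrite -mulrDr mulrAC ler_pdivrMr// -mulrA ler_wpM2l ?(ltW e0)//.
have b2' : `|s *: v| <= t * `|v|.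
  by rewrite normrZ; have /andP[s0 s1] := hs; rewrite (ger0_norm s0) ler_wpM2r.
by have := ltW t0; rewrite /K; lra.
Qed.

Lemma schwarz U g x v w : open U -> U x -> (forall y, U y -> differentiable g y) ->
  differentiable ('D_v g) x -> differentiable ('D_w g) x ->
  'D_w ('D_v g) x = 'D_v ('D_w g) x.
Proof.
move=> oU Ux dg dv dw; apply/eqP; rewrite -subr_eq0 -normr_le0; apply/ler_addgt0Pr => e e0.
have e20 : 0 < e / 2 by rewrite divr_gt0.
have [d1 d10 h1] := second_difference w oU Ux dg dv e20.
have [d2 d20 h2] := second_difference v oU Ux dg dw e20.
pose t := Num.min d1 d2 / 2.
have m0 : 0 < Num.min d1 d2 by rewrite lt_min d10.
have t0 : 0 < t by rewrite divr_gt0.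
have tm : t < Num.min d1 d2 by rewrite /t; lra.
move: (tm); rewrite lt_min => /andP[td1 td2].
have := h1 t; rewrite t0 td1 => /(_ isT).
have := h2 t; rewrite t0 td2 => /(_ isT); rewrite [x + t *: w + t *: v]addrAC.
set A := g (x + t *: v + t *: w); set B := g (x + t *: w); set C := g (x + t *: v).
set D := 'D_w _ x; set E := 'D_v _ x => z1 z2.
have t2 : 0 < t ^+ 2 by rewrite exprn_gt0.
rewrite add0r -(ler_pM2l t2).
have -> : t ^+ 2 * `|D - E| = `|(A - B - (C - g x) - t ^+ 2 * E) - (A - C - (B - g x) - t ^+ 2 * D)|.
  by rewrite -{1}(gtr0_norm t2) -normrM; congr (`| _ |); ring.
apply: le_trans (ler_normB _ _) _; apply: le_trans (lerD z1 z2) _.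
by rewrite le_eqVlt; apply/orP; left; apply/eqP; field.
Qed.

Lemma iterD_cat us vs g : iterD (us ++ vs) g = iterD us (iterD vs g).
Proof. by rewrite /Defs.iterD foldr_cat. Qed.

Lemma iterD_eq_on U g h vs : open U -> (forall y, U y -> g y = h y) ->
  forall y, U y -> iterD vs g y = iterD vs h y.
Proof.
move=> oU gh; elim: vs => [//|v vs IH] y Uy /=; apply: near_eq_derive.
by have : \forall z \near y, U z by [exact: open_nbhs_nbhs]; apply: filterS.
Qed.

Lemma smooth_on_iterD U g vs : smooth_on U g -> smooth_on U (iterD vs g).
Proof. by move=> sg us x Ux; rewrite -iterD_cat; exact: sg. Qed.

Lemma iterD_swap U g v w vs x : open U -> smooth_on U g -> U x ->
  iterD (v :: w :: vs) g x = iterD (w :: v :: vs) g x.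
Proof.
move=> oU sg Ux /=; apply: (@schwarz U) => //.
- by move=> y Uy; exact: sg.
- exact: (sg (w :: vs)).
- exact: (sg (v :: vs)).
Qed.

Lemma iterD_perm U g vs ws : open U -> smooth_on U g -> perm_eq vs ws ->
  forall x, U x -> iterD vs g x = iterD ws g x.
Proof.
move=> oU sg.
have front us v ts x : U x -> iterD (us ++ v :: ts) g x = iterD (v :: us ++ ts) g x.
  move=> Ux; elim: us x Ux => [//|u us IH] x Ux.
  rewrite (_ : iterD ((u :: us) ++ v :: ts) g x = iterD (u :: v :: us ++ ts) g x); last first.
    exact: (@iterD_eq_on U _ _ [:: u] oU IH).
  by rewrite (iterD_swap u v (us ++ ts) oU sg Ux).
elim: vs ws => [|v vs IH] ws vw x Ux; first by move: vw; rewrite perm_sym => /perm_nilP ->.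
have : v \in ws by rewrite -(perm_mem vw) mem_head.
move=> /splitPr vws; case: vws vw => us ts vw.
rewrite front//; apply: (@iterD_eq_on U _ _ [:: v] oU) => // y Uy; apply: IH => //.
rewrite -(perm_cons v); apply: perm_trans vw _.
exact/permPl/(perm_catCA us [:: v] ts).
Qed.

Lemma iterD_add U g h vs : open U -> smooth_on U g -> smooth_on U h ->
  forall y, U y -> iterD vs (fun z => g z + h z) y = iterD vs g y + iterD vs h y.
Proof.
move=> oU sg sh; elim: vs => [//|v vs IH] y Uy /=.
rewrite (@near_eq_derive _ _ _ _ (iterD vs g + iterD vs h)); last first.
  by have : \forall z \near y, U z by [exact: open_nbhs_nbhs]; apply: filterS.
by rewrite deriveD//; apply: diff_derivable; [exact: sg|exact: sh].
Qed.

Lemma iterD_scale U g (a : R) vs : open U -> smooth_on U g ->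
  forall y, U y -> iterD vs (fun z => a * g z) y = a * iterD vs g y.
Proof.
move=> oU sg; elim: vs => [//|v vs IH] y Uy /=.
rewrite (@near_eq_derive _ _ _ _ (a *: iterD vs g)); last first.
  by have : \forall z \near y, U z by [exact: open_nbhs_nbhs]; apply: filterS.
by rewrite deriveZ//; apply: diff_derivable; exact: sg.
Qed.

Lemma iterD_slot_add U g us v w vs x : open U -> smooth_on U g -> U x ->
  iterD (us ++ (v + w) :: vs) g x = iterD (us ++ v :: vs) g x + iterD (us ++ w :: vs) g x.
Proof.
move=> oU sg Ux; rewrite !iterD_cat -(iterD_add (U := U))//; last 2 first.
- exact: smooth_on_iterD.
- exact: smooth_on_iterD.
apply: (@iterD_eq_on U _ _ us oU) => // y Uy /=; rewrite deriveDv//; exact: sg.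
Qed.

Lemma iterD_slot_scale U g us (a : R) v vs x : open U -> smooth_on U g -> U x ->
  iterD (us ++ (a *: v) :: vs) g x = a * iterD (us ++ v :: vs) g x.
Proof.
move=> oU sg Ux; rewrite !iterD_cat -(iterD_scale (U := U))//; last exact: smooth_on_iterD.
apply: (@iterD_eq_on U _ _ us oU) => // y Uy /=; rewrite deriveZv//; exact: sg.
Qed.

Lemma iterD_scale_all U g us (a : R) vs x : open U -> smooth_on U g -> U x ->
  iterD (us ++ map ( *:%R a) vs) g x = a ^+ size vs * iterD (us ++ vs) g x.
Proof.
move=> oU sg Ux; elim: vs us => [|v vs IH] us /=; first by rewrite mul1r.
rewrite (iterD_slot_scale _ _ _ _ oU)// -cat_rcons IH exprS -mulrA; congr (_ * (_ * _)).
by rewrite cat_rcons.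
Qed.

Lemma iterD_binomial U g us v w m x : open U -> smooth_on U g -> U x ->
  iterD (us ++ nseq m (v + w)) g x =
  \sum_(i < m.+1) 'C(m, i)%:R * iterD (us ++ nseq i w ++ nseq (m - i) v) g x.
Proof.
move=> oU sg Ux; elim: m us => [|m IH] us.
  by rewrite big_ord1 bin0 mul1r.
rewrite /= (iterD_slot_add _ _ _ _ oU)// -!cat_rcons !IH.
rewrite [RHS]big_ord_recl [X in X + _ = _]big_ord_recl /= ?bin0 ?subn0 !mul1r.
rewrite cat_rcons -addrA; congr (_ + _).
rewrite [in RHS]big_ord_recr /= [in X in _ + X = _]big_ord_recr /= addrA; congr (_ + _); last first.
  by rewrite /bump /= !add1n !binn subnn subSS subnn cat_rcons.
rewrite -big_split /=; apply: eq_bigr => i _; rewrite /bump /= !add1n binS natrD mulrDl; congr (_ * _ + _ * _).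
- rewrite subSS; apply: (iterD_perm oU sg) => //; rewrite cat_rcons perm_cat2l.
  have -> : (m - i = (m - i.+1).+1)%N by rewrite subnSK.
  exact/permPl/(perm_catCA [:: v] (w :: nseq i w) (nseq (m - i.+1) v)).
- by rewrite cat_rcons subSS.
Qed.

Fixpoint mixed_diff (ws : seq V) (q : V -> R) (v : V) : R :=
  if ws is w :: ws' then mixed_diff ws' (fun u => q (u + w) - q u) v else q v.

Lemma mixed_diff_sum ws m (c : 'I_m -> R) (q : 'I_m -> V -> R) v :
  mixed_diff ws (fun u => \sum_i c i * q i u) v = \sum_i c i * mixed_diff ws (q i) v.
Proof.
elim: ws q v => [//|w ws IH] q v /=; rewrite -IH; congr (mixed_diff _ _ _).
by apply/funext => u; rewrite -sumrB; apply: eq_bigr => i _; rewrite mulrBr.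
Qed.

Lemma mixed_diff_bound ws q v (B : R) :
  (forall u, `|u - v| <= \sum_(w <- ws) `|w| -> `|q u| <= B) ->
  `|mixed_diff ws q v| <= 2 ^+ size ws * B.
Proof.
elim: ws q v B => [|w ws IH] q v B hq /=.
  by rewrite mul1r; apply: hq; rewrite subrr normr0 big_nil.
rewrite exprSr -mulrA; apply: IH => u hu.
rewrite mulr_natl mulr2n; apply: le_trans (ler_normB _ _) _; apply: lerD; apply: hq; rewrite big_cons.
  by rewrite addrAC addrC; apply: le_trans (ler_normD _ _) _; rewrite lerD2l.
by apply: le_trans hu _; rewrite lerDr.
Qed.

(** By the binomial formula each difference lowers the degree in [u] by one and fills one slot with
    its step, the leading term with coefficient equal to the degree. After as many differences as
    the degree only the factorial and the polar form remain; one more gives 0. *)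
Lemma mixed_diff_diag U g x m us ws v : open U -> smooth_on U g -> U x ->
  (m <= size ws)%N ->
  mixed_diff ws (fun u => iterD (us ++ nseq m u) g x) v =
  if m == size ws then m`!%:R * iterD (us ++ ws) g x else 0.
Proof.
move=> oU sg Ux; elim: ws m us v => [|w ws IH] m us v.
  by rewrite leqn0 => /eqP -> /=; rewrite mul1r.
case: m => [_|m ms] /=.
  under [X in mixed_diff _ X]eq_fun do rewrite subrr.
  have -> : (fun=> 0) = (fun u : V => \sum_(i < 0) (0 : R) * (cst (0 : R)) u) :> (V -> R).
    by apply/funext => u; rewrite big_ord0.
  by rewrite (mixed_diff_sum _ (fun=> 0) (fun=> cst 0)) big_ord0.
have -> : (fun u => iterD (us ++ (u + w) :: nseq m (u + w)) g x - iterD (us ++ u :: nseq m u) g x) =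
  (fun u => \sum_(i < m.+1) 'C(m.+1, i.+1)%:R * iterD ((us ++ nseq i.+1 w) ++ nseq (m - i) u) g x).
  apply/funext => u; rewrite (iterD_binomial us u w m.+1 oU sg Ux) big_ord_recl /=.
  rewrite bin0 mul1r addrC addKr; apply: eq_bigr => i _.
  by rewrite /bump /= add1n subSS -catA.
rewrite mixed_diff_sum big_ord_recl /= subn0 big1 ?addr0; last first.
  move=> i _; rewrite /bump /= add1n IH; last by rewrite (leq_trans (leq_subr _ _)).
  rewrite ifF ?mulr0//; apply/negbTE/eqP.
  by have := ltn_ord i; move: ms => /=; lia.
rewrite IH// eqSS; case: eqP => [me|_]; last by rewrite mulr0.
by rewrite bin1 factS natrM -mulrA -catA.
Qed.

Lemma expn_fact_le k : (k%:R : R) ^+ k <= expR 1 ^+ k * k`!%:R.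
Proof.
case: k => [|k]; first by rewrite !expr0 mul1r.
have := @expR_ge1Dxn R k.+1%:R k (ler0n _ _).
rewrite -expRM_natl mulr1 => h.
have : k.+1%:R ^+ k.+1 / k.+1`!%:R <= expR (k.+1%:R : R) by lra.
by rewrite ler_pdivrMr// ltr0n fact_gt0.
Qed.

(** Steps [a v] with [a = rho / k] keep all 2^k sample directions within [rho] of [v0]. Division by
    k! a^k leaves (2/rho)^k k^k/k!, and k^k <= e^k k!. *)
Lemma polarization U g x v0 vs (rho B : R) : open U -> smooth_on U g -> U x ->
  0 < rho -> (forall v, v \in vs -> `|v| <= 1) ->
  (forall v, `|v - v0| <= rho -> `|iterD (nseq (size vs) v) g x| <= B) ->
  `|iterD vs g x| <= (2 * expR 1 / rho) ^+ size vs * B.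
Proof.
move=> oU sg Ux rho0 vs1 hB; set k := size vs.
have B0 : 0 <= B.
  by apply: le_trans (hB v0 _) => //; rewrite subrr normr0 ltW.
case: (posnP k) => [k0|k0].
  have vs0 : vs = [::] by exact: size0nil.
  by rewrite k0 expr0 mul1r; move: (hB v0); rewrite -/k k0 vs0 /= subrr normr0; apply; exact: ltW.
pose a := rho / k%:R.
have k0' : 0 < k%:R :> R by rewrite ltr0n.
have a0 : 0 < a by rewrite divr_gt0.
have := @mixed_diff_bound (map ( *:%R a) vs) (fun u => iterD (nseq k u) g x) v0 B.
rewrite (@mixed_diff_diag U g x k [::])//; last by rewrite size_map.
rewrite size_map eqxx -/k (iterD_scale_all [::] _ _ oU)//= => /(_ _)/wrap[].
  move=> u hu; apply: hB; apply: le_trans hu _; rewrite big_map.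
  apply: (@le_trans _ _ (\sum_(v <- vs) a)).
    rewrite !big_seq; apply: ler_sum => v /vs1 v1.
    by rewrite normrZ (gtr0_norm a0) ler_piMr// ltW.
  by rewrite big_const_seq count_predT iter_addr addr0 -/k -[a *+ k]mulr_natr /a divfK// gt_eqF.
rewrite !normrM normrX (gtr0_norm a0) (ger0_norm (ler0n _ _)) -/k => h.
set D := `|iterD vs g x| in h *.
have F0 : 0 < k`!%:R :> R by rewrite ltr0n fact_gt0.
rewrite -(ler_pM2l (mulr_gt0 F0 (exprn_gt0 k a0))) -mulrA.
apply: le_trans h _.
have -> : k`!%:R * a ^+ k * ((2 * expR 1 / rho) ^+ k * B) =
   2 ^+ k * B * ((expR 1 ^+ k * k`!%:R) * (a / rho) ^+ k).
  by rewrite !exprMn; ring.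
rewrite -[leLHS]mulr1; apply: ler_wpM2l; first by rewrite mulr_ge0// exprn_ge0.
have -> : a / rho = k%:R^-1 by rewrite /a mulrAC divff ?mul1r// gt_eqF.
rewrite exprVn ler_pdivlMr ?exprn_gt0// mul1r.
exact: expn_fact_le.
Qed.

Lemma open_line U x v : open U -> open [set s : R | U (x + s *: v)].
Proof.
move=> oU; rewrite openE => s /= Us.
have [d d0 hd] := near_line oU Us; apply/nbhs_ballP; exists d => // t.
by rewrite -ball_normE /= distrC => /hd.
Qed.

Lemma iterD_line_jet U g x v : smooth_on U g ->
  jet [set s : R | U (x + s *: v)] (fun k s => iterD (nseq k v) g (x + s *: v)).
Proof. by move=> sg k s /= Us; apply: is_derive_line; exact: sg. Qed.

End DirectionalDerivatives.

(** * Bounds for the derivatives of any local extension *)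

Section DerivativeBound.
Context {R : realType}.
Variables (n : nat) (M : nat -> R) (X : set 'rV[R]_n.+1) (f : 'rV[R]_n.+1 -> R).
Hypotheses (M0 : positive_seq M) (Mlc : log_convex M) (Mnq : non_quasianalytic M).
Hypothesis fA : AM_set M X f.
Variables (yo v0 : 'rV[R]_n.+1) (r d e : R).
Hypotheses (Xyo : X yo) (r0 : 0 < r) (d0 : 0 < d) (e0 : 0 < e).
Hypothesis cX : local_cone X yo v0 r d e.

(** At a boundary point the extension is tied to [f] on one side only. Along a cone direction it
    agrees with [f] for small [s > 0], where [ray_lemma] applies, and its derivatives at [s = 0]
    follow by continuity. *)
Lemma derivative_bound : exists eta C rho : R, [/\ 0 < eta, 0 < C, 0 < rho &
  forall x U g vs, X x -> `|x - yo| < eta -> local_ext X f x U g ->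
    (forall v, v \in vs -> eucl v <= 1) ->
    `|iterD vs g x| <= C * rho ^+ size vs * (size vs)`!%:R * M (2 * size vs)%N].
Proof.
have [eta [C [rho [eta0 C0 rho0 hray]]]] := ray_lemma M0 Mlc Mnq fA Xyo r0 d0 e0 cX.
have c0 : 0 < 2 * expR 1 / (r / 2) :> R by rewrite divr_gt0 ?mulr_gt0 ?expR_gt0// divr_gt0.
exists eta, C, (2 * expR 1 / (r / 2) * rho); split=> //; first by rewrite mulr_gt0.
move=> x U g vs Xx xyo [oU [Ux [sg fg]]] vs1; set k := size vs.
have r20 : 0 < r / 2 by rewrite divr_gt0.
have -> : C * (2 * expR 1 / (r / 2) * rho) ^+ k * k`!%:R * M (2 * k)%N =
   (2 * expR 1 / (r / 2)) ^+ k * (C * rho ^+ k * k`!%:R * M (2 * k)%N).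
  by rewrite exprMn; ring.
apply: (polarization oU sg Ux r20) => [v /vs1|v vv].
  exact: le_trans (le_eucl _).
rewrite -/k; set B := C * _ * _ * _.
have [hX der hb] := hray x v Xx xyo vv.
have oI := @open_line R n U x v oU.
have jF := @iterD_line_jet R n U g x v sg.
have hF s : U (x + s *: v) -> 0 < s < eta -> `|iterD (nseq k v) g (x + s *: v)| <= B.
  move=> Us hs.
  have oJ : open ([set s : R | U (x + s *: v)] `&` `]0, eta[%classic).
    by apply: openI => //; exact: itv_open.
  have jJ : jet ([set s : R | U (x + s *: v)] `&` `]0, eta[%classic)
      (fun k s => iterD (nseq k v) g (x + s *: v)).
    by move=> j t [Ut _]; exact: jF.
  rewrite -(derive1n_jet oJ jJ (c := fun s => f (x + s *: v))).
  - exact: hb.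
  - move=> t [Ut]; rewrite /= in_itv /= => /andP[t0 t1]; apply: fg => //.
    by apply: hX; rewrite (ltW t0) (ltW t1).
  - by split=> //=; rewrite in_itv.
have U0 : U (x + 0 *: v) by rewrite scale0r addr0.
have cF : {for (0 : R), continuous (fun s : R => `|iterD (nseq k v) g (x + s *: v)|)}.
  apply: (@continuous_comp _ _ _ (fun s : R => iterD (nseq k v) g (x + s *: v)) (fun z : R => `|z|)); last exact: norm_continuous.
  by apply: differentiable_continuous; apply/derivable1_diffP; case: (jF k 0 U0).
have -> : iterD (nseq k v) g x = iterD (nseq k v) g (x + 0 *: v) by rewrite scale0r addr0.
apply/ler_addgt0Pr => z z0.
move/cvgrPdist_le: cF => /(_ z z0) /nbhs_ballP[d1 /= d10 hd1].
have [d2 d20 hd2] := near_line oU U0.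
pose s := Num.min (eta / 2) (Num.min (d1 / 2) (d2 / 2)).
have s0 : 0 < s by rewrite !lt_min !divr_gt0.
have s1 : s <= eta / 2 by rewrite !ge_min lexx.
have s2 : s <= d1 / 2 by rewrite !ge_min lexx !orbT.
have s3 : s <= d2 / 2 by rewrite !ge_min lexx !orbT.
have := hd1 s; rewrite -ball_normE /= sub0r normrN (gtr0_norm s0).
have sd1 : s < d1 by lra.
move=> /(_ sd1) h1.
have h2 : `|iterD (nseq k v) g (x + s *: v)| <= B.
  apply: hF; last by rewrite s0 /=; lra.
  by apply: hd2; rewrite subr0 (gtr0_norm s0); lra.
have := ler_norm (`|iterD (nseq k v) g (x + 0 *: v)| - `|iterD (nseq k v) g (x + s *: v)|).
by move: h1 h2; lra.
Qed.

End DerivativeBound.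
(** * Series and tensor products of smooth functions *)

Section SmoothSeries.
Context {R : realType}.
Variable n : nat.
Notation V := ('rV[R]_n.+1).

Lemma diff_flat_at (V' W' : normedModType R) (g : V' -> W') (x : V') (K : R) :
  0 <= K -> g x = 0 -> (forall z, `|g (x + z)| <= K * `|z| ^+ 2) ->
  differentiable g x /\ 'd g x = 0 :> (V' -> W').
Proof.
move=> K0 g0 hg.
have cz : continuous (0 : V' -> W') by move=> z; exact: cst_continuous.
have ho : g \o shift x = cst (g x) + 0 +o_ 0 id.
  apply/eqaddoP => e e0; near=> z.
  rewrite -[X in `|X| <= _]/(g (z + x) - (g x + 0)) g0 addr0 subr0 addrC.
  apply: le_trans (hg z) _; rewrite expr2 mulrA ler_wpM2r//.
  have : `|z| <= e / (K + 1).
    near: z; apply/nbhs_ballP; exists (e / (K + 1)); first by rewrite /= divr_gt0//; lra.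
    by move=> z; rewrite -ball_normE /= sub0r normrN => /ltW.
  rewrite ler_pdivlMr; last lra.
  by apply: le_trans; rewrite mulrC ler_wpM2l//; lra.
have dE : 'd g x = 0 :> (V' -> W') by apply: diff_unique.
by split=> //; apply/diff_locallyP; rewrite dE.
Unshelve. all: by end_near. Qed.

Lemma diff_flat (g : V -> R) (x : V) (K : R) :
  (forall z, `|g (x + z)| <= K * `|z| ^+ 2) ->
  differentiable g x /\ forall v, 'D_v g x = 0.
Proof.
move=> hg.
have g0 : g x = 0.
  by apply/eqP; rewrite -normr_le0; have := hg 0; rewrite addr0 normr0 expr0n mulr0.
have K0 : 0 <= K.
  have := hg (delta_mx ord0 ord0); case: (lerP 0 K) => // Kn h.
  have h1 : K * `|delta_mx ord0 ord0 : V| ^+ 2 <= 0.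
    by rewrite mulr_le0_ge0 ?(ltW Kn)// exprn_ge0.
  have d0 : `|delta_mx ord0 ord0 : V| = 0.
    apply/eqP; rewrite -sqrf_eq0 eq_le exprn_ge0// andbT.
    by have := le_trans (normr_ge0 _) h; rewrite nmulr_rge0.
  by move/normr0_eq0/rowP/(_ ord0): d0; rewrite !mxE !eqxx /= => /eqP; rewrite oner_eq0.
have [dg dE] := diff_flat_at K0 g0 hg.
by split=> // v; rewrite deriveE// dE.
Qed.

Lemma diff_quadratic (g : V -> R) (x : V) (c : 'I_n.+1 -> R) (K : R) :
  (forall z, `|g (x + z) - g x - \sum_l z ord0 l * c l| <= K * `|z| ^+ 2) ->
  differentiable g x /\ forall v, 'D_v g x = \sum_l v ord0 l * c l.
Proof.
move=> hg.
pose L (z : V) := \sum_l z ord0 l * c l.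
have dL y : differentiable L y.
  have -> : L = \sum_l (fun z : V => z ord0 l * c l) by apply/funext => z; rewrite fct_sumE.
  apply: differentiable_sum => l; apply: differentiableM; last exact: differentiable_cst.
  exact: differentiable_coord.
have LD y z : L (y + z) = L y + L z.
  by rewrite /L -big_split; apply: eq_bigr => l _; rewrite mxE mulrDl.
have LZ (a : R) z : L (a *: z) = a * L z.
  by rewrite /L mulr_sumr; apply: eq_bigr => l _; rewrite mxE mulrA.
have DL y v : 'D_v L y = L v.
  apply/cvg_lim => //; apply: cvg_near_cst; near=> h.
  rewrite /= LD addrK LZ -[_ *: _]/(_ * _) mulrA mulVf ?mul1r//.
  by near: h; exact: nbhs_dnbhs_neq.
have hL (z : V) : `|g (x + z) - g x - L (x + z - x)| <= K * `|z| ^+ 2.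
  by rewrite [x + z - x]addrAC subrr add0r; exact: hg.
have [dr Dr] := @diff_flat (fun y => g y - g x - L (y - x)) x K hL.
have gE : g = (fun y => g y - g x - L (y - x)) + (L + cst (g x - L x)).
  apply/funext => y; rewrite -[RHS]/(g y - g x - L (y - x) + (L y + (g x - L x))).
  by have := LD (y - x) x; rewrite subrK => ->; ring.
have d2 : differentiable (L + cst (g x - L x)) x.
  by apply: differentiableD => //; exact: differentiable_cst.
split; first by rewrite gE; exact: differentiableD.
move=> v; rewrite {1}gE deriveD; [|exact: diff_derivable|exact: diff_derivable].
rewrite Dr add0r deriveD; [|exact: diff_derivable|exact: derivable_cst].
by rewrite DL derive_cst addr0.
Unshelve. all: by end_near. Qed.

(** Bounds by the product of the norms are homogeneous in each direction: prepending [z] twice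
    produces the factor |z|^2 of a Taylor remainder. *)
Definition nprod (vs : seq V) : R := \prod_(v <- vs) `|v|.

Lemma nprod_ge0 vs : 0 <= nprod vs.
Proof. by rewrite /nprod; elim: vs => [|v vs IH]; rewrite ?big_nil ?big_cons// mulr_ge0. Qed.

Lemma derive_coord_sum (g : V -> R) x v : differentiable g x ->
  'D_v g x = \sum_l v ord0 l * 'D_(delta_mx ord0 l) g x.
Proof.
move=> dg; rewrite deriveE// {1}[v]row_sum_delta linear_sum.
by apply: eq_bigr => l _; rewrite linearZ /= deriveE.
Qed.

(** The mechanism of [dyadic_sum_jet] in several variables: the remainder along the segment from [x]
    to [x + z] is controlled by the derivatives in the directions [z :: z :: vs]. *)
Lemma smooth_series (G : nat -> V -> R) (b : nat -> R) :
  (forall j, smooth_on setT (G j)) ->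
  (forall j vs x, `|iterD vs (G j) x| <= b (size vs) * nprod vs / 2 ^+ j) ->
  smooth_on setT (fun x => limn (series (fun j => G j x))).
Proof.
move=> sG bG.
have cv vs x : cvgn (series (fun j => iterD vs (G j) x)) by exact: (cvg_dyadic _).1.
pose S vs x := limn (series (fun j => iterD vs (G j) x)).
have main vs x : differentiable (S vs) x /\ forall v, 'D_v (S vs) x = S (v :: vs) x.
  pose c l := S (delta_mx ord0 l :: vs) x.
  have SE (v : V) : \sum_l v ord0 l * c l = S (v :: vs) x.
    apply/esym/cvg_lim => //.
    have -> : series (fun j => iterD (v :: vs) (G j) x) =
        (fun m => \sum_l v ord0 l * series (fun j => iterD (delta_mx ord0 l :: vs) (G j) x) m).
      apply/funext => m; rewrite /series /=.
      under eq_bigr => j _ do rewrite (derive_coord_sum _ (sG j vs x I)).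
      by rewrite exchange_big /=; apply: eq_bigr => l _; rewrite mulr_sumr.
    rewrite [X in X @ _](_ : _ = \sum_l (fun m => v ord0 l * series (fun j => iterD (delta_mx ord0 l :: vs) (G j) x) m)); last first.
      by apply/funext => m; rewrite fct_sumE.
    apply: (big_ind2 (fun (h : nat -> R) (l : R) => h @ \oo --> l)).
    - exact: cvg_cst.
    - by move=> h1 l1 h2 l2; exact: cvgD.
    - by move=> l _; apply: cvgMr; exact: cv.
  suff /diff_quadratic[d1 d2] (z : V) : `|S vs (x + z) - S vs x - \sum_l z ord0 l * c l| <=
      2 * (b (size vs).+2 * nprod vs) * `|z| ^+ 2.
    by split=> // v; rewrite d2 SE.
  rewrite SE.
  have -> : S vs (x + z) - S vs x - S (z :: vs) x =
     limn (series (fun j => iterD vs (G j) (x + z) - iterD vs (G j) x - iterD (z :: vs) (G j) x)).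
    apply/esym/cvg_lim => //.
    have -> : series (fun j => iterD vs (G j) (x + z) - iterD vs (G j) x - iterD (z :: vs) (G j) x) =
      (fun m => series (fun j => iterD vs (G j) (x + z)) m - series (fun j => iterD vs (G j) x) m -
       series (fun j => iterD (z :: vs) (G j) x) m).
      by apply/funext => m; rewrite /series /= !sumrB.
    by apply: cvgB; [apply: cvgB; exact: cv|exact: cv].
  have := @cvg_dyadic R (fun j => iterD vs (G j) (x + z) - iterD vs (G j) x - iterD (z :: vs) (G j) x)
     (b (size vs).+2 * nprod vs * `|z| ^+ 2).
  rewrite mulrA => H; apply: (H _).2 => j.
  have jl := @iterD_line_jet R n setT (iterD vs (G j)) x z (smooth_on_iterD vs (sG j)).
  have := @jet_taylor2 R _ 0 0 1 (b (size vs).+2 * nprod vs * `|z| ^+ 2 / 2 ^+ j) jl _.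
  rewrite expr1n mulr1 mul1r add0r /= scale1r scale0r addr0; apply=> s.
  have := bG j (z :: z :: vs) (x + s *: z) => /=.
  by rewrite /nprod !big_cons -/(nprod vs) mulrA -expr2 [X in b _ * X]mulrC mulrA.
have SE vs : iterD vs (fun x => limn (series (fun j => G j x))) = S vs.
  elim: vs => [//|v vs IH] /=; apply/funext => x; rewrite IH.
  exact: (main vs x).2.
by move=> vs x _; rewrite SE; exact: (main vs x).1.
Qed.

End SmoothSeries.

Section Tensors.
Context {R : realType}.
Variables (n : nat) (T : finType) (u : T -> nat -> R -> R).
Notation V := ('rV[R]_n.+1).
Hypothesis ju : forall t, jet setT (u t).

Definition inc (al : 'I_n.+1 -> nat) (l l' : 'I_n.+1) : nat := (al l' + (l' == l))%N.

Lemma incC al l1 l2 : inc (inc al l1) l2 = inc (inc al l2) l1.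
Proof. by apply/funext => l; rewrite /inc addnAC. Qed.

Lemma sum_inc al l : (\sum_l' inc al l l' = (\sum_l' al l').+1)%N.
Proof.
rewrite /inc big_split /= -[(\sum_l' al l').+1]addn1; congr (_ + _)%N.
rewrite (bigD1 l)//= eqxx big1// => l' ll'.
by rewrite (negPf ll').
Qed.

Lemma diff_coord_comp (p dp : R -> R) (l : 'I_n.+1) (x : V) :
  is_derive (x ord0 l) (1 : R) p (dp (x ord0 l)) ->
  differentiable (fun y : V => p (y ord0 l)) x /\
  forall v, 'D_v (fun y : V => p (y ord0 l)) x = v ord0 l * dp (x ord0 l).
Proof.
move=> [dp1 dp2].
have dc : differentiable (fun y : V => y ord0 l) x by exact: differentiable_coord.
have dd : differentiable p (x ord0 l) by exact/derivable1_diffP.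
have dpc : differentiable (p \o (fun y : V => y ord0 l)) x by exact: differentiable_comp.
split=> // v; rewrite -[LHS]/('D_v (p \o (fun y : V => y ord0 l)) x) deriveE//.
rewrite diff_comp//= -[X in 'd p _ X]deriveE//.
have -> : 'D_v (fun y : V => y ord0 l) x = v ord0 l *: (1 : R).
  rewrite -[RHS]/(_ * 1) mulr1; apply/cvg_lim => //; apply: cvg_near_cst; near=> h.
  rewrite /= !mxE addrK -[_ *: _]/(_ * _) mulrA mulVf ?mul1r//.
  by near: h; exact: nbhs_dnbhs_neq.
by rewrite linearZ /= -deriveE// dp2.
Unshelve. all: by end_near. Qed.

Lemma diff_coord_prod (w : 'I_n.+1 -> nat -> R -> R) (al : 'I_n.+1 -> nat)
    (r : seq 'I_n.+1) (x : V) :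
  (forall l, jet setT (w l)) -> uniq r ->
  differentiable (fun y : V => \prod_(l <- r) w l (al l) (y ord0 l)) x /\
  forall v, 'D_v (fun y : V => \prod_(l <- r) w l (al l) (y ord0 l)) x =
    \sum_(l <- r) v ord0 l * \prod_(l' <- r) w l' (inc al l l') (x ord0 l').
Proof.
move=> jw; elim: r => [_|l r IH /= /andP[lr ur]].
  have -> : (fun y : V => \prod_(l <- [::]) w l (al l) (y ord0 l)) = cst 1.
    by apply/funext => y; rewrite big_nil.
  split; first exact: differentiable_cst.
  by move=> v; rewrite derive_cst big_nil.
have [d1 D1] := IH ur.
have [d2 D2] := diff_coord_comp (jw l (al l) (x ord0 l) I).
have -> : (fun y : V => \prod_(l <- l :: r) w l (al l) (y ord0 l)) =
   (fun y : V => w l (al l) (y ord0 l)) * (fun y : V => \prod_(l <- r) w l (al l) (y ord0 l)).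
  by apply/funext => y; rewrite big_cons.
split; first exact: differentiableM.
move=> v; rewrite deriveM; [|exact: diff_derivable|exact: diff_derivable].
rewrite D1 D2 -![_ *: _]/(_ * _) big_cons addrC; congr (_ + _).
  rewrite big_cons /inc eqxx addn1 mulrC -mulrA; congr (_ * (_ * _)).
  rewrite big_seq [in RHS]big_seq; apply: eq_bigr => l' l'r.
  have -> : (l' == l) = false by apply/negbTE; apply: contraNneq lr => <-.
  by rewrite addn0.
rewrite mulr_sumr big_seq [in RHS]big_seq; apply: eq_bigr => l' l'r.
have e : inc al l' l = al l.
  by rewrite /inc (_ : (l == l') = false) ?addn0//; apply/negbTE; apply: contraNneq lr => ->.
by rewrite big_cons e mulrCA.
Qed.

Variable c : {ffun 'I_n.+1 -> T} -> R.

(** [al] is the multi-index of a partial derivative, so that this family is closed under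
    differentiation, [inc] raising one entry. *)
Definition tens (al : 'I_n.+1 -> nat) (x : V) : R :=
  \sum_(a : {ffun 'I_n.+1 -> T}) c a * \prod_l u (a l) (al l) (x ord0 l).

Lemma diff_bigsum (I : Type) (r : seq I) (G : I -> V -> R) (dG : I -> V -> R) (x : V) :
  (forall i, differentiable (G i) x /\ forall v, 'D_v (G i) x = dG i v) ->
  differentiable (fun y => \sum_(i <- r) G i y) x /\
  forall v, 'D_v (fun y => \sum_(i <- r) G i y) x = \sum_(i <- r) dG i v.
Proof.
move=> hG; elim: r => [|i r [d D]].
  have -> : (fun y => \sum_(i <- [::]) G i y) = cst 0 by apply/funext => y; rewrite big_nil.
  split; first exact: differentiable_cst.
  by move=> v; rewrite derive_cst big_nil.
have -> : (fun y => \sum_(i <- i :: r) G i y) = G i + (fun y => \sum_(i <- r) G i y).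
  by apply/funext => y; rewrite big_cons.
have [di Di] := hG i.
split; first exact: differentiableD.
move=> v; rewrite deriveD; [|exact: diff_derivable|exact: diff_derivable].
by rewrite Di D big_cons.
Qed.

Lemma diff_scale (a : R) (g : V -> R) (dg : V -> R) (x : V) :
  differentiable g x /\ (forall v, 'D_v g x = dg v) ->
  differentiable (fun y => a * g y) x /\ forall v, 'D_v (fun y => a * g y) x = a * dg v.
Proof.
move=> [d D]; have -> : (fun y => a * g y) = a *: g by [].
split; first exact: differentiableZ.
by move=> v; rewrite deriveZ ?D//; exact: diff_derivable.
Qed.

Lemma diff_tens al x : differentiable (tens al) x /\
  forall v, 'D_v (tens al) x = \sum_l v ord0 l * tens (inc al l) x.
Proof.
have [d D] := @diff_bigsum _ (index_enum {ffun 'I_n.+1 -> T}) _ _ x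
  (fun a => diff_scale (c a) (@diff_coord_prod (fun l => u (a l)) al
   (index_enum 'I_n.+1) x (fun l => ju _) (index_enum_uniq _))).
split=> // v; rewrite D.
under eq_bigr => a _ do rewrite mulr_sumr.
rewrite exchange_big /=; apply: eq_bigr => l _; rewrite mulr_sumr; apply: eq_bigr => a _.
by rewrite mulrCA.
Qed.

Fixpoint tensD (vs : seq V) (al : 'I_n.+1 -> nat) (x : V) : R :=
  if vs is v :: vs' then \sum_l v ord0 l * tensD vs' (inc al l) x else tens al x.

Lemma diff_tensD vs al x : differentiable (tensD vs al) x /\
  forall v, 'D_v (tensD vs al) x = \sum_l v ord0 l * tensD vs (inc al l) x.
Proof.
elim: vs al => [|w vs IH] al; first exact: diff_tens.
have [d D] := @diff_bigsum _ (index_enum 'I_n.+1) _ _ x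
  (fun l => diff_scale (w ord0 l) (IH (inc al l))).
split=> // v; rewrite D.
under eq_bigr => l _ do rewrite mulr_sumr.
rewrite exchange_big /=; apply: eq_bigr => l _; rewrite mulr_sumr; apply: eq_bigr => l' _.
by rewrite incC mulrCA.
Qed.

Lemma iterD_tens vs al : iterD vs (tens al) = tensD vs al.
Proof.
elim: vs al => [//|v vs IH] al /=; apply/funext => x; rewrite IH.
exact: (diff_tensD vs al x).2.
Qed.

Lemma smooth_tens al : smooth_on setT (tens al).
Proof. by move=> vs x _; rewrite iterD_tens; exact: (diff_tensD vs al x).1. Qed.

(** By distributivity the sum over all index functions is a product of one-dimensional sums, so the
    number of cells does not enter the bound. *)
Lemma tens_bound (P : nat) (e B H : R) al x : 0 <= e -> 0 <= B -> 0 <= H ->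
  (forall a, `|c a| <= e) ->
  (forall p s, (p <= P)%N -> \sum_t `|u t p s| <= B * H ^+ p) ->
  (\sum_l al l <= P)%N ->
  `|tens al x| <= e * B ^+ n.+1 * H ^+ (\sum_l al l).
Proof.
move=> e0 B0 H0 ce hu alP.
apply: le_trans (ler_norm_sum _ _ _) _.
apply: (@le_trans _ _ (\sum_(a : {ffun 'I_n.+1 -> T}) e * \prod_l `|u (a l) (al l) (x ord0 l)|)).
  by apply: ler_sum => a _; rewrite normrM normr_prod ler_wpM2r// prodr_ge0.
rewrite -mulr_sumr -mulrA ler_wpM2l//.
rewrite -(bigA_distr_bigA (fun l t => `|u t (al l) (x ord0 l)|)).
apply: (@le_trans _ _ (\prod_(l < n.+1) (B * H ^+ al l))).
  apply: ler_prod => l _; rewrite sumr_ge0//=; apply: hu.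
  by apply: leq_trans alP; rewrite (bigD1 l)//= leq_addr.
by rewrite big_split /= prodr_const card_ord expr_sum.
Qed.

Lemma iterD_tens_bound (P : nat) (e B H : R) vs x : 0 <= e -> 0 <= B -> 0 <= H ->
  (forall a, `|c a| <= e) ->
  (forall p s, (p <= P)%N -> \sum_t `|u t p s| <= B * H ^+ p) ->
  (size vs <= P)%N ->
  `|iterD vs (tens (fun=> 0%N)) x| <= e * B ^+ n.+1 * (n.+1%:R * H) ^+ size vs * nprod vs.
Proof.
move=> e0 B0 H0 ce hu vsP; rewrite iterD_tens.
have main (al : 'I_n.+1 -> nat) : (\sum_l al l + size vs <= P)%N ->
   `|tensD vs al x| <= e * B ^+ n.+1 * H ^+ (\sum_l al l) * (n.+1%:R * H) ^+ size vs * nprod vs.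
  elim: vs al {vsP} => [|v vs IH] al alP /=.
    by rewrite /nprod big_nil expr0 !mulr1; apply: (@tens_bound P) => //; rewrite addn0 in alP.
  apply: le_trans (ler_norm_sum _ _ _) _.
  have hl l : `|v ord0 l * tensD vs (inc al l) x| <= `|v| * (e * B ^+ n.+1 *
     H ^+ (\sum_l al l).+1 * (n.+1%:R * H) ^+ size vs * nprod vs).
    rewrite normrM; apply: ler_pM => //; first exact: le_coord_norm.
    by rewrite -(sum_inc al l); apply: IH; rewrite sum_inc addSnnS.
  apply: le_trans (ler_sum _ (fun l _ => hl l)) _.
  rewrite sumr_const card_ord -mulr_natl /nprod big_cons.
  by rewrite le_eqVlt; apply/orP; left; apply/eqP; rewrite !exprS; ring.
have := main (fun=> 0%N); rewrite big1// expr0 mulr1; exact.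
Qed.

End Tensors.
(** * Interpolation *)

Section Lagrange.
Context {R : realType}.

(** The Lagrange basis for the nodes 0, ..., k. *)
Definition lag (k : nat) (i : 'I_k.+1) : {poly R} :=
  \prod_(j < k.+1 | j != i) ((i%:R - j%:R)^-1 *: ('X - (j%:R)%:P)).

Lemma lagE k (i j : 'I_k.+1) : (lag i).[j%:R] = (i == j)%:R.
Proof.
rewrite /lag horner_prod; case: eqVneq => [->|ij] /=.
  apply: big1 => l lj; rewrite hornerZ hornerXsubC mulVf// subr_eq0 eqr_nat.
  by rewrite eq_sym.
by rewrite (bigD1 j) 1?eq_sym//= hornerZ hornerXsubC subrr mulr0 mul0r.
Qed.

Lemma size_lag k (i : 'I_k.+1) : (size (lag i) <= k.+1)%N.
Proof.
have h : (size (lag i) <= (\sum_(j < k.+1 | j != i) 2).+1 - #|[pred j : 'I_k.+1 | j != i]|)%N.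
  apply: leq_trans (size_poly_prod_leq _ _) _; rewrite leq_sub2r// ltnS.
  by apply: leq_sum => j _; apply: leq_trans (size_scale_leq _ _) _; rewrite size_XsubC.
apply: leq_trans h _; rewrite sum_nat_const cardC1 card_ord /=; lia.
Qed.

Lemma lag_repr k (p : {poly R}) x : (size p <= k.+1)%N ->
  p.[x] = \sum_(i < k.+1) p.[i%:R] * (lag i).[x].
Proof.
move=> sp.
pose q := p - \sum_(i < k.+1) p.[i%:R] *: lag i.
have q0 : q = 0.
  apply: (@roots_geq_poly_eq0 _ _ [seq (val i)%:R | i <- enum 'I_k.+1]).
  - apply/allP => _ /mapP[j _ ->]; rewrite /root /q hornerD hornerN horner_sum.
    rewrite (bigD1 j)//= big1 ?addr0 => [|i ij].
      by rewrite hornerZ lagE eqxx mulr1 subrr.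
    by rewrite hornerZ lagE (negPf ij) mulr0.
  - rewrite map_inj_uniq ?enum_uniq// => i j /eqP; rewrite eqr_nat => /eqP; exact: val_inj.
  - rewrite size_map size_enum_ord (leq_trans (size_polyD _ _))// geq_max sp size_polyN.
    apply: (leq_trans (size_sum _ _ _)); apply/bigmax_leqP => i _.
    exact: leq_trans (size_scale_leq _ _) (size_lag i).
have := congr1 (horner^~ x) q0; rewrite /q hornerD hornerN horner_sum horner0 => /eqP.
by rewrite subr_eq0 => /eqP ->; apply: eq_bigr => i _; rewrite hornerZ.
Qed.

Lemma lag_sum1 k x : \sum_(i < k.+1) (lag i).[x] = 1.
Proof.
have := @lag_repr k 1%:P x; rewrite size_poly1 hornerC => ->//.
by apply: eq_bigr => i _; rewrite hornerC mul1r.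
Qed.

Lemma horner_bounded (p : {poly R}) (B : R) : 0 <= B -> exists2 C, 0 <= C &
  forall x, `|x| <= B -> `|p.[x]| <= C.
Proof.
move=> B0; exists (\sum_(i < size p) `|p`_i| * B ^+ i).
  by apply: sumr_ge0 => i _; rewrite mulr_ge0// exprn_ge0.
move=> x xB; rewrite horner_coef; apply: le_trans (ler_norm_sum _ _ _) _.
apply: ler_sum => i _; rewrite normrM normrX; apply: ler_wpM2l => //.
by rewrite lerXn2r ?nnegrE.
Qed.

Lemma lag_bounded k (B : R) : 0 <= B -> exists2 C, 0 <= C &
  forall x, `|x| <= B -> \sum_(i < k.+1) `|(lag i).[x]| <= C.
Proof.
move=> B0.
have /choice[C hC] (i : 'I_k.+1) : exists C, 0 <= C /\ forall x, `|x| <= B -> `|(lag i).[x]| <= C.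
  by have [C ? ?] := horner_bounded (lag i) B0; exists C.
exists (\sum_i C i); first by apply: sumr_ge0 => i _; have [] := hC i.
by move=> x xB; apply: ler_sum => i _; have [_] := hC i; apply.
Qed.

End Lagrange.

Section Taylor.
Context {R : realType}.

Definition tpoly (m : nat) (c : nat -> R) : {poly R} := \poly_(q < m) (c q / q`!%:R).

Lemma deriv_tpoly m c : (tpoly m.+1 c)^`() = tpoly m (fun q => c q.+1).
Proof.
apply/polyP => i; rewrite coef_deriv !coef_poly ltnS; case: ifP => _; last by rewrite mul0rn.
rewrite factS natrM -mulr_natl; field.
by rewrite nat1r !pnatr_eq0 -lt0n fact_gt0.
Qed.

Lemma taylor_bound (u : nat -> R -> R) (a b K p s : R) m :
  jet `]a, b[%classic u -> (forall t, a < t < b -> `|u m t| <= K) ->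
  a < p < b -> a < s < b ->
  `|u 0%N s - (tpoly m (u^~ p)).[s - p]| <= K * `|s - p| ^+ m.
Proof.
elim: m u s => [|m IH] u s ju uK pI sI.
  rewrite /tpoly horner_poly big_ord0 subr0 expr0 mulr1; exact: uK.
have ju' : jet `]a, b[%classic (fun k => u k.+1) by move=> k t It; exact: ju.
pose D t := u 1%N t - (tpoly m (fun q => u q.+1 p)).[t - p].
have dD t : a < t < b -> is_derive t (1 : R) (fun t => u 0%N t - (tpoly m.+1 (u^~ p)).[t - p]) (D t).
  move=> tI; apply: (@is_deriveB R R R (u 0%N) (fun t => (tpoly m.+1 (u^~ p)).[t - p])).
    by apply: ju; rewrite /= in_itv.
  have := @is_derive_affine R R (horner (tpoly m.+1 (u^~ p))) 1 (- p) t _ (is_derive_poly _ _).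
  by rewrite mul1r scale1r deriv_tpoly; under eq_fun do rewrite mul1r.
have z0 : u 0%N p - (tpoly m.+1 (u^~ p)).[p - p] = 0.
  rewrite subrr horner_poly big_ord_recl /= expr0 mulr1 fact0 divr1 big1 ?addr0 ?subrr// => i _.
  by rewrite expr0n /= mulr0.
have K0 : 0 <= K by apply: le_trans (uK p pI).
have hD t : `|t - p| <= `|s - p| -> a < t < b -> `|D t| <= K * `|s - p| ^+ m.
  move=> tp tI; apply: le_trans (IH (fun k => u k.+1) t ju' uK pI tI) _.
  by rewrite ler_wpM2l// lerXn2r ?nnegrE.
have /andP[p1 p2] := pI; have /andP[s1 s2] := sI.
case/orP: (le_total p s) => ps.
  have [|t /andP[t1 t2]] := MVT_everywhere ps (G := fun t => u 0%N t - (tpoly m.+1 (u^~ p)).[t - p]) (u := D).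
    by move=> t /andP[t1 t2]; apply: dD; lra.
  rewrite z0 subr0 => ->; rewrite normrM exprSr mulrA ler_wpM2r//; apply: hD; last lra.
  by rewrite !ger0_norm; lra.
have [|t /andP[t1 t2]] := MVT_everywhere ps (G := fun t => u 0%N t - (tpoly m.+1 (u^~ p)).[t - p]) (u := D).
  by move=> t /andP[t1 t2]; apply: dD; lra.
rewrite z0 sub0r => e.
rewrite -normrN e normrM exprSr mulrA [`|p - s|]distrC ler_wpM2r//; apply: hD; last lra.
by rewrite !ler0_norm; lra.
Qed.

(* All nodes lie inside the open interval, so that nothing but right continuity
   of [u 0] is needed at the endpoint [0]. *)
Lemma interp1 (u : nat -> R -> R) (a K L h tau t C : R) k :
  jet `]0, a[%classic u -> (forall s, 0 < s < a -> `|u k.+1 s| <= K) ->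
  (forall e, 0 < e -> exists2 d, 0 < d & forall s, 0 <= s < d -> `|u 0%N s - u 0%N 0| <= e) ->
  0 < h -> 0 <= L -> L * h < a -> 0 < tau -> tau + h * k%:R <= L * h -> 0 <= t <= L * h ->
  (forall x, `|x| <= L -> \sum_(c < k.+1) `|(lag c : {poly R}).[x]| <= C) ->
  `|u 0%N t - \sum_(c < k.+1) u 0%N (tau + h * c%:R) * (lag c).[(t - tau) / h]| <=
     K * (L * h) ^+ k.+1 * (1 + C).
Proof.
move=> ju uK rc h0 L0 La tau0 tauL tL hC.
have hk c : (c <= k)%N -> 0 < tau + h * c%:R <= L * h.
  move=> ck; apply/andP; split; first by rewrite ltr_wpDr// mulr_ge0// ltW.
  apply: le_trans tauL; rewrite lerD2l ler_wpM2l ?(ltW h0)//.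
  by rewrite ler_nat.
have tauI : 0 < tau < a.
  rewrite tau0 /=; apply: le_lt_trans La; have := hk 0%N (leq0n _).
  by rewrite mulr0 addr0 => /andP[].
pose T s := (tpoly k.+1 (u^~ tau)).[s - tau].
have tauL' : tau <= L * h by have := hk 0%N (leq0n _); rewrite mulr0 addr0 => /andP[].
have K0 : 0 <= K by apply: le_trans (uK _ tauI).
have E0 : 0 <= K * (L * h) ^+ k.+1.
  by rewrite mulr_ge0// exprn_ge0// mulr_ge0// ltW.
have err s : 0 < s <= L * h -> `|u 0%N s - T s| <= K * (L * h) ^+ k.+1.
  move=> /andP[s0 s1]; apply: le_trans (taylor_bound ju uK tauI _) _.
    by rewrite s0 /=; exact: le_lt_trans La.
  rewrite ler_wpM2l// lerXn2r ?nnegrE ?mulr_ge0// ?(ltW h0)//.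
  by rewrite ler_norml; lra.
have err0 s : 0 <= s <= L * h -> `|u 0%N s - T s| <= K * (L * h) ^+ k.+1.
  move=> /andP[]; rewrite le_eqVlt => /predU1P[<- _|s0 s1]; last by apply: err; rewrite s0.
  clear s.
  apply/ler_addgt0Pr => e e0.
  have [d1 d10 hd1] := rc (e / 2) (divr_gt0 e0 (ltr0Sn _ 1)).
  have cT : {for (0 : R), continuous T}.
    apply: (@continuous_comp _ _ _ (fun s => s - tau) (horner (tpoly k.+1 (u^~ tau)))).
      by apply: cvgB; [exact: cvg_id|exact: cvg_cst].
    exact: continuous_horner.
  move/cvgrPdist_le: cT => /(_ (e / 2) (divr_gt0 e0 (ltr0Sn _ 1))) /nbhs_ballP[d2 /= d20 hd2].
  have Lh0 : 0 < L * h by exact: lt_le_trans tau0 tauL'.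
  pose s := Num.min (L * h) (Num.min (d1 / 2) (d2 / 2)).
  have s0 : 0 < s by rewrite !lt_min Lh0 !divr_gt0.
  have s1 : s <= L * h by rewrite !ge_min lexx.
  have s2 : s <= d1 / 2 by rewrite !ge_min lexx !orbT.
  have s3 : s <= d2 / 2 by rewrite !ge_min lexx !orbT.
  have h1 : `|u 0%N s - u 0%N 0| <= e / 2 by apply: hd1; rewrite (ltW s0) /=; lra.
  have h2 : `|T 0 - T s| <= e / 2.
    by apply: hd2; rewrite -ball_normE /= sub0r normrN (gtr0_norm s0); lra.
  have h3 : `|u 0%N s - T s| <= K * (L * h) ^+ k.+1 by apply: err; rewrite s0.
  have -> : u 0%N 0 - T 0 = (u 0%N s - T s) - (u 0%N s - u 0%N 0) - (T 0 - T s) by ring.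
  apply: le_trans (ler_normB _ _) _.
  have := ler_normB (u 0%N s - T s) (u 0%N s - u 0%N 0).
  by move: h1 h2 h3; lra.
(* [Q] is the Taylor polynomial in the variable in which the nodes are 0, ..., k, so interpolation
   reproduces it. The error is thus the Taylor error at [t] plus the Taylor errors at the nodes
   weighted by Lagrange polynomials, whence the factor [1 + C]. *)
pose Q := \poly_(q < k.+1) (u q tau * h ^+ q / q`!%:R).
have TE s : T s = Q.[(s - tau) / h].
  rewrite /T /tpoly /Q !horner_poly; apply: eq_bigr => q _.
  rewrite expr_div_n; field.
  by rewrite expf_neq0 ?gt_eqF//= ltr0n fact_gt0.
have Tt : T t = \sum_(c < k.+1) T (tau + h * c%:R) * (lag c).[(t - tau) / h].
  rewrite TE (@lag_repr R k)//; last exact: size_poly.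
  apply: eq_bigr => c _; rewrite TE; congr (_.[_] * _).
  by rewrite addrAC subrr add0r mulrC mulKf// gt_eqF.
have -> : u 0%N t - \sum_(c < k.+1) u 0%N (tau + h * c%:R) * (lag c).[(t - tau) / h] =
   (u 0%N t - T t) - \sum_(c < k.+1) (u 0%N (tau + h * c%:R) - T (tau + h * c%:R)) * (lag c).[(t - tau) / h].
  rewrite Tt; under [X in _ = _ - _ - X]eq_bigr do rewrite mulrBl.
  by rewrite sumrB; ring.
apply: le_trans (ler_normB _ _) _; rewrite mulrDr mulr1; apply: lerD; first exact: err0.
apply: le_trans (ler_norm_sum _ _ _) _.
apply: (@le_trans _ _ (\sum_(c < k.+1) K * (L * h) ^+ k.+1 * `|(lag c : {poly R}).[(t - tau) / h]|)).
  apply: ler_sum => c _; rewrite normrM ler_wpM2r//; apply: err; apply: hk.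
  by rewrite -ltnS.
rewrite -mulr_sumr ler_wpM2l//; apply: hC.
rewrite normrM normfV (gtr0_norm h0) ler_pdivrMr// ler_norml.
by have /andP[? ?] := tL; lra.
Qed.

End Taylor.

(** * Partition of unity by integer translates *)

Section PartitionOfUnity.
Context {R : realType}.

(** [th] is the difference of two consecutive integer translates of a step function, so the sum of
    its translates telescopes to 1. *)
Lemma theta_exists (M : nat -> R) : positive_seq M -> non_quasianalytic M ->
  exists th : nat -> R -> R,
   [/\ jet setT th, (forall p t, 1 < `|t| -> th p t = 0),
       (forall p, exists2 C, 0 <= C & forall t, `|th p t| <= C) &
       (forall N t, `|t| <= N%:R -> \sum_(i < (N.*2).+1) th 0%N (t + N%:R - i%:R) = 1)].
Proof.
move=> M0 Mnq.
have [s [C [C0 js s0 s1 [s01 sb]]]] := step_exists M0 Mnq (@ltr01 R).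
pose th p t := s p (t + 1) - s p t.
have jth : jet setT th.
  have sh : jet setT (fun k t => s k (t + 1)).
    move=> k t _; have := @is_derive_affine R R (s k) 1 1 t (s k.+1 (t + 1)).
    by rewrite scale1r mul1r; under eq_fun do rewrite mul1r; apply; exact: js.
  exact: jetB sh js.
exists th; split=> //.
- move=> [|p] t t1.
    rewrite /th; case: (ltP t 0) => tn.
      by move: t1; rewrite ltr0_norm// => t1; rewrite !s0 ?subrr//; lra.
    by move: t1; rewrite ger0_norm// => t1; rewrite !s1 ?subrr//; lra.
  apply: (@jet_const_on R [set t : R | 1 < `|t|] th 0) => //.
  + by move=> j y _; exact: jth.
  + apply: (@open_comp _ _ (fun t : R => `|t|) [set y | 1 < y]); last exact: open_gt.
    by move=> y _; exact: norm_continuous.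
  move=> y y1; rewrite /th; case: (ltP y 0) => tn.
    by move: y1; rewrite /= ltr0_norm// => t2; rewrite !s0 ?subrr//; lra.
  by move: y1; rewrite /= ger0_norm// => t2; rewrite !s1 ?subrr//; lra.
- move=> p; exists (2 * (C * p`!%:R * M p)); first by rewrite !mulr_ge0// ltW.
  by move=> t; apply: le_trans (ler_normB _ _) _; rewrite mulr_natl mulr2n lerD.
- move=> N t; rewrite ler_norml => /andP[t1 t2].
  rewrite -(big_mkord xpredT (fun i => th 0%N (t + N%:R - i%:R))).
  rewrite (eq_bigr (fun i => - s 0%N (t + N%:R - i.+1%:R + 1) - - s 0%N (t + N%:R - i%:R + 1))).
    rewrite telescope_sumr// subr0 (s1 (t + N%:R + 1)); last by move: t1; lra.
    rewrite (s0 (t + N%:R - (N.*2).+1%:R + 1)) ?oppr0 ?add0r ?opprK//.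
    by rewrite -natr1 -muln2 natrM; lra.
  move=> i _; rewrite /th opprK addrC; congr (- s 0%N _ + _).
  by rewrite -natr1; ring.
Qed.

Lemma overlap_count (g : R -> R) (C : R) N t : 0 <= C -> (forall s, `|g s| <= C) ->
  (forall s, 1 < `|s| -> g s = 0) -> \sum_(i < N) `|g (t - i%:R)| <= 3 * C.
Proof.
move=> C0 gC gz.
(* [H (x + 2) - H (x + 1)] dominates the indicator of [|x| <= 1] and telescopes over integer
   translates. As [H] ranges in [0, 3], the bound is independent of [N]. *)
pose H (x : R) := Num.max 0 (Num.min x 3).
have H01 x : 0 <= H x <= 3 by rewrite /H /Num.max /Num.min; case: ifP; case: ifP; lra.
have HE x : [\/ x <= 0 /\ H x = 0, 0 <= x <= 3 /\ H x = x | 3 <= x /\ H x = 3].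
  rewrite /H; case/orP: (le_total x 3) => h3.
    rewrite (min_idPl h3); case/orP: (le_total x 0) => h0.
      by constructor 1; split=> //; exact/max_idPl.
    by constructor 2; split; [lra|exact/max_idPr].
  by constructor 3; split=> //; rewrite (min_idPr h3); apply/max_idPr; lra.
have Hstep x : (if `|x| <= 1 then 1 else 0) <= H (x + 2) - H (x + 1).
  rewrite ler_norml; case: ifPn => h; case: (HE (x + 2)) => -[h1 ->]; case: (HE (x + 1)) => -[h2 ->]; lra.
have : \sum_(i < N) `|g (t - i%:R)| <= C * (H (t + 2) - H (t - N%:R + 2)).
  elim: N => [|N IH]; first by rewrite big_ord0 subr0 subrr mulr0.
  rewrite big_ord_recr /=.
  have : `|g (t - N%:R)| <= C * (H (t - N%:R + 2) - H (t - N.+1%:R + 2)).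
    have -> : t - N.+1%:R + 2 = t - N%:R + 1 by rewrite -natr1; ring.
    have := Hstep (t - N%:R); case: ifP => [_|/negbT]; rewrite -?ltNge => h1.
      by apply: le_trans (gC _) _; rewrite ler_peMr.
    by move=> h2; rewrite gz// normr0 mulr_ge0.
  by move: IH; lra.
move=> h; apply: le_trans h _; rewrite mulrC ler_wpM2r//.
by have := H01 (t + 2); have := H01 (t - N%:R + 2); lra.
Qed.

Lemma jmul_family_bound (T1 T2 : finType) (A : T1 -> nat -> R -> R) (B : T2 -> nat -> R -> R)
    (a b H : R) (P : nat) s : 0 <= a -> 0 <= b -> 0 <= H ->
  (forall q, (q <= P)%N -> \sum_t `|A t q s| <= a * H ^+ q) ->
  (forall q, (q <= P)%N -> \sum_t `|B t q s| <= b * H ^+ q) ->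
  forall p, (p <= P)%N ->
  \sum_(t : T1 * T2) `|jmul p (A t.1) (B t.2) s| <= 2 ^+ P * a * b * H ^+ p.
Proof.
move=> a0 b0 H0 hA hB p pP.
have h t : `|jmul p (A t.1) (B t.2) s| <=
    \sum_(j < p.+1) 'C(p, j)%:R * (`|A t.1 j s| * `|B t.2 (p - j)%N s|).
  by apply: (@jmul_bound R p (A t.1) (B t.2) (fun j => `|A t.1 j s|) (fun j => `|B t.2 j s|)).
apply: le_trans (ler_sum _ (fun t _ => h t)) _.
rewrite exchange_big /=.
apply: (@le_trans _ _ (\sum_(j < p.+1) 'C(p, j)%:R * (a * b * H ^+ p))).
  apply: ler_sum => j _; rewrite -mulr_sumr ler_wpM2l//.
  have jp : (j <= p)%N by rewrite -ltnS.
  rewrite -(pair_bigA _ (fun t1 t2 => `|A t1 j s| * `|B t2 (p - j)%N s|)) /=.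
  under eq_bigr do rewrite -mulr_sumr.
  rewrite -mulr_suml.
  have -> : a * b * H ^+ p = (a * H ^+ j) * (b * H ^+ (p - j)).
    by rewrite -[in LHS](subnKC jp) exprD; ring.
  apply: ler_pM; rewrite ?sumr_ge0//; first exact/hA/(leq_trans jp).
  by apply: hB; exact: leq_trans (leq_subr _ _) pP.
rewrite -mulr_suml -natr_sum.
have -> : (\sum_(j < p.+1) 'C(p, j) = 2 ^ p)%N.
  rewrite -[2%N]/(1 + 1)%N expnDn; apply: eq_bigr => j _.
  by rewrite !exp1n !muln1.
rewrite natrX !mulrA ler_wpM2r ?exprn_ge0// ler_wpM2r// ler_wpM2r//.
by rewrite ler_weXn2l// ler1n.
Qed.

Lemma shift_family_bound (g : nat -> R -> R) (C lam H : R) (P N : nat) (c s : R) :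
  0 <= C -> 0 <= lam <= H -> (forall q t, (q <= P)%N -> `|g q t| <= C) ->
  (forall q t, 1 < `|t| -> g q t = 0) ->
  forall q, (q <= P)%N ->
  \sum_(i < N) `|lam ^+ q * g q (lam * s + c - i%:R)| <= 3 * C * H ^+ q.
Proof.
move=> C0 /andP[l0 lH] gC gz q qP.
under eq_bigr do rewrite normrM normrX (ger0_norm l0).
rewrite -mulr_sumr mulrC; apply: ler_pM; rewrite ?sumr_ge0 ?exprn_ge0//.
  by apply: overlap_count => // t; [exact: gC|exact: gz].
by rewrite lerXn2r ?nnegrE// (le_trans l0).
Qed.

End PartitionOfUnity.
Section FiniteSums.
Context {R : realType}.

Lemma sum_ffun_pair (I A B : finType) (G : {ffun I -> A * B} -> R) :
  \sum_a G a = \sum_(b : {ffun I -> A}) \sum_(c : {ffun I -> B}) G [ffun l => (b l, c l)].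
Proof.
rewrite pair_bigA /=.
rewrite (reindex (fun p : {ffun I -> A} * {ffun I -> B} => [ffun l => (p.1 l, p.2 l)]))//=.
exists (fun a : {ffun I -> A * B} => ([ffun l => (a l).1], [ffun l => (a l).2])) => [[b c] _|a _].
  by congr pair; apply/ffunP => l; rewrite !ffunE.
by apply/ffunP => l; rewrite !ffunE /=; case: (a l).
Qed.

Definition upd (I C : finType) (i : {ffun I -> C}) (l : I) (c : C) : {ffun I -> C} :=
  [ffun l' => if l' == l then c else i l'].

(* The pairs [(i, c)] and [(upd i l c, i l)] carry the same weight. *)
Lemma sum_ffun_average (I C : finType) (w : I -> C -> R) (l : I) (A : {ffun I -> C} -> R) :
  \sum_c w l c = 1 ->
  \sum_(i : {ffun I -> C}) (\prod_l' w l' (i l')) * A i =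
  \sum_(i : {ffun I -> C}) (\prod_l' w l' (i l')) * \sum_c w l c * A (upd i l c).
Proof.
move=> w1.
transitivity (\sum_(p : {ffun I -> C} * C) (\prod_l' w l' (p.1 l')) * (w l p.2 * A p.1)).
  rewrite -(pair_bigA _ (fun (i : {ffun I -> C}) c => (\prod_l' w l' (i l')) * (w l c * A i))) /=.
  by apply: eq_bigr => i _; rewrite -mulr_sumr -mulr_suml w1 mul1r.
transitivity (\sum_(p : {ffun I -> C} * C)
    (\prod_l' w l' (p.1 l')) * (w l p.2 * A (upd p.1 l p.2))); last first.
  rewrite -(pair_bigA _ (fun (i : {ffun I -> C}) c => (\prod_l' w l' (i l')) * (w l c * A (upd i l c)))) /=.
  by apply: eq_bigr => i _; rewrite mulr_sumr.
pose swap (p : {ffun I -> C} * C) := (upd p.1 l p.2, p.1 l).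
have swapK : involutive swap.
  move=> [i c]; rewrite /swap /= !ffunE eqxx; congr pair.
  by apply/ffunP => l'; rewrite !ffunE; case: eqP => // ->.
rewrite (reindex_inj (inv_inj swapK)) /=; apply: eq_bigr => -[i c] _ /=.
rewrite (bigD1 l)//= [in RHS](bigD1 l)//= ffunE eqxx.
rewrite [X in _ * X * _](_ : _ = \prod_(l' | l' != l) w l' (i l')); first by ring.
by apply: eq_bigr => l' /negPf h; rewrite ffunE h.
Qed.

Lemma sum_prod_norm_le (I C : finType) (w : I -> C -> R) (La : R) :
  0 <= La -> (forall l, \sum_c `|w l c| <= La) ->
  \sum_(i : {ffun I -> C}) `|\prod_l w l (i l)| <= La ^+ #|I|.
Proof.
move=> La0 hw; under eq_bigr do rewrite normr_prod.
rewrite -(bigA_distr_bigA (fun l c => `|w l c|)) -prodr_const.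
by apply: ler_prod => l _; rewrite hw andbT sumr_ge0.
Qed.

End FiniteSums.

(** * Local smooth extension *)

Section Nodes.
Context {R : realType}.

Definition grid (j : nat) : nat := ((2 ^ j).*2).+1.

(** The m-th cell is centred at (m - 2^j)/2^j; this is the position of [s] relative to that centre,
    in units of 2^(-j). *)
Definition offs (j : nat) (m : 'I_(grid j)) (s : R) : R :=
  2 ^+ j * s + (2 ^ j)%:R - m%:R.

(* The nodes are shifted by [6] cells, away from the cell that they serve, so that
   they lie in [Y] as soon as that cell meets [Y]. *)
Definition nod (j k : nat) (b : 'I_(grid j) * 'I_k.+1) : R :=
  (b.1%:R - (2 ^ j)%:R + 6 + b.2%:R) / 2 ^+ j.

Variable th : nat -> R -> R.

(** The nodes of a cell sit at offsets 6, ..., 6 + k, whence the shift by 6. *)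
Definition lagj k (i : 'I_k.+1) (q : nat) (t : R) : R := (derivn q (lag i)).[t - 6].

Definition ths j (m : 'I_(grid j)) (q : nat) (s : R) : R := (2 ^+ j) ^+ q * th q (offs m s).

Definition kap j k (b : 'I_(grid j) * 'I_k.+1) (q : nat) (s : R) : R :=
  (2 ^+ j) ^+ q * jmul q th (lagj b.2) (offs b.1 s).

Lemma kap0 j k b s : @kap j k b 0%N s = th 0%N (offs b.1 s) * (lag b.2).[offs b.1 s - 6].
Proof. by rewrite /kap expr0 mul1r. Qed.

Lemma jet_lagj k (i : 'I_k.+1) : jet setT (lagj i).
Proof.
move=> q t _; have := @is_derive_affine R R (horner (derivn q (lag i))) 1 (- 6) t _ (is_derive_poly _ _).
by rewrite mul1r scale1r -derivnS; under eq_fun do rewrite mul1r.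
Qed.

Lemma jet_offs (g : nat -> R -> R) j (m : 'I_(grid j)) : jet setT g ->
  jet setT (fun q s => (2 ^+ j) ^+ q * g q (offs m s)).
Proof.
move=> jg; have := @jet_affine R R setT setT g (2 ^+ j) ((2 ^ j)%:R - m%:R) jg (fun _ _ => I).
rewrite (_ : (fun q s => (2 ^+ j) ^+ q * g q (offs m s)) =
  (fun q s => (2 ^+ j) ^+ q *: g q (2 ^+ j * s + ((2 ^ j)%:R - m%:R))))//.
by apply/funext => q; apply/funext => s; rewrite /offs addrA.
Qed.

Hypothesis jth : jet setT th.
Hypothesis th_supp : forall p t, 1 < `|t| -> th p t = 0.
Hypothesis th1 : forall N t, `|t| <= N%:R -> \sum_(i < (N.*2).+1) th 0%N (t + N%:R - i%:R) = 1.

Lemma jet_ths j m : jet setT (@ths j m).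
Proof. exact: jet_offs. Qed.

Lemma jet_kap j k b : jet setT (@kap j k b).
Proof. apply: (@jet_offs (fun q => jmul q th (lagj b.2))); exact: jet_jmul (jet_lagj _). Qed.

Lemma sum_ths j s : `|s| <= 1 -> \sum_(m < grid j) ths m 0%N s = 1.
Proof.
move=> s1; rewrite -(@th1 (2 ^ j) (2 ^+ j * s)).
  by apply: eq_bigr => m _; rewrite /ths expr0 mul1r.
by rewrite normrM natrX ger0_norm ?exprn_ge0// ler_piMr ?exprn_ge0.
Qed.

(** On each cell Lagrange's formula is exact in degree at most k, and the [ths] sum to 1. The affine
    substitution allows polynomials in the variable of a coarser grid. *)
Lemma kap_reproduces j k (p : {poly R}) (al be s : R) : `|s| <= 1 -> (size p <= k.+1)%N ->
  \sum_b p.[al * @nod j k b + be] * kap b 0%N s = p.[al * s + be].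
Proof.
move=> s1 sp.
rewrite -(pair_bigA _ (fun m i => p.[al * @nod j k (m, i) + be] * kap (m, i) 0%N s)) /=.
transitivity (\sum_(m < grid j) ths m 0%N s * p.[al * s + be]); last first.
  by rewrite -mulr_suml sum_ths// mul1r.
apply: eq_bigr => m _.
have J0 : 2 ^+ j != 0 :> R by rewrite expf_neq0// pnatr_eq0.
pose r := (al / 2 ^+ j) *: 'X + (al * (m%:R - (2 ^ j)%:R + 6) / 2 ^+ j + be)%:P : {poly R}.
pose q := p \Po r.
have qE x : q.[x] = p.[al * ((m%:R - (2 ^ j)%:R + 6 + x) / 2 ^+ j) + be].
  rewrite /q horner_comp /r hornerD hornerZ hornerX hornerC; congr (_.[_]).
  by field.
have sq : (size q <= k.+1)%N.
  apply: leq_trans (size_comp_poly_leq _ _) _.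
  have : (size r <= 2)%N.
    apply: leq_trans (size_polyD _ _) _; rewrite geq_max.
    rewrite (leq_trans (size_scale_leq _ _)) ?size_polyX//=.
    by rewrite (leq_trans (size_polyC_leq1 _)).
  move: sp; set a := size p; set b := size r; move=> h1 h2; nia.
rewrite (_ : p.[al * s + be] = q.[offs m s - 6]); last first.
  rewrite qE; congr (_.[_]); rewrite /offs; by field.
rewrite (lag_repr _ sq) mulr_sumr; apply: eq_bigr => i _.
by rewrite kap0 /= qE /ths expr0 mul1r /nod /=; ring.
Qed.

End Nodes.
Section Approximants.
Context {R : realType}.
Variables (n : nat) (Y : set 'rV[R]_n.+1) (F : 'rV[R]_n.+1 -> R) (th : nat -> R -> R).
Notation V := ('rV[R]_n.+1).
Notation I := 'I_n.+1.
Hypothesis jth : jet setT th.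
Hypothesis th_supp : forall p t, 1 < `|t| -> th p t = 0.
Hypothesis th1 : forall N t, `|t| <= N%:R -> \sum_(i < (N.*2).+1) th 0%N (t + N%:R - i%:R) = 1.

Definition nodv j k (b : {ffun I -> 'I_(grid j) * 'I_k.+1}) : V := \row_l nod (b l).

Definition interp j k (m : {ffun I -> 'I_(grid j)}) (z : V) : R :=
  \sum_(i : {ffun I -> 'I_k.+1})
    (\prod_l (lag (i l)).[offs (m l) (z ord0 l) - 6]) * F (nodv [ffun l => (m l, i l)]).

Definition approx j k : V -> R := tens (@kap R th j k) (fun b => F (nodv b)) (fun=> 0%N).

(* Only these indices contribute to [corr] on [Y]; all nodes involved then lie
   in [Y], while [F] has arbitrary values outside [Y]. *)
Definition near_cell j k' (a : {ffun I -> 'I_(grid j) * ('I_(grid j.+1) * 'I_k'.+1)}) : Prop :=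
  exists y : V, [/\ Y y, `|y| <= 1, forall l, `|offs (a l).1 (y ord0 l)| <= 1 &
    forall l, `|(a l).2.1%:R - 2 * (a l).1%:R| <= 3 :> R].

Definition corr_coef j k k' (a : {ffun I -> 'I_(grid j) * ('I_(grid j.+1) * 'I_k'.+1)}) : R :=
  if `[< near_cell a >]
  then F (nodv [ffun l => (a l).2]) - interp k [ffun l => (a l).1] (nodv [ffun l => (a l).2])
  else 0.

Definition corr_fun j k' (t : 'I_(grid j) * ('I_(grid j.+1) * 'I_k'.+1)) (q : nat) : R -> R :=
  jmul q (ths th t.1) (kap th t.2).

Definition corr j k k' : V -> R := tens (@corr_fun j k') (@corr_coef j k k') (fun=> 0%N).

Lemma jet_corr_fun j k' t : jet setT (@corr_fun j k' t).
Proof. by apply: jet_jmul; [exact: jet_ths|exact: jet_kap]. Qed.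

Lemma sum_prod_ths j (x : V) : `|x| <= 1 ->
  \sum_(m : {ffun I -> 'I_(grid j)}) \prod_l ths th (m l) 0%N (x ord0 l) = 1.
Proof.
move=> x1; rewrite -(bigA_distr_bigA (fun l m => ths th m 0%N (x ord0 l))) big1// => l _.
by apply: sum_ths => //; apply: le_trans x1; exact: le_coord_norm.
Qed.

Lemma approxE j k (x : V) :
  approx j k x = \sum_(m : {ffun I -> 'I_(grid j)})
    (\prod_l ths th (m l) 0%N (x ord0 l)) * interp k m x.
Proof.
rewrite /approx /tens sum_ffun_pair; apply: eq_bigr => m _.
rewrite mulr_sumr; apply: eq_bigr => i _.
under eq_bigr do rewrite ffunE kap0 /=.
rewrite big_split /= mulrC -mulrA; congr (_ * _).
by apply: eq_bigr => l _; rewrite /ths expr0 mul1r.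
Qed.

Lemma interp_reproduced j k k' (m : {ffun I -> 'I_(grid j)}) (x : V) :
  `|x| <= 1 -> (k <= k')%N ->
  \sum_(b : {ffun I -> 'I_(grid j.+1) * 'I_k'.+1})
    interp k m (nodv b) * \prod_l kap th (b l) 0%N (x ord0 l) = interp k m x.
Proof.
move=> x1 kk; rewrite /interp; under eq_bigr do rewrite mulr_suml.
rewrite exchange_big /=; apply: eq_bigr => i _.
under eq_bigr do rewrite -mulrA [F _ * _]mulrC mulrA -big_split /=.
rewrite -mulr_suml; congr (_ * _).
transitivity (\prod_l \sum_(b : 'I_(grid j.+1) * 'I_k'.+1)
   (lag (i l)).[offs (m l) (nod b) - 6] * kap th b 0%N (x ord0 l)).
  rewrite bigA_distr_bigA /=; apply: eq_bigr => b _; apply: eq_bigr => l _.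
  by rewrite mxE.
apply: eq_bigr => l _.
have hx : `|x ord0 l| <= 1 by apply: le_trans x1; exact: le_coord_norm.
have sl : (size (@lag R k (i l)) <= k'.+1)%N by apply: leq_trans (size_lag _) _.
have := @kap_reproduces R th th1 j.+1 k' (lag (i l)) (2 ^+ j) ((2 ^ j)%:R - (m l)%:R - 6) _ hx sl.
rewrite /offs => h; rewrite -!addrA !addrA in h *.
by under eq_bigr do rewrite -!addrA; rewrite -!addrA in h *; exact: h.
Qed.

(** As [k <= k'], the finer approximation reproduces every coarse polynomial [interp k m]. Splitting
    the fine sum by the coarse partition of unity turns the difference into a sum over coarse cells
    and fine nodes, with [F] minus the coarse interpolant at the fine node as coefficient. *)
Lemma corrE j k k' (x : V) : Y x -> `|x| <= 1 -> (k <= k')%N ->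
  corr j k k' x = approx j.+1 k' x - approx j k x.
Proof.
move=> Yx x1 kk.
transitivity (\sum_(a : {ffun I -> 'I_(grid j) * ('I_(grid j.+1) * 'I_k'.+1)})
  (F (nodv [ffun l => (a l).2]) - interp k [ffun l => (a l).1] (nodv [ffun l => (a l).2])) *
  ((\prod_l ths th (a l).1 0%N (x ord0 l)) * \prod_l kap th (a l).2 0%N (x ord0 l))).
  apply: eq_bigr => a _; rewrite -big_split /=.
  rewrite /corr_coef; case: asboolP => // ncell.
  rewrite mul0r; apply/esym/eqP; rewrite mulf_eq0; apply/orP; right.
  apply/negP => /negP /prodf_neq0 hp; apply: ncell; exists x; split=> // l.
    have := hp l isT; rewrite mulf_eq0 negb_or => /andP[+ _].
    by case: (lerP _ 1) => // h; rewrite /ths th_supp// mulr0 eqxx.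
  have := hp l isT; rewrite mulf_eq0 negb_or => /andP[].
  rewrite kap0 /ths; set o1 := offs _ _; set o2 := offs _ _.
  case: (lerP `|o1| 1) => [h1 _|h]; last by rewrite th_supp// mulr0 eqxx.
  case: (lerP `|o2| 1) => [h2 _|h]; last by rewrite (th_supp _ h) mul0r eqxx.
  (* With both offsets at most 1 in absolute value, this gives the 3 of [near_cell]. *)
  rewrite (_ : _ - _ = 2 * o1 - o2); last first.
    by rewrite /o1 /o2 /offs expnS natrM exprS; ring.
  by move: h1 h2; rewrite !ler_norml; lra.
rewrite sum_ffun_pair /=.
transitivity (\sum_(m : {ffun I -> 'I_(grid j)}) (\prod_l ths th (m l) 0%N (x ord0 l)) *
   (approx j.+1 k' x - interp k m x)); last first.
  by under eq_bigr do rewrite mulrBr; rewrite sumrB -mulr_suml sum_prod_ths// mul1r (approxE j k).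
apply: eq_bigr => m _.
rewrite -(interp_reproduced _ x1 kk) /approx /tens -sumrB mulr_sumr; apply: eq_bigr => b _.
rewrite -mulrBl mulrCA; congr (_ * (_ * _)).
- by apply: eq_bigr => l _; rewrite !ffunE.
- have e : [ffun l => ([ffun l0 => (m l0, b l0)] l).2] = b by apply/ffunP => l; rewrite !ffunE.
  have e' : [ffun l => ([ffun l0 => (m l0, b l0)] l).1] = m by apply/ffunP => l; rewrite !ffunE.
  by rewrite e e'.
- by apply: eq_bigr => l _; rewrite !ffunE.
Qed.

End Approximants.

(** * Interpolation error in several variables *)

Section InterpolationError.
Context {R : realType}.
Variables (n : nat) (Y : set 'rV[R]_n.+1) (F : 'rV[R]_n.+1 -> R) (Cd : nat -> R).
Notation V := ('rV[R]_n.+1).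
Notation I := 'I_n.+1.
Hypothesis HY : forall y z : V, Y y -> `|y| <= 1 ->
  (forall l, 0 <= z ord0 l - y ord0 l <= 12) -> Y z.
Hypothesis HJ : forall (y : V) l, Y y -> `|y| <= 13 -> exists u : nat -> R -> R,
  [/\ jet `]0, 13[%classic u, forall k s, 0 < s < 13 -> `|u k s| <= Cd k,
      forall s, 0 <= s < 13 -> u 0%N s = F (y + s *: delta_mx ord0 l) &
      forall e, 0 < e -> exists2 d, 0 < d & forall s, 0 <= s < d -> `|u 0%N s - u 0%N 0| <= e].

(** The coordinates of [z] are exchanged for nodes one at a time: [hyb S i] has nodes in the
    coordinates of [S]. By [sum_ffun_average] each exchange is a one-dimensional interpolation, of
    cost [La ^ (n + 1) * E], and there are n + 1 of them. *)
Lemma interp_error j k (La L : R) (y z : V) (m : {ffun I -> 'I_(grid j)}) :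
  k%:R + 7 <= L -> L / 2 ^+ j <= 12 ->
  (forall x, `|x| <= L -> \sum_(c < k.+1) `|(lag c : {poly R}).[x]| <= La) ->
  Y y -> `|y| <= 1 -> (forall l, `|offs (m l) (y ord0 l)| <= 1) ->
  (forall l, 0 <= z ord0 l - y ord0 l <= L / 2 ^+ j) ->
  `|F z - interp F k m z| <=
    n.+1%:R * (La ^+ n.+1 * (Cd k.+1 * (L / 2 ^+ j) ^+ k.+1 * (1 + La))).
Proof.
move=> kL L12 hLa Yy y1 my zy.
set E := Cd k.+1 * _ * _.
have H0 : 0 < 2 ^+ j :> R by rewrite exprn_gt0.
have H0' : 2 ^+ j != 0 :> R by rewrite gt_eqF.
have k0 : 0 <= k%:R :> R by [].
have L0 : 0 <= L by lra.
have La0 : 0 <= La.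
  by apply: le_trans (hLa 0 _); rewrite ?normr0//; apply: sumr_ge0.
have offsE l s : offs (m l) s = 2 ^+ j * (s - y ord0 l) + offs (m l) (y ord0 l).
  by rewrite /offs; ring.
pose w l (c : 'I_k.+1) : R := (lag c).[offs (m l) (z ord0 l) - 6].
have w1 l : \sum_c w l c = 1 by exact: lag_sum1.
have wLa l : \sum_c `|w l c| <= La.
  apply: hLa; rewrite offsE ler_norml.
  have /andP[z1 z2] := zy l; have := my l; rewrite ler_norml => /andP[b1 b2].
  have : 0 <= 2 ^+ j * (z ord0 l - y ord0 l) <= L.
    by rewrite mulr_ge0 ?(ltW H0)//= mulrC -ler_pdivlMr.
  by lra.
pose hyb (S : seq I) (i : {ffun I -> 'I_k.+1}) : V :=
  \row_l if l \in S then nod (m l, i l) else z ord0 l.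
have nody l c : 0 < nod (m l, c : 'I_k.+1) - y ord0 l <= L / 2 ^+ j.
  have -> : nod (m l, c) - y ord0 l = (6 + c%:R - offs (m l) (y ord0 l)) / 2 ^+ j.
    by rewrite /nod /offs /=; field.
  have := my l; rewrite ler_norml => /andP[b1 b2].
  have ck : c%:R <= k%:R :> R by rewrite ler_nat -ltnS.
  have c0 : 0 <= c%:R :> R by [].
  by rewrite divr_gt0 ?ler_pM2r ?invr_gt0//; lra.
have hyby S i l : 0 <= hyb S i ord0 l - y ord0 l <= L / 2 ^+ j.
  rewrite mxE; case: ifP => _; last exact: zy.
  by have /andP[? ?] := nody l (i l); lra.
pose Q S := \sum_(i : {ffun I -> 'I_k.+1}) (\prod_l w l (i l)) * F (hyb S i).
have Qstep l S : l \notin S -> `|Q S - Q (l :: S)| <= La ^+ n.+1 * E.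
  move=> lS; rewrite /Q [X in _ - X](sum_ffun_average (l := l))// -sumrB.
  under eq_bigr do rewrite -mulrBr.
  apply: le_trans (ler_norm_sum _ _ _) _.
  apply: (@le_trans _ _ (\sum_(i : {ffun I -> 'I_k.+1}) `|\prod_l w l (i l)| * E)); last first.
    rewrite -mulr_suml; apply: ler_wpM2r.
      rewrite /E mulr_ge0// ?addr_ge0// mulr_ge0// ?exprn_ge0// ?divr_ge0// ?(ltW H0)//.
      have [u [_ hu _ _]] := HJ l Yy (le_trans y1 (ler1n _ 13)).
      by apply: le_trans (hu k.+1 1 _) => //; rewrite ltr01 (ltr_nat _ 1 13).
    by rewrite -[X in La ^+ X]card_ord; exact: sum_prod_norm_le.
  apply: ler_sum => i _; rewrite normrM; apply: ler_wpM2l => //.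
  pose p := hyb S i.
  have pl : p ord0 l = z ord0 l by rewrite mxE (negPf lS).
  (* The l-th coordinate is pulled back to that of [y]. The new point lies in [Y], and both [p] and
     the nodes in coordinate l lie ahead of it on the l-th axis, where [HJ] gives derivatives. As
     [|y| <= 1] and the other moves are at most 12, its norm is at most 13. *)
  pose y' : V := p + (y ord0 l - p ord0 l) *: delta_mx ord0 l.
  have y'E l' : y' ord0 l' = if l' == l then y ord0 l else p ord0 l'.
    rewrite {1}/y' mxE [X in _ + X = _]mxE [delta_mx _ _ _ _]mxE eqxx /=.
    case: eqVneq => [->|_] /=; last by rewrite mulr0 addr0.
    by rewrite mulr1; ring.
  have y'y l' : 0 <= y' ord0 l' - y ord0 l' <= L / 2 ^+ j.
    rewrite y'E; case: eqP => [->|_]; last exact: hyby.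
    by rewrite subrr lexx divr_ge0// ltW.
  have Yy' : Y y' by apply: HY Yy y1 _ => l'; have /andP[-> h] := y'y l'; exact: le_trans L12.
  have y'13 : `|y'| <= 13.
    apply: rV_norm_le => // l'; have /andP[h1 h2] := y'y l'.
    have := le_trans (le_coord_norm y l') y1; rewrite !ler_norml => /andP[h3 h4].
    by lra.
  have [u [ju uC uF rc]] := HJ l Yy' y'13.
  pose tau : R := nod (m l, ord0 : 'I_k.+1) - y ord0 l.
  have tauc (c : 'I_k.+1) : tau + (2 ^+ j)^-1 * c%:R = nod (m l, c) - y ord0 l.
    by rewrite /tau /nod /=; field.
  have Lh : L * (2 ^+ j)^-1 < 13 by apply: le_lt_trans L12 _; rewrite ltr_nat.
  have pt : p = y' + (z ord0 l - y ord0 l) *: delta_mx ord0 l.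
    by rewrite /y' pl -addrA -scalerDl [_ + (z _ _ - _)]addrC subrKA subrr scale0r addr0.
  have pc c : hyb (l :: S) (upd i l c) = y' + (tau + (2 ^+ j)^-1 * c%:R) *: delta_mx ord0 l.
    apply/rowP => l'; rewrite [RHS]mxE y'E tauc !mxE ffunE inE eqxx /=.
    case: eqVneq => [->|_] /=; first by rewrite mulr1; ring.
    by rewrite mulr0 addr0.
  have tzl : 0 <= z ord0 l - y ord0 l <= L / 2 ^+ j by exact: zy.
  have := @interp1 R u 13 (Cd k.+1) L (2 ^+ j)^-1 tau (z ord0 l - y ord0 l) La k
    ju (fun s hs => uC k.+1 s hs) rc _ L0 Lh _ _ tzl hLa.
  rewrite invr_gt0 uF; last by have /andP[-> /le_lt_trans] := tzl; apply.
  rewrite -pt => h; apply: le_trans (h _ _ _) => //.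
  - rewrite le_eqVlt; apply/orP; left; apply/eqP; congr `|_ - _|; apply: eq_bigr => c _.
    have /andP[c1 c2] := nody l c.
    rewrite mulrC uF ?pc//; last by rewrite tauc (ltW c1) /=; exact: le_lt_trans Lh.
    congr (_ * _.[_]); rewrite /tau /nod /offs /=; field => //.
  - by have /andP[] := nody l ord0.
  - by have /andP[] := nody l ord_max; rewrite -tauc.
have Qn (S : seq I) : uniq S -> `|F z - Q S| <= (size S)%:R * (La ^+ n.+1 * E).
  elim: S => [_|l S IH /= /andP[lS uS]].
    rewrite mul0r /Q (eq_bigr (fun i : {ffun I -> 'I_k.+1} => (\prod_l w l (i l)) * F z)).
      rewrite -mulr_suml -bigA_distr_bigA big1 => [|l _]; last exact: w1.
      by rewrite mul1r subrr normr0.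
    by move=> i _; congr (_ * F _); apply/rowP => l; rewrite mxE.
  rewrite (_ : F z - Q (l :: S) = (F z - Q S) + (Q S - Q (l :: S))); last by ring.
  apply: le_trans (ler_normD _ _) _; rewrite -natr1 mulrDl mul1r; apply: lerD; first exact: IH.
  exact: Qstep.
have := Qn (enum I) (enum_uniq _); rewrite size_enum_ord => h; apply: le_trans h.
rewrite le_eqVlt; apply/orP; left; apply/eqP; congr `|_ - _|; apply: eq_bigr => i _; congr (_ * F _).
by apply/rowP => l; rewrite !mxE mem_enum ffunE.
Qed.

End InterpolationError.

(** * Choice of the degrees and uniform bounds for the corrections *)

Section SlowGrowth.
Context {R : realType}.

(* The interpolation degree may grow so slowly that all constants depending on
   it are absorbed by the geometric gain. *)
Lemma slow_growth (A : nat -> R) : exists k : nat -> nat,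
  [/\ forall j, (k j <= j)%N, forall j, (k j <= k j.+1 <= (k j).+1)%N,
      forall j, A (k j) <= A 0%N + 2 ^+ j &
      forall p, exists J, forall j, (J <= j)%N -> (p <= k j)%N].
Proof.
pose k := fix k j := if j is j'.+1 then
   if A (k j').+1 <= A 0%N + 2 ^+ j'.+1 then (k j').+1 else k j' else 0%N.
have kS j : k j.+1 = if A (k j).+1 <= A 0%N + 2 ^+ j.+1 then (k j).+1 else k j by [].
have step j : (k j <= k j.+1 <= (k j).+1)%N.
  by rewrite kS; case: ifP => _; rewrite leqnn leqnSn.
have mono i j : (i <= j)%N -> (k i <= k j)%N.
  elim: j => [|j IH]; first by rewrite leqn0 => /eqP ->.
  rewrite leq_eqVlt => /predU1P[->//|/IH h]; apply: leq_trans h _.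
  by have /andP[] := step j.
exists k; split=> //.
- elim=> // j IH; have /andP[_ h] := step j; exact: leq_trans h _.
- elim=> [|j IH]; first by rewrite lerDl.
  rewrite kS; case: ifP => // _; apply: le_trans IH _.
  by rewrite lerD2l ler_weXn2l// ler1n.
- elim=> [|p [J hJ]]; first by exists 0%N.
  have [j1 Jj1 hj1] : exists2 j1, (J <= j1)%N & A p.+1 <= A 0%N + 2 ^+ j1.+1.
    exists (maxn J (Num.truncn `|A p.+1 - A 0%N|)); first exact: leq_maxl.
    rewrite -lerBlDl; apply: le_trans (ler_norm _) _.
    apply: le_trans (ltW (truncnS_gt _)) _; rewrite -natrX ler_nat.
    apply: leq_trans (ltnW (ltn_expl _ (ltnSn 1))); by rewrite ltnS leq_maxr.
  exists j1.+1 => j jj; apply: leq_trans (mono _ _ jj).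
  have := hJ _ Jj1; rewrite leq_eqVlt => /predU1P[pk|pk]; first by rewrite kS -pk hj1.
  by have /andP[h _] := step j1; exact: leq_trans h.
Qed.

End SlowGrowth.

Section FamilyBounds.
Context {R : realType}.
Variables (th : nat -> R -> R).
Hypothesis th_supp : forall p t, 1 < `|t| -> th p t = 0.
Hypothesis th_bound : forall p, exists2 C, 0 <= C & forall t, `|th p t| <= C.

Lemma uniform_bound_le (T : finType) (g : T -> nat -> R -> R) :
  (forall t q, exists2 C, 0 <= C & forall s, `|g t q s| <= C) ->
  forall P, exists2 C, 0 <= C & forall t q s, (q <= P)%N -> `|g t q s| <= C.
Proof.
move=> hg P.
have /choice[C hC] (x : T * nat) : exists C, 0 <= C /\ forall s, `|g x.1 x.2 s| <= C.
  by have [C C0 h] := hg x.1 x.2; exists C.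
exists (\sum_(t : T) \sum_(q < P.+1) C (t, val q)).
  by apply: sumr_ge0 => t _; apply: sumr_ge0 => q _; have [] := hC (t, val q).
move=> t q s qP; have [_ /(_ s) /le_trans] := hC (t, q); apply.
rewrite (bigD1 t)//= (bigD1 (Ordinal (qP : (q < P.+1)%N)))//= -addrA lerDl addr_ge0//.
  by apply: sumr_ge0 => q' _; have [] := hC (t, val q').
by apply: sumr_ge0 => t' _; apply: sumr_ge0 => q' _; have [] := hC (t', val q').
Qed.

Lemma jmul_supp q (v : nat -> R -> R) t : 1 < `|t| -> jmul q th v t = 0.
Proof. by move=> t1; rewrite jmulE big1// => j _; rewrite th_supp// mul0r mulr0. Qed.

Lemma jmul_lagj_bound k (i : 'I_k.+1) q :
  exists2 C, 0 <= C & forall t, `|jmul q th (lagj i) t| <= C.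
Proof.
have /choice[a ha] p : exists a, 0 <= a /\ forall t, `|th p t| <= a.
  by have [C ? ?] := th_bound p; exists C.
have /choice[b hb] p : exists b, 0 <= b /\ forall t, `|t| <= 7 -> `|(derivn p (@lag R k i)).[t]| <= b.
  by have [C ? ?] := @horner_bounded R (derivn p (lag i)) 7 (ler0n _ _); exists C.
exists (\sum_(j < q.+1) 'C(q, j)%:R * (a j * b (q - j)%N)).
  by apply: sumr_ge0 => j _; rewrite !mulr_ge0//; [have [] := ha j|have [] := hb (q - j)%N].
move=> t; case: (ltP 1 `|t|) => t1.
  rewrite jmul_supp// normr0.
  by apply: sumr_ge0 => j _; rewrite !mulr_ge0//; [have [] := ha j|have [] := hb (q - j)%N].
apply: jmul_bound => p _; first by have [_] := ha p; apply.
by have [_] := hb p; apply; move: t1; rewrite !ler_norml; lra.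
Qed.

(** Finite overlap makes the constant independent of the scale [j]; rescaling produces the powers of
    2^(j+1). *)
Lemma corr_fun_bound : exists B : nat -> nat -> R, (forall P k, 0 <= B P k) /\
  forall P j k p s, (p <= P)%N ->
    \sum_t `|@corr_fun R th j k t p s| <= B P k * (2 ^+ j.+1) ^+ p.
Proof.
have /choice[a ha] P : exists a, 0 <= a /\ forall q s, (q <= P)%N -> `|th q s| <= a.
  have [|C C0 hC] := @uniform_bound_le unit (fun=> th) _ P; first by [].
  by exists C; split=> // q s; exact: (hC tt).
have /choice[b hb] (x : nat * nat) : exists b, 0 <= b /\
    forall (i : 'I_x.2.+1) q s, (q <= x.1)%N -> `|jmul q th (lagj i) s| <= b.
  have [C C0 hC] := uniform_bound_le (@jmul_lagj_bound x.2) x.1.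
  by exists C.
exists (fun P k => 2 ^+ P * (3 * a P) * (k.+1%:R * (3 * b (P, k)))); split.
  move=> P k; have [a0 _] := ha P; have [b0 _] := hb (P, k).
  by rewrite !mulr_ge0// exprn_ge0.
move=> P j k p s pP; have [a0 hA] := ha P; have [b0 hB] := hb (P, k).
apply: (@jmul_family_bound R _ _ (@ths R th j) (@kap R th j.+1 k)) pP;
  rewrite ?mulr_ge0 ?exprn_ge0// => q qP.
  have := @shift_family_bound R th (a P) (2 ^+ j) (2 ^+ j.+1) P (grid j) (2 ^ j)%:R s a0.
  apply=> //.
  by rewrite exprn_ge0//= ler_weXn2l// ler1n.
rewrite -(pair_bigA _ (fun m i => `|@kap R th j.+1 k (m, i) q s|)) exchange_big /=.
apply: (@le_trans _ _ (\sum_(i < k.+1) 3 * b (P, k) * (2 ^+ j.+1) ^+ q)); last first.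
  by rewrite sumr_const card_ord -[_ *+ k.+1]mulr_natl !mulrA.
apply: ler_sum => i _.
have := @shift_family_bound R (fun q => jmul q th (lagj i)) (b (P, k)) (2 ^+ j.+1)
  (2 ^+ j.+1) P (grid j.+1) (2 ^ j.+1)%:R s b0.
apply=> //; first by rewrite exprn_ge0//=.
  by move=> q' t q'P; exact: hB.
by move=> q' t; exact: jmul_supp.
Qed.

Lemma sum_ths_norm_bound : exists2 C, 0 <= C &
  forall j s, \sum_(m < grid j) `|ths th m 0%N s| <= C.
Proof.
have [C C0 hC] := th_bound 0%N; exists (3 * C); first by rewrite mulr_ge0.
move=> j s; under eq_bigr do rewrite /ths expr0 mul1r.
by apply: overlap_count => // t; exact: th_supp.
Qed.

End FamilyBounds.
Section Extension.
Context {R : realType}.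
Variables (n : nat) (Y : set 'rV[R]_n.+1) (F : 'rV[R]_n.+1 -> R) (Cd : nat -> R).
Notation V := ('rV[R]_n.+1).
Notation I := 'I_n.+1.
Hypothesis Cd0 : forall k, 0 <= Cd k.
Hypothesis HY : forall y z : V, Y y -> `|y| <= 1 ->
  (forall l, 0 <= z ord0 l - y ord0 l <= 12) -> Y z.
Hypothesis HJ : forall (y : V) l, Y y -> `|y| <= 13 -> exists u : nat -> R -> R,
  [/\ jet `]0, 13[%classic u, forall k s, 0 < s < 13 -> `|u k s| <= Cd k,
      forall s, 0 <= s < 13 -> u 0%N s = F (y + s *: delta_mx ord0 l) &
      forall e, 0 < e -> exists2 d, 0 < d & forall s, 0 <= s < d -> `|u 0%N s - u 0%N 0| <= e].

(** The condition [k <= j] keeps [(k + 12) / 2 ^ j] below 12, the range in which [Y] is stable. *)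
Lemma interp_error_scaled : exists2 Er : nat -> R, (forall k, 0 <= Er k) &
  forall j k (y z : V) (m : {ffun I -> 'I_(grid j)}), (k <= j)%N ->
  Y y -> `|y| <= 1 -> (forall l, `|offs (m l) (y ord0 l)| <= 1) ->
  (forall l, 0 <= z ord0 l - y ord0 l <= (k%:R + 12) / 2 ^+ j) ->
  `|F z - interp F k m z| <= Er k / (2 ^+ j) ^+ k.+1.
Proof.
have /choice[La hLa] (k : nat) : exists La, 0 <= La /\ forall x, `|x| <= k%:R + 12 ->
    \sum_(c < k.+1) `|(lag c : {poly R}).[x]| <= La.
  by have [C ? ?] := @lag_bounded R k (k%:R + 12) (addr_ge0 (ler0n _ _) (ler0n _ _)); exists C.
exists (fun k => n.+1%:R * (La k ^+ n.+1 * (Cd k.+1 * (k%:R + 12) ^+ k.+1 * (1 + La k)))).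
  move=> k; have [La0 _] := hLa k.
  by rewrite !mulr_ge0 ?exprn_ge0 ?addr_ge0.
move=> j k y z m kj Yy y1 my zy; have [La0 hL] := hLa k.
have h := @interp_error R n Y F Cd HY HJ j k (La k) (k%:R + 12) y z m _ _ hL Yy y1 my zy.
apply: le_trans (h _ _) _.
- by lra.
- rewrite ler_pdivrMr ?exprn_gt0//.
  have j2 : j.+1%:R <= 2 ^+ j :> R by rewrite -natrX ler_nat ltn_expl.
  have kj' : k%:R <= j%:R :> R by rewrite ler_nat.
  have j0 : 0 <= j%:R :> R by [].
  by rewrite -natr1 in j2; lra.
- by rewrite exprMn exprVn le_eqVlt; apply/orP; left; apply/eqP; ring.
Qed.

Variable th : nat -> R -> R.
Hypothesis jth : jet setT th.
Hypothesis th_supp : forall p t, 1 < `|t| -> th p t = 0.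
Hypothesis th_bound : forall p, exists2 C, 0 <= C & forall t, `|th p t| <= C.
Hypothesis th1 : forall N t, `|t| <= N%:R -> \sum_(i < (N.*2).+1) th 0%N (t + N%:R - i%:R) = 1.

Lemma corr_coef_bound (Er : nat -> R) : (forall k, 0 <= Er k) ->
  (forall j k (y z : V) (m : {ffun I -> 'I_(grid j)}), (k <= j)%N ->
    Y y -> `|y| <= 1 -> (forall l, `|offs (m l) (y ord0 l)| <= 1) ->
    (forall l, 0 <= z ord0 l - y ord0 l <= (k%:R + 12) / 2 ^+ j) ->
    `|F z - interp F k m z| <= Er k / (2 ^+ j) ^+ k.+1) ->
  forall j k k' a, (k <= j)%N -> (k' <= k.+1)%N ->
  `|@corr_coef R n Y F j k k' a| <= Er k / (2 ^+ j) ^+ k.+1.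
Proof.
move=> Er0 hEr j k k' a kj kk; rewrite /corr_coef; case: asboolP => [[y [Yy y1 ay aa]]|_]; last first.
  by rewrite normr0 divr_ge0// !exprn_ge0.
apply: (hEr _ _ y) => // l; first by rewrite ffunE.
rewrite mxE ffunE.
have H0 : 0 < 2 ^+ j :> R by rewrite exprn_gt0.
(* Six fine cells are three coarse ones, more than the 3/2 + 1 that the other terms can take away.
   So the fine node lies ahead of [y] in each coordinate. *)
have -> : nod (a l).2 - y ord0 l = (((a l).2.1%:R - 2 * (a l).1%:R) / 2 + 3 + (a l).2.2%:R / 2
   - offs (a l).1 (y ord0 l)) / 2 ^+ j.
  rewrite /nod /offs expnS natrM exprS; field.
  by rewrite gt_eqF.
have := ay l; rewrite ler_norml => /andP[b1 b2].
have := aa l; rewrite ler_norml => /andP[c1 c2].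
have d1 : 0 <= (a l).2.2%:R :> R by [].
have d2 : (a l).2.2%:R <= k%:R + 1 :> R.
  by rewrite natr1 ler_nat (leq_trans _ kk)// -ltnS.
have k0 : 0 <= k%:R :> R by [].
by rewrite divr_ge0 ?(ltW H0)// ?ler_pM2r ?invr_gt0//; lra.
Qed.

Lemma approx_cvg (Er : nat -> R) (k : nat -> nat) (A0 : R) x :
  (forall j k (y z : V) (m : {ffun I -> 'I_(grid j)}), (k <= j)%N ->
    Y y -> `|y| <= 1 -> (forall l, `|offs (m l) (y ord0 l)| <= 1) ->
    (forall l, 0 <= z ord0 l - y ord0 l <= (k%:R + 12) / 2 ^+ j) ->
    `|F z - interp F k m z| <= Er k / (2 ^+ j) ^+ k.+1) ->
  (forall k, 0 <= Er k) -> 0 <= A0 ->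
  (forall j, (k j <= j)%N) -> (forall j, Er (k j) <= A0 + 2 ^+ j) ->
  (forall p, exists J, forall j, (J <= j)%N -> (p <= k j)%N) ->
  Y x -> `|x| <= 1 -> (fun j => approx F th j (k j) x) @ \oo --> F x.
Proof.
move=> hEr Er0 A00 kj kA kinf Yx x1.
have [C C0 hC] := sum_ths_norm_bound th_supp th_bound.
have bnd j : `|F x - approx F th j (k j) x| <= C ^+ n.+1 * (Er (k j) / (2 ^+ j) ^+ (k j).+1).
  have -> : F x = \sum_(m : {ffun I -> 'I_(grid j)}) (\prod_l ths th (m l) 0%N (x ord0 l)) * F x.
    by rewrite -mulr_suml (@sum_prod_ths R n th)// mul1r.
  rewrite approxE -sumrB; under eq_bigr do rewrite -mulrBr.
  apply: le_trans (ler_norm_sum _ _ _) _.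
  have e0 : 0 <= Er (k j) / (2 ^+ j) ^+ (k j).+1 by rewrite divr_ge0// !exprn_ge0.
  apply: (@le_trans _ _ (\sum_(m : {ffun I -> 'I_(grid j)})
      `|\prod_l ths th (m l) 0%N (x ord0 l)| * (Er (k j) / (2 ^+ j) ^+ (k j).+1))); last first.
    rewrite -mulr_suml ler_wpM2r//.
    by have := @sum_prod_norm_le R I 'I_(grid j) (fun l m => ths th m 0%N (x ord0 l)) C C0
       (fun l => hC j (x ord0 l)); rewrite card_ord.
  apply: ler_sum => m _; rewrite normrM.
  have [->|pm] := eqVneq (\prod_l ths th (m l) 0%N (x ord0 l)) 0.
    by rewrite normr0 !mul0r.
  rewrite ler_wpM2l//; apply: (hEr _ _ x) => // l.
    move/prodf_neq0: pm => /(_ l isT); case: (lerP _ 1) => // h.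
    by rewrite /ths th_supp// mulr0 eqxx.
  by rewrite subrr lexx divr_ge0 ?exprn_ge0// addr_ge0.
(* Once the degree is at least 1, the error is at most a multiple of [(A0 + 2 ^ j) / 4 ^ j]. *)
have [J hJ] := kinf 1%N.
have bnd' j : (J <= j)%N -> `|F x - approx F th j (k j) x| <= C ^+ n.+1 * (A0 + 1) / 2 ^+ j.
  move=> Jj; apply: le_trans (bnd j) _; rewrite -mulrA ler_wpM2l ?exprn_ge0//.
  have P0 : 1 <= 2 ^+ j :> R by rewrite exprn_ege1// ler1n.
  have Pp : 0 < 2 ^+ j :> R by rewrite exprn_gt0.
  rewrite ler_pdivrMr ?exprn_gt0//.
  have h : (2 ^+ j) ^+ 2 <= (2 ^+ j) ^+ (k j).+1 :> R by apply: ler_weXn2l => //; rewrite ltnS hJ.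
  apply: le_trans (kA j) _.
  apply: (@le_trans _ _ ((A0 + 1) / 2 ^+ j * (2 ^+ j) ^+ 2)); last first.
    by rewrite ler_wpM2l// divr_ge0// addr_ge0.
  rewrite expr2 mulrA divfK ?gt_eqF// mulrDl mul1r lerD2r ler_peMr//.
apply/cvgrPdist_le => e e0.
have : (fun j => C ^+ n.+1 * (A0 + 1) / 2 ^+ j) @ \oo --> (0 : R).
  have := @cvg_geometric R (C ^+ n.+1 * (A0 + 1)) 2^-1.
  rewrite ger0_norm ?invr_ge0// invf_lt1// ltr1n => /(_ isT); apply: cvg_trans.
  by apply: near_eq_cvg; near=> j; rewrite /geometric /= exprVn.
move/cvgrPdist_le => /(_ e e0) h; near=> j.
apply: le_trans (bnd' j _) _; first by near: j; exists J.
have : `|0 - C ^+ n.+1 * (A0 + 1) / 2 ^+ j| <= e by near: j.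
by rewrite sub0r normrN; apply: le_trans; exact: ler_norm.
Unshelve. all: by end_near. Qed.

Lemma smooth_extension : exists g : V -> R,
  smooth_on setT g /\ forall x, Y x -> `|x| <= 1 -> g x = F x.
Proof.
have [Er Er0 hEr] := interp_error_scaled.
have [B [B0 hB]] := corr_fun_bound th_supp th_bound.
(* [A q] dominates [Er q] alone and [Er q] times the derivative constants of orders up to [q], for
   the degrees [q] and [q + 1]. Finitely many orders per degree suffice, as the degree eventually
   exceeds any given order. *)
pose A k := Er k * (1 + \sum_(p < k.+1) (B p k ^+ n.+1 + B p k.+1 ^+ n.+1)).
have S0 k : 0 <= \sum_(p < k.+1) (B p k ^+ n.+1 + B p k.+1 ^+ n.+1).
  by apply: sumr_ge0 => p _; rewrite addr_ge0// exprn_ge0.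
have A0 : 0 <= A 0%N by rewrite mulr_ge0// addr_ge0.
have [k [kj kS kA kinf]] := slow_growth A.
have ErA q : Er q <= A q by rewrite /A ler_peMr// lerDl.
have EBA q p k' : (p <= q)%N -> (q <= k' <= q.+1)%N -> Er q * B p k' ^+ n.+1 <= A q.
  move=> pq hk'; rewrite /A ler_wpM2l//.
  rewrite (bigD1 (Ordinal (pq : (p < q.+1)%N)))//=.
  have : 0 <= \sum_(i < q.+1 | i != Ordinal (pq : (p < q.+1)%N)) (B i q ^+ n.+1 + B i q.+1 ^+ n.+1).
    by apply: sumr_ge0 => i _; rewrite addr_ge0// exprn_ge0.
  have h1 : 0 <= B p q ^+ n.+1 by rewrite exprn_ge0.
  have h2 : 0 <= B p q.+1 ^+ n.+1 by rewrite exprn_ge0.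
  have [->|->] : k' = q \/ k' = q.+1 by lia.
    by lra.
  by lra.
pose D j := corr Y F th j (k j) (k j.+1).
have sD j : smooth_on setT (D j) by apply: smooth_tens => t; exact: jet_corr_fun.
pose cc p j := Er (k j) / (2 ^+ j) ^+ (k j).+1 * B p (k j.+1) ^+ n.+1 *
   (n.+1%:R * 2 ^+ j.+1) ^+ p * 2 ^+ j.
have cc0 p j : 0 <= cc p j.
  by rewrite /cc !mulr_ge0// ?exprn_ge0// ?mulr_ge0// ?invr_ge0 ?exprn_ge0.
(* For [p < k j] the gain 2^(-j (k_j + 1)) pays for three losses: 2^(jp) from the derivatives, 2^j
   from the growth of [A], and the 2^j demanded by [smooth_series]. The finitely many other [j] are
   covered by their sum. *)
have /choice[b hb] p : exists b, forall j, cc p j <= b.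
  have [J hJ] := kinf p.+1.
  pose b1 := (A 0%N + 1) * (n.+1%:R * 2) ^+ p.
  have b10 : 0 <= b1 by rewrite mulr_ge0// ?addr_ge0// exprn_ge0// mulr_ge0.
  exists (\sum_(j < J) cc p j + b1) => j; case: (ltnP j J) => jJ.
    rewrite (bigD1 (Ordinal jJ))//= -addrA lerDl addr_ge0// sumr_ge0//.
  rewrite -[leLHS]add0r lerD ?sumr_ge0//.
  set q := k j; have pq : (p < q)%N := hJ j jJ.
  have P1 : 1 <= 2 ^+ j :> R by rewrite exprn_ege1// ler1n.
  have Pp : 0 < 2 ^+ j :> R by rewrite exprn_gt0.
  have -> : cc p j = Er q * B p (k j.+1) ^+ n.+1 * (n.+1%:R * 2) ^+ p * ((2 ^+ j) ^+ p.+1 / (2 ^+ j) ^+ q.+1).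
    have e : (n.+1%:R * 2 ^+ j.+1) ^+ p = (n.+1%:R * 2) ^+ p * (2 ^+ j) ^+ p :> R.
      by rewrite [2 ^+ j.+1]exprS mulrA exprMn.
    by rewrite /cc -/q e [(2 ^+ j) ^+ p.+1]exprS; ring.
  apply: (@le_trans _ _ ((A 0%N + 2 ^+ j) * (n.+1%:R * 2) ^+ p * (2 ^+ j)^-1)).
    apply: ler_pM; rewrite ?divr_ge0 ?exprn_ge0 ?mulr_ge0 ?exprn_ge0 ?mulr_ge0//.
      rewrite ler_wpM2r ?exprn_ge0 ?mulr_ge0//; apply: le_trans (kA j).
      by apply: EBA; [exact: ltnW|exact: kS].
    rewrite ler_pdivrMr ?exprn_gt0// mulrC ler_pdivlMr// -exprSr.
    by apply: ler_weXn2l.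
  rewrite mulrAC ler_wpM2r ?exprn_ge0 ?mulr_ge0// mulrDl divff ?gt_eqF// lerD2r.
  by rewrite ler_pdivrMr// ler_peMr.
have bD j vs x : `|iterD vs (D j) x| <= b (size vs) * nprod vs / 2 ^+ j.
  have := @iterD_tens_bound R n _ _ (@jet_corr_fun R th jth j (k j.+1))
    (@corr_coef R n Y F j (k j) (k j.+1)) (size vs) (Er (k j) / (2 ^+ j) ^+ (k j).+1)
    (B (size vs) (k j.+1)) (2 ^+ j.+1) vs x _ (B0 _ _) _ _ _ (leqnn _).
  move=> h; apply: le_trans (h _ _ _ _) _ => {h}.
  - by rewrite divr_ge0// !exprn_ge0.
  - by rewrite exprn_ge0.
  - by move=> a; apply: corr_coef_bound => //; have /andP[] := kS j.
  - by move=> p s pP; exact: hB.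
  rewrite ler_pdivlMr ?exprn_gt0// mulrAC ler_wpM2r ?nprod_ge0//.
  exact: hb.
have sS := smooth_series sD bD.
have sf : smooth_on setT (approx F th 0 (k 0%N)) by apply: smooth_tens => t; exact: jet_kap.
exists (fun x => approx F th 0 (k 0%N) x + limn (series (fun j => D j x))); split.
  move=> vs x _.
  rewrite (_ : iterD _ _ = iterD vs (approx F th 0 (k 0%N)) +
     iterD vs (fun x => limn (series (fun j => D j x)))); last first.
    by apply/funext => z; exact: (iterD_add vs openT sf sS).
  by apply: differentiableD; [exact: sf|exact: sS].
move=> x Yx x1.
have sE : series (fun j => D j x) = (fun J => approx F th J (k J) x - approx F th 0 (k 0%N) x).
  apply/funext => J; rewrite /series /= -(telescope_sumr (fun j => approx F th j (k j) x))//.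
  apply: eq_bigr => j _; apply: corrE => //.
  by have /andP[] := kS j.
have : series (fun j => D j x) @ \oo --> F x - approx F th 0 (k 0%N) x.
  rewrite sE; apply: cvgB; last exact: cvg_cst.
  apply: (approx_cvg hEr Er0 A0) => // j; exact: le_trans (ErA _) (kA j).
by move/cvg_lim => ->//; rewrite addrC subrK.
Qed.

End Extension.

(** * Affine coordinates adapted to the cone, and the local extension *)

Section AffineChange.
Context {R : realType}.
Variable n : nat.
Notation V := ('rV[R]_n.+1).

Lemma continuous_mulmxr (Q : 'M[R]_n.+1) : continuous (mulmxr Q : V -> V).
Proof.
apply: bounded_linear_continuous; apply/linear_boundedP.
exists (\sum_i \sum_j `|Q i j|); split; first exact: num_real.
move=> r hr x /=; apply: le_trans (mulmx_norm_le _ _) _.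
by rewrite ler_wpM2r// ltW.
Qed.

Lemma differentiable_affine (Q : 'M[R]_n.+1) (x0 x : V) :
  differentiable (fun x => (x - x0) *m Q) x.
Proof.
have -> : (fun x => (x - x0) *m Q) = (mulmxr Q : V -> V) - cst (x0 *m Q).
  by apply/funext => z; rewrite mulmxBl.
apply: differentiableB; last exact: differentiable_cst.
exact/linear_differentiable/continuous_mulmxr.
Qed.

Lemma continuous_affine (Q : 'M[R]_n.+1) (x0 : V) : continuous (fun x : V => (x - x0) *m Q).
Proof. by move=> x; exact: differentiable_continuous (differentiable_affine Q x0 x). Qed.

Lemma iterD_affine (Q : 'M[R]_n.+1) (x0 : V) (g : V -> R) vs :
  iterD vs (fun x => g ((x - x0) *m Q)) =
  fun x => iterD [seq v *m Q | v <- vs] g ((x - x0) *m Q).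
Proof.
elim: vs => [//|v vs IH] /=; rewrite IH; apply/funext => x.
set G := iterD _ g.
have e : (fun h : R => h^-1 *: (((fun x => G ((x - x0) *m Q)) \o shift x) (h *: v) -
    G ((x - x0) *m Q))) =
  (fun h : R => h^-1 *: ((G \o shift ((x - x0) *m Q)) (h *: (v *m Q)) - G ((x - x0) *m Q))).
  by apply/funext => h /=; rewrite -addrA mulmxDl -scalemxAl.
by rewrite /derive e.
Qed.

Lemma smooth_affine (Q : 'M[R]_n.+1) (x0 : V) (g : V -> R) :
  smooth_on setT g -> smooth_on setT (fun x => g ((x - x0) *m Q)).
Proof.
move=> sg vs x _; rewrite iterD_affine.
apply: (@differentiable_comp _ _ _ _ (fun x => (x - x0) *m Q)); first exact: differentiable_affine.
exact: sg.
Qed.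

End AffineChange.

Section LocalExtension.
Context {R : realType}.
Variables (n : nat) (M : nat -> R) (X : set 'rV[R]_n.+1) (f : 'rV[R]_n.+1 -> R).
Notation V := ('rV[R]_n.+1).
Hypotheses (M0 : positive_seq M) (Mlc : log_convex M) (Mnq : non_quasianalytic M).
Hypothesis fA : AM_set M X f.

(* With [v0] the last row of [A], the rows of [Bmat A sg ka] are the vectors
   [sg *: (v0 + ka *: row l A)]: a basis inside the cone of directions around [v0]. *)
Definition Bmat (A : 'M[R]_n.+1) (sg ka : R) : 'M[R]_n.+1 :=
  sg *: ((ka%:M + (const_mx 1 : 'cV_n.+1) *m (delta_mx ord0 ord_max : V)) *m A).

Lemma mul_Bmat A sg ka (w : V) : w *m Bmat A sg ka =
  (sg * ka) *: (w *m A) + (sg * \sum_l w ord0 l) *: (delta_mx ord0 ord_max *m A).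
Proof.
rewrite /Bmat -scalemxAr mulmxA mulmxDr mulmxDl scalerDr; congr (_ + _).
  by rewrite mul_mx_scalar -scalemxAl scalerA.
rewrite mulmxA -scalerA; congr (_ *: _).
have -> : w *m const_mx 1 = (\sum_l w ord0 l)%:M :> 'M[R]_1.
  apply/matrixP => i j; rewrite !ord1 !mxE eqxx mulr1n.
  by apply: eq_bigr => l _; rewrite mxE mulr1.
by rewrite mul_scalar_mx -scalemxAl.
Qed.

(** [J] is idempotent, so the inverse of ka + J is (1 - J/(1 + ka))/ka. *)
Lemma Bmat_unit A sg ka : A \in unitmx -> 0 < sg -> 0 < ka -> Bmat A sg ka \in unitmx.
Proof.
move=> uA sg0 ka0; rewrite unitmxZ ?unitfE ?gt_eqF// unitmx_mul uA andbT.
set J : 'M[R]_n.+1 := const_mx 1 *m delta_mx ord0 ord_max.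
have JJ : J *m J = J.
  rewrite /J mulmxA -[_ *m const_mx 1]mulmxA.
  suff -> : (delta_mx ord0 ord_max : V) *m const_mx 1 = 1%:M :> 'M[R]_1 by rewrite mulmx1.
  apply/matrixP => i j; rewrite !ord1 !mxE eqxx (bigD1 ord_max)//= big1 ?addr0.
    by rewrite !mxE !eqxx mulr1.
  by move=> l /negPf hl; rewrite !mxE hl andbF mul0r.
have : (ka%:M + J) *m (ka^-1 *: (1%:M - (1 + ka)^-1 *: J)) = 1%:M.
  rewrite -scalemxAr mulmxDl !mulmxBr !mulmx1 -!scalemxAr JJ mul_scalar_mx scalerA.
  rewrite -[_ + _ + _]addrA [- _ + _]addrC -addrA.
  have -> : J + (- ((1 + ka)^-1 *: J) - ((1 + ka)^-1 * ka) *: J) = 0.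
    rewrite addrA -[X in X - _ - _]scale1r -!scalerBl.
    have -> : 1 - (1 + ka)^-1 - (1 + ka)^-1 * ka = 0 by field; rewrite gt_eqF// addr_gt0.
    by rewrite scale0r.
  by rewrite addr0 scale_scalar_mx mulVf// gt_eqF.
by case/mulmx1_unit.
Qed.

Lemma local_smooth_extension x0 : lipschitz_set X -> X x0 -> exists U g, local_ext X f x0 U g.
Proof.
move=> XL Xx0.
have [A [r [d [e [uA r0 d0 e0 cX]]]]] := lipschitz_local_cone XL Xx0.
set v0 : V := delta_mx ord0 ord_max *m A in cX.
have [eta [C [rho [eta0 C0 rho0 hray]]]] := ray_lemma M0 Mlc Mnq fA Xx0 r0 d0 e0 cX.
pose nA : R := \sum_i \sum_j `|A i j|.
have nA0 : 0 <= nA by apply: sumr_ge0 => i _; apply: sumr_ge0.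
pose ka := r / 2 / (nA + 1).
have ka0 : 0 < ka by rewrite !divr_gt0// ltr_wpDl.
have kaA : ka * nA <= r / 2.
  by rewrite /ka mulrAC ler_pdivrMr ?ltr_wpDl// ler_wpM2l ?divr_ge0 ?(ltW r0)// lerDl.
(* [K] bounds the linear map and [sg] rescales it so that the cube [|w| <= 13] lands in the ball of
   radius [eta] in which [ray_lemma] is available. *)
pose K := ka * nA + n.+1%:R * `|v0| + 1.
have K0 : 0 < K by rewrite /K ltr_wpDl// addr_ge0// mulr_ge0// ltW.
pose sg := eta / (13 * (n.+1%:R * (K + 1))).
have sg0 : 0 < sg by rewrite divr_gt0// !mulr_gt0// ltr_wpDl// ltW.
have sgK : 13 * n.+1%:R * sg * (K + 1) = eta.
  have -> : 13 * n.+1%:R * sg * (K + 1) = sg * (13 * (n.+1%:R * (K + 1))) by ring.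
  by rewrite /sg divfK// gt_eqF// !mulr_gt0// ltr_wpDl// ltW.
clearbody sg ka.
set B := Bmat A sg ka.
have uB : B \in unitmx by exact: Bmat_unit.
have BE (w : V) : w *m B = (sg * ka) *: (w *m A) + (sg * \sum_l w ord0 l) *: v0.
  exact: mul_Bmat.
have n1 : 1 <= n.+1%:R :> R by rewrite ler1n.
have sg13 : 13 * sg < eta.
  rewrite -sgK -!mulrA ltr_pM2l// mulrCA ltr_pMr//.
  by apply: (lt_le_trans (_ : 1 < K + 1)); [rewrite ltrDr|rewrite ler_peMl// addr_ge0// ltW].
have Bnorm (w : V) : `|w| <= 13 -> `|w *m B| < eta.
  move=> w13; rewrite BE; apply: le_lt_trans (ler_normD _ _) _.
  rewrite !normrZ ?normrM (gtr0_norm sg0) (gtr0_norm ka0).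
  have h1 : `|w *m A| <= nA * 13.
    by apply: le_trans (mulmx_norm_le _ _) _; rewrite ler_wpM2l.
  have h2 : `|\sum_l w ord0 l| <= n.+1%:R * 13.
    apply: le_trans (ler_norm_sum _ _ _) _.
    apply: (@le_trans _ _ (\sum_(l < n.+1) 13)); last by rewrite sumr_const card_ord mulr_natl.
    by apply: ler_sum => l _; apply: le_trans w13; exact: le_coord_norm.
  apply: (@le_lt_trans _ _ (sg * ka * (nA * 13) + sg * (n.+1%:R * 13) * `|v0|)).
    apply: lerD; first by rewrite ler_wpM2l// mulr_ge0// ltW.
    by rewrite ler_wpM2r// ler_wpM2l// ltW.
  apply: (@lt_le_trans _ _ (13 * sg * (K + 1))).
    have -> : sg * ka * (nA * 13) + sg * (n.+1%:R * 13) * `|v0| = 13 * sg * (ka * nA + n.+1%:R * `|v0|) by ring.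
    rewrite ltr_pM2l ?mulr_gt0// /K; lra.
  have q0 : 0 <= 13 * sg * (K + 1).
    by apply: mulr_ge0; [rewrite mulr_ge0// ltW|exact: addr_ge0 (ltW K0) ler01].
  have -> : eta = n.+1%:R * (13 * sg * (K + 1)) by rewrite -sgK; ring.
  by rewrite ler_peMl.
pose Y : set V := [set s | X (x0 + s *m B)].
pose F (s : V) := f (x0 + s *m B).
pose Cd k := sg ^+ k * (C * rho ^+ k * k`!%:R * M (2 * k)%N).
have Cd0 k : 0 <= Cd k by rewrite !mulr_ge0 ?exprn_ge0// ltW.
have close y : `|y| <= 13 -> `|x0 + y *m B - x0| < eta.
  by move=> y13; rewrite addrAC subrr add0r; exact: Bnorm.
have HY (y z : V) : Y y -> `|y| <= 1 -> (forall l, 0 <= z ord0 l - y ord0 l <= 12) -> Y z.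
  move=> Yy y1 zy.
  (* [(z - y) B] is [sg * S] times [v0 + (ka / S) (z - y) A]. The coordinates being nonnegative,
     [|z - y| <= S], so the move from [y] to [z] is a single move along an admissible direction. *)
  pose S := \sum_l (z - y) ord0 l.
  have zl l : 0 <= (z - y) ord0 l <= 12 by rewrite !mxE; exact: zy.
  have S0 : 0 <= S by apply: sumr_ge0 => l _; have /andP[] := zl l.
  have S12 : S <= 12 * n.+1%:R.
    apply: (@le_trans _ _ (\sum_(l < n.+1) 12)); last by rewrite sumr_const card_ord mulr_natr.
    by apply: ler_sum => l _; have /andP[] := zl l.
  have zS : `|z - y| <= S.
    apply: rV_norm_le => // l; have /andP[h _] := zl l; rewrite ger0_norm// /S (bigD1 l)//= lerDl.
    by apply: sumr_ge0 => l' _; have /andP[] := zl l'.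
  rewrite /Y /= -[z](subrK y) mulmxDl BE -/S addrC addrAC [_ + x0]addrC.
  have [S00|Sn0] := eqVneq S 0.
    have -> : z - y = 0 by apply/eqP; rewrite -normr_le0 -S00.
    by rewrite mul0mx S00 scaler0 mulr0 scale0r !addr0.
  have Sp : 0 < S by rewrite lt0r Sn0.
  have vv : `|v0 + (ka / S) *: ((z - y) *m A) - v0| <= r / 2.
    rewrite addrAC subrr add0r normrZ ger0_norm; last by rewrite divr_ge0// ltW.
    apply: le_trans kaA; rewrite -mulrA ler_pM2l// ler_pdivrMl//.
    by apply: le_trans (mulmx_norm_le _ _) _; rewrite mulrC ler_wpM2r.
  have [hX _ _] := hray _ _ Yy (close _ (le_trans y1 (ler1n _ 13))) vv.
  have := hX (sg * S); rewrite scalerDr scalerA.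
  have -> : sg * S * (ka / S) = sg * ka by field.
  rewrite [x0 + _ + y *m B]addrAC [(sg * S) *: v0 + _]addrC; apply.
  rewrite mulr_ge0 ?(ltW sg0)//= -sgK.
  have h1 : sg * S <= sg * (12 * n.+1%:R) by rewrite ler_pM2l.
  apply: le_trans h1 _.
  have h2 : 12 * n.+1%:R * sg <= 13 * n.+1%:R * sg by rewrite !ler_pM2r// ler_nat.
  have h3 : 13 * n.+1%:R * sg <= 13 * n.+1%:R * sg * (K + 1).
    by rewrite ler_peMr ?mulr_ge0 ?(ltW sg0)// lerDr ltW.
  by rewrite mulrC; exact: le_trans h2 h3.
have HJ (y : V) l : Y y -> `|y| <= 13 -> exists u : nat -> R -> R,
  [/\ jet `]0, 13[%classic u, forall k s, 0 < s < 13 -> `|u k s| <= Cd k,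
      forall s, 0 <= s < 13 -> u 0%N s = F (y + s *: delta_mx ord0 l) &
      forall e, 0 < e -> exists2 d, 0 < d & forall s, 0 <= s < d -> `|u 0%N s - u 0%N 0| <= e].
  move=> Yy y13.
  pose v := v0 + ka *: (delta_mx ord0 l *m A).
  have vv : `|v - v0| <= r / 2.
    rewrite /v addrAC subrr add0r normrZ gtr0_norm//.
    apply: le_trans kaA; rewrite ler_pM2l//.
    by apply: le_trans (mulmx_norm_le _ _) _; rewrite ler_piMr// norm_delta.
  have [hX hd hb] := hray _ _ Yy (close _ y13) vv.
  pose phi t := f (x0 + y *m B + t *: v).
  have lB (s : R) : (y + s *: delta_mx ord0 l) *m B = y *m B + (sg * s) *: v.
    have -> : (y + s *: delta_mx ord0 l) *m B = y *m B + s *: (delta_mx ord0 l *m B).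
      by rewrite mulmxDl -scalemxAl.
    congr (_ + _); rewrite BE.
    have -> : \sum_l' (delta_mx ord0 l : V) ord0 l' = 1.
      rewrite (bigD1 l)//= mxE !eqxx big1 ?addr0// => l' /negPf h.
      by rewrite mxE h andbF.
    rewrite mulr1 /v !scalerDr !scalerA addrC; congr (_ *: _ + _ *: _); ring.
  (* The l-th axis is mapped to the ray in direction [v] run at speed [sg]; hence the factor
     [sg ^ k] in [Cd]. *)
  exists (fun k s => sg ^+ k * derive1n k phi (sg * s + 0)); split.
  - apply: (@jet_affine R R `]0, eta[%classic `]0, 13[%classic (fun k => derive1n k phi)).
      by apply: jet_derive1n => k t; rewrite /= in_itv /=; exact: hd.
    move=> t; rewrite /= !in_itv /= addr0 => /andP[t0 t13]; rewrite mulr_gt0//=.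
    by apply: lt_trans sg13; rewrite mulrC ltr_pM2r.
  - move=> k s /andP[s0 s13]; rewrite normrM ger0_norm ?exprn_ge0 ?(ltW sg0)// ler_wpM2l ?exprn_ge0 ?(ltW sg0)//.
    apply: hb; rewrite addr0 mulr_gt0//=.
    by apply: lt_trans sg13; rewrite mulrC ltr_pM2r.
  - by move=> s _; rewrite expr0 mul1r addr0 /F lB addrA.
  move=> ep ep0.
  have [del del0 hdel] := ray_right_continuous M0 Mlc Mnq fA eta0 hX ep0.
  exists (del / sg); first by rewrite divr_gt0.
  move=> s /andP[s0 s1]; rewrite !expr0 !mul1r !addr0 mulr0.
  have -> : derive1n 0 phi 0 = f (x0 + y *m B) by rewrite -[LHS]/(f (x0 + y *m B + 0 *: v)) scale0r addr0.
  apply: hdel.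
  by rewrite mulr_ge0 ?(ltW sg0)//= mulrC -ltr_pdivlMr.
have [th [jth th_supp th_bound th1]] := theta_exists M0 Mnq.
have [g [sg' gF]] := smooth_extension Cd0 HY HJ jth th_supp th_bound th1.
exists [set x | `|(x - x0) *m invmx B| < 1], (fun x => g ((x - x0) *m invmx B)); split; last split; last split.
- apply: (@open_comp _ _ (fun x : V => `|(x - x0) *m invmx B|) [set y | y < 1]); last exact: open_lt.
  move=> x _; apply: (@continuous_comp _ _ _ (fun x : V => (x - x0) *m invmx B) Num.norm).
    exact: continuous_affine.
  exact: norm_continuous.
- by rewrite /= subrr mul0mx normr0.
- by move=> vs x _; exact: smooth_affine.
- move=> y Uy Xy.
  have yE : x0 + (y - x0) *m invmx B *m B = y by rewrite mulmxKV// addrC subrK.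
  by rewrite gF ?/F ?/Y /= ?yE// ltW.
Qed.

End LocalExtension.

(** * Globalisation over compact sets *)

Section SecondInclusion.
Context {R : realType}.

Lemma AM_set_sub_CN_set n (M : nat -> R) (X : set 'rV[R]_n.+1) :
  positive_seq M -> log_convex M -> non_quasianalytic M -> lipschitz_set X ->
  AM_set M X `<=` CN_set (fun k => M (2 * k)%N) X.
Proof.
move=> M0 Mlc Mnq XL f fA; split=> [x Xx|K KX cK].
  exact: local_smooth_extension M0 Mlc Mnq fA x XL Xx.
(* Both constants are merged into one parameter, in which the bound is monotone. Local bounds then
   hold for all large [a], the form that the covering argument needs. *)
pose P (a : R) (x : 'rV[R]_n.+1) := X x -> forall U g vs, local_ext X f x U g ->
  (forall v, v \in vs -> eucl v <= 1) ->
  `|iterD vs g x| <= a * a ^+ size vs * (size vs)`!%:R * M (2 * size vs)%N.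
have : \forall a \near +oo, K `<=` P a.
  move/compact_near_coveringP: cK; apply=> x Kx; have Xx := KX _ Kx.
  have [A [r [d [e [_ r0 d0 e0 cX]]]]] := lipschitz_local_cone XL Xx.
  have [eta [C [rho [eta0 C0 rho0 hb]]]] := derivative_bound M0 Mlc Mnq fA Xx r0 d0 e0 cX.
  exists ([set y | `|y - x| < eta], [set a | Num.max C rho < a]); first split.
  - apply/nbhs_ballP; exists eta => // y.
    by rewrite -ball_normE /= distrC.
  - by apply: nbhs_pinfty_gt; exact: num_real.
  move=> [y a] /= [yx]; rewrite gt_max => /andP[Ca rhoa] Xy U g vs ext vs1.
  apply: le_trans (hb _ _ _ _ Xy yx ext vs1) _.
  rewrite ler_wpM2r ?(ltW (M0 _))// ler_wpM2r//.
  apply: ler_pM; rewrite ?exprn_ge0 ?(ltW C0) ?(ltW rho0) ?(ltW Ca)//.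
  by rewrite lerXn2r ?nnegrE ?(ltW rho0) ?(ltW rhoa)// (le_trans (ltW rho0) (ltW rhoa)).
move=> hK.
have [a [a0 Pa]] : exists a : R, 0 < a /\ K `<=` P a.
  near +oo_R => a; exists a; split; first by near: a; exact: nbhs_pinfty_gt.
  by near: a.
exists a, a; split=> //; split=> // k x U g vs Kx ext <- vs1.
exact: (Pa _ Kx (KX _ Kx) U g vs).
Unshelve. all: by end_near. Qed.

End SecondInclusion.

Theorem theorem1p19 (R : realType) (n : nat) (M : nat -> R)
    (X : set 'rV[R]_n.+1) :
  positive_seq M -> log_convex M -> non_quasianalytic M -> lipschitz_set X ->
  CN_set M X `<=` AM_set M X /\
  AM_set M X `<=` CN_set (fun k => M (2 * k)%N) X.
Proof.
move=> M0 Mlc Mnq XL; split; first exact: CN_set_sub_AM_set.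
exact: AM_set_sub_CN_set.
Qed.
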